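(* Let $A\in\mathcal A$ with $w_0\in D_A$ and $r_A$ large enough that $[0,1]\cap\beta=\emptyset$, and let $a,b\in\partial_eA$ be distinct. Then \[ P(a,b;A)=\bar q_A\,\exp\{2m(\mathcal J_A)\}\,\Phi_A(a,b). \]
   Context: Domains. Identify $\mathbb Z^2$ with $\mathbb Z+i\mathbb Z\subset\mathbb C$; $w_0=\frac12-\frac i2$. $\mathcal A$ is the set of finite $A\subset\mathbb Z^2$ with $0\in A$ such that $A$ and $\mathbb Z^2\setminus A$ are connected subgraphs. $\mathcal S_z=\{z+x+iy:|x|,|y|\le\frac12\}$, $D_A=\mathrm{int}\left[\bigcup_{z\in A}\mathcal S_z\right]$. $\partial_eA$ is the set of ordered pairs $a=[a_-,a_+]$ with $a_-\in A$, $a_+\notin A$, $|a_--a_+|=1$; $a$ also denotes the midpoint $(a_-+a_+)/2\in\partial D_A$. $f_A:D_A\to\mathbb D$ is the conformal map with $f_A(w_0)=0$, $f_A'(w_0)>0$ (extended to the boundary); $r_A=f_A'(w_0)^{-1}$; $\beta=f_A^{-1}([0,1))$ is the branch cut. LERW probability. $\mathcal W(A;a,b)$ is the set of nearest-neighbor walks $\omega=[\omega_0,\dots,\omega_\tau]$ with $[\omega_0,\omega_1]=[a_+,a_-]$, $[\omega_{\tau-1},\omega_\tau]=[b_-,b_+]$, $\omega_1,\dots,\omega_{\tau-1}\in A$; $p(\omega)=4^{-\tau}$; $H_{\partial A}(a,b)=\sum_{\omega\in\mathcal W(A;a,b)}p(\omega)$. $L(\omega)$ is the chronological loop-erasure (erase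 loops of $[\omega_1,\dots,\omega_{\tau-1}]$, keeping the two boundary edges). $P(a,b;A)=H_{\partial A}(a,b)^{-1}\sum p(\omega)$, the sum over $\omega\in\mathcal W(A;a,b)$ such that $L(\omega)$ traverses $[0,1]$ or $[1,0]$. Signs. For a curve $\omega(t)$, $0\le t\le T$, in $\overline{D_A}$ avoiding $w_0$, let $\Theta_t$ be a continuous version of $\arg f_A(\omega(t))$, $J(\omega)=\lfloor\Theta_T/2\pi\rfloor-\lfloor\Theta_0/2\pi\rfloor$, and $Q(\omega)=(-1)^{J(\omega)}$. Lattice walks are regarded as continuous curves by unit-speed linear interpolation; $q(\omega)=p(\omega)Q(\omega)$, with $p(\omega)=4^{-|\omega|}$ where $|\omega|$ is the number of steps. Loop measure. A rooted loop is a nearest-neighbor walk $\ell=[\ell_0,\dots,\ell_k]$ with $\ell_0=\ell_k$, $k>0$; an unrooted loop $[\ell]$ is an equivalence class under cyclic permutation of the directed-edge sequence; $m([\ell])=\frac{\#[\ell]}{|\ell|}4^{-|\ell|}$, where $\#[\ell]$ is the number of rooted representatives. $\mathcal J_A$ is the set of unrooted loops $\ell\subset A$ with $Q(\ell)=-1$ (equivalently with odd winding number about $w_0$). Other factors. For $B\subset A$, $G^q_B(z,w)=\sum q(\omega)$ over walks $\omega$ from $z$ to $w$ (including the trivial walk if $z=w$) staying in $B$; $\bar q_A=\frac14 G^q_A(0,0)\,G^q_{A\setminus\{0\}}(1,1)$. Let $S$ be simple random walk, $\tau=\inf\{k\ge0:S_k\notin A\}$; $S_\tau=a$ means that $S$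 exits $A$ through the edge $[a_-,a_+]$. $I_a$ is the indicator of $\{S[1,\tau]\cap\{0,1\}=\emptyset,\ S_\tau=a\}$, and $R_A(z,a)=\mathbf E^z\left[Q(S[0,\tau-\frac12])\,I_a\right]$, where $S[0,\tau-\frac12]$ is the interpolated path ending at the midpoint $a$. Finally \[\Phi_A(a,b)=\frac{|R_A(0,a)R_A(1,b)-R_A(0,b)R_A(1,a)|}{H_{\partial A}(a,b)}.\] *)

(* Defs.v *)
From HB Require Import structures.
From mathcomp Require Import all_boot all_order all_algebra finmap.
From mathcomp Require Import all_classical all_reals all_analysis.
From mathcomp Require Export complex.

Set Implicit Arguments.
Unset Strict Implicit.
Unset Printing Implicit Defensive.

Import Order.TTheory GRing.Theory Num.Theory.
Import numFieldNormedType.Exports.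

Local Open Scope classical_set_scope.
Local Open Scope ring_scope.

Notation Z2 := (int * int)%type.
(* the complex line over R, as a normed space over the field R[i] *)
Notation Cx R := (R[i]^o)%type.

Definition o0 : Z2 := (0, 0).
Definition o1 : Z2 := (1, 0).

Definition adj : rel Z2 :=
  fun x y => (`|(x.1 - y.1)%R| + `|(x.2 - y.2)%R| == 1)%N.

Definition lconnected (S : pred Z2) : Prop :=
  forall x y : Z2, S x -> S y ->
    exists p : seq Z2, [/\ path adj x p, all S p & last x p = y].

Definition is_domain (A : {fset Z2}) : Prop :=
  [/\ o0 \in A, lconnected (fun x => x \in A) & lconnected (fun x => x \notin A)].

(* a = [a_-, a_+] is encoded as the pair (a_-, a_+) *)
Definition is_bdedge (A : {fset Z2}) (a : Z2 * Z2) : Prop :=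
  [/\ a.1 \in A, a.2 \notin A & adj a.1 a.2].

(* Sum of an absolutely summable family indexed by the set D, as the difference
   of the sums of the positive and negative parts. *)
Definition rsum (R : realType) (T : choiceType) (D : set T) (u : T -> R) : R :=
  fine (\esum_(x in D) ((u^\+)%R x)%:E) - fine (\esum_(x in D) ((u^\-)%R x)%:E).

Section ConformalMap.
Variable R : realType.

Definition emb (z : Z2) : Cx R := Complex (z.1)%:~R (z.2)%:~R.

Definition w0 : Cx R := Complex 2^-1 (- 2^-1).

Definition square (z : Z2) : set (Cx R) :=
  [set emb z + v | v in
     [set v : Cx R | `|complex.Re v| <= 2^-1 /\ `|complex.Im v| <= 2^-1]].

Definition DA (A : {fset Z2}) : set (Cx R) :=
  interior (\bigcup_(z in [set z | z \in A]) square z).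

(* [derivable f z 1] over the field R[i] is complex differentiability at z, and
   [0 < _] in R[i] says that the number is real and positive.  The boundary of
   DA A is a Jordan curve when A is connected with connected complement, so the
   conformal map has a unique continuous extension to the closure; values of f
   outside the closure are irrelevant. *)
Definition is_conformal (A : {fset Z2}) (f : Cx R -> Cx R) : Prop :=
  [/\ set_bij (DA A) [set w : Cx R | `|w| < 1] f,
      forall z, DA A z -> derivable f z 1,
      f w0 = 0,
      0 < derive1 f w0
    & {within closure (DA A), continuous f}].

Definition branch_cut (A : {fset Z2}) (f : Cx R -> Cx R) : set (Cx R) :=
  [set z | DA A z /\ 0 <= f z < 1].

Definition edge01 : set (Cx R) :=
  [set (x%:C)%C | x in [set x : R | 0 <= x <= 1]].

End ConformalMap.

Section Signs.
Variables (R : realType) (f : Cx R -> Cx R).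

Definition is_arg_lift (g : R -> Cx R) (T : R) (Theta : R -> R) : Prop :=
  {within `[0, T], continuous Theta} /\
  forall t : R, 0 <= t <= T ->
    f (g t) = `|f (g t)| * Complex (cos (Theta t)) (sin (Theta t)).

(* Two lifts differ by a constant multiple of 2 pi, so J does not depend on
   which one is selected. *)
Definition arg_lift (g : R -> Cx R) (T : R) : R -> R :=
  xget (fun=> 0) [set Theta | is_arg_lift g T Theta].

Definition J (g : R -> Cx R) (T : R) : int :=
  Num.floor (arg_lift g T T / (2 * pi)) - Num.floor (arg_lift g T 0 / (2 * pi)).

Definition Q (g : R -> Cx R) (T : R) : R := (-1) ^ J g T.

Definition interp (s : nat -> Z2) (t : R) : Cx R :=
  let n := Num.truncn t in
  ((1 - (t - n%:R))%:C)%C * emb R (s n) + ((t - n%:R)%:C)%C * emb R (s n.+1).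

(* A walk [w_0, ..., w_n] is the sequence of its n + 1 vertices. *)
Definition nsteps (w : seq Z2) : nat := (size w).-1.

Definition Qw (w : seq Z2) : R := Q (interp (nth o0 w)) (nsteps w)%:R.

Definition pw (w : seq Z2) : R := 4 ^- nsteps w.

Definition qw (w : seq Z2) : R := pw w * Qw w.

Definition walks_in (B : {fset Z2}) (z w : Z2) : set (seq Z2) :=
  [set s | exists t : seq Z2,
     [/\ s = z :: t, path adj z t, {subset s <= B} & last z t = w]].

Definition Gq (B : {fset Z2}) (z w : Z2) : R := rsum (walks_in B z w) qw.

Definition qbar (A : {fset Z2}) : R :=
  4^-1 * Gq A o0 o0 * Gq (A `\ o0)%fset o1 o1.

(* The rooted loop [l_0, ..., l_k] with l_k = l_0 and k > 0 is encoded by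
   [:: l_0; ...; l_(k-1)], so that |l| is the size of the sequence and cyclic
   permutations of the edges of l are rotations of this sequence. *)
Definition rooted_loop : set (seq Z2) := [set l | l != [::] /\ cycle adj l].

Definition loop_class (l : seq Z2) : set (seq Z2) :=
  [set l' | exists i : nat, l' = rot i l].

Definition unrooted_loop : set (set (seq Z2)) :=
  [set loop_class l | l in rooted_loop].

(* All elements of an unrooted loop have the same length. *)
Definition loop_length (c : set (seq Z2)) : nat := size (xget [::] c).

Definition loop_measure (c : set (seq Z2)) : R :=
  #|` fset_set c|%:R / (loop_length c)%:R * 4 ^- loop_length c.

Definition JA (A : {fset Z2}) : set (set (seq Z2)) :=
  [set c | unrooted_loop c /\
     forall l, c l -> {subset l <= A} /\ Qw (rcons l (head o0 l)) = -1].

Definition mJA (A : {fset Z2}) : R := rsum (JA A) loop_measure.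

End Signs.

Section LERW.
Variables (R : realType) (A : {fset Z2}) (a b : Z2 * Z2).

Definition bd_walks : set (seq Z2) :=
  [set w | let tau := nsteps w in
     [/\ [/\ (0 < tau)%N, nth o0 w 0 = a.2 & nth o0 w 1 = a.1],
         nth o0 w tau.-1 = b.1 /\ nth o0 w tau = b.2,
         sorted adj w
       & forall i, (0 < i < tau)%N -> nth o0 w i \in A]].

Definition Hbd : R := rsum bd_walks (@pw R).

(* [shorten x s] keeps x and restarts after the last visit to x, recursively;
   x :: shorten x s is the chronological loop-erasure of x :: s. *)
Definition loop_erase (s : seq Z2) : seq Z2 :=
  if s is x :: s' then x :: shorten x s' else [::].

(* loop-erases w_1, ..., w_(tau-1) and keeps the first and last edges *)
Definition L (w : seq Z2) : seq Z2 :=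
  if w is x :: s then x :: rcons (loop_erase (belast (head o0 s) (behead s))) (last x s)
  else [::].

Definition traverses01 (w : seq Z2) : bool :=
  infix [:: o0; o1] w || infix [:: o1; o0] w.

Definition P_LERW : R :=
  Hbd^-1 * rsum [set w | bd_walks w /\ traverses01 (L w)] (@pw R).

End LERW.

Section RandomWalk.
Variables (R : realType) (d : measure_display) (Om : measurableType d).

(* S is simple random walk started at z: every nearest-neighbor path from z with
   n steps is followed up to time n with probability 4^-n. *)
Definition is_srw (Pr : probability Om R) (S : nat -> Om -> Z2) (z : Z2) : Prop :=
  (forall k v, measurable [set o | S k o = v]) /\
  forall s : seq Z2, path adj z s ->
    Pr [set o | forall k, (k <= size s)%N -> S k o = nth o0 (z :: s) k]
      = (4 ^- size s)%:E.

(* The default value 0 is used on the null event that A is never left;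
   this event is excluded from [exits] since o0 \in A. *)
Definition exit_time (A : {fset Z2}) (s : nat -> Z2) : nat :=
  xget 0%N [set n | s n \notin A /\ forall k, (k < n)%N -> s k \in A].

Definition exits (A : {fset Z2}) (a : Z2 * Z2) (s : nat -> Z2) : Prop :=
  let tau := exit_time A s in
  [/\ (0 < tau)%N, s tau.-1 = a.1, s tau = a.2
    & forall k, (1 <= k <= tau)%N -> s k \notin [:: o0; o1]].

(* Q(S[0, tau - 1/2]) I_a on the trajectory s *)
Definition signed_exit (f : Cx R -> Cx R) (A : {fset Z2}) (a : Z2 * Z2)
    (s : nat -> Z2) : R :=
  Q f (interp s) ((exit_time A s)%:R - 2^-1) * (`[< exits A a s >])%:R.

Definition RA (f : Cx R -> Cx R) (Pr : Z2 -> probability Om R)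
    (S : nat -> Om -> Z2) (A : {fset Z2}) (z : Z2) (a : Z2 * Z2) : R :=
  fine 'E_(Pr z)[fun o => signed_exit f A a (S^~ o)]%E.

Definition Phi (f : Cx R -> Cx R) (Pr : Z2 -> probability Om R)
    (S : nat -> Om -> Z2) (A : {fset Z2}) (a b : Z2 * Z2) : R :=
  let r := RA f Pr S A in
  `|r o0 a * r o1 b - r o0 b * r o1 a| / Hbd R A a b.

End RandomWalk.

(* Main.v *)
(** The partition function H cancels, so the claim compares unnormalized sums.
    Chronological loop erasure turns the numerator into a sum over self-avoiding
    paths eta from a to b through the edge 01, each weighted by 4^-|eta| times
    the ratio Z(A) / Z(A \ eta) of loop partition functions.  On the other side,
    the determinant of the R's is, by Fomin's identity, a signed sum over pairs
    of disjoint paths from {0, 1} to {a, b}, that is over the same eta, with the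
    signed weights q and the partition functions Z^q; the factors
    qbar exp(2m) convert between Z and Z^q.  Since f winds once around w0,
    the product of the signs around a lattice square is -1 exactly for the
    square centered at w0.  Hence the sign of a closed walk is the parity of its
    winding number about w0.  This gives two topological facts: a loop that
    avoids eta has sign +1, because eta joins w0 to the complement of A, so that
    Z^q(A \ eta) = Z(A \ eta); and the sign of eta depends only on the direction
    in which it crosses 01, so that the signed sum has no cancellation. *)

From HB Require Import structures.
Require Import Defs.
From mathcomp Require Import all_boot all_order all_algebra finmap.
From mathcomp Require Import all_classical all_reals all_analysis.
From mathcomp Require Import zify ring lra.

Set Implicit Arguments.
Unset Strict Implicit.
Unset Printing Implicit Defensive.

Import Order.TTheory GRing.Theory Num.Theory.
Import numFieldNormedType.Exports.

Local Open Scope classical_set_scope.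
Local Open Scope ring_scope.

(** All facts about partition functions rest on one recursion: deleting [z] from [B] divides
    [loopZ w B] by the Green function at [z]. It yields loop erasure, Fomin's identity and $\bar q_A
    = \frac14 Z^q(A)/Z^q(A\setminus\{0,1\})$, where $\frac14$ is the weight of the edge 01, which
    lies on eta but on neither path of a pair. An odd loop enters $\log Z$ with $+$ and $\log Z^q$
    with $-$, whence $e^{2m} = Z(A)/Z^q(A)$.

    The walks of $R_A$ stop at a boundary midpoint. The last half edge has a sign that depends on
    that edge only; both products of the determinant contain the sign of $a$ and the sign of $b$, so
    the absolute value removes them.

    The sign rule for squares uses no contour integral: the signed count of crossings of the cut
    around a rectangle is additive, vanishes where [f] has no zero (by compactness, from small
    rectangles), and is 1 on a small square about $w_0$, where [f] is close to $c(z-w_0)$ with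
    $c>0$. From there on, planar topology is reduced to crossing parities of lattice walks. *)

(** * Power series with bounded coefficients *)

Lemma cvg_pseries_of_bound (R : realType) (c : nat -> R) (r C x : R) :
  0 < r -> (forall k, `|c k| * r ^+ k <= C) -> `|x| < r -> cvgn (pseries c x).
Proof.
move=> r0 cC xr; apply: normed_cvg.
have C0 : 0 <= C.
  by apply: le_trans (cC 0%N); rewrite mulr_ge0 // exprn_ge0 // ltW.
apply: (@series_le_cvg _ _ (geometric C (`|x| / r))) => [k|k|k|].
- exact: normr_ge0.
- by rewrite geometric_ge0 // divr_ge0 // ltW.
- rewrite /geometric /= normrM normrX exprMn exprVn.
  rewrite [leRHS]mulrCA [leLHS]mulrC ler_wpM2l ?exprn_ge0 //.
  by rewrite ler_pdivlMr ?exprn_gt0.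
- apply: is_cvg_geometric_series.
  by rewrite normf_div normr_id (gtr0_norm r0) ltr_pdivrMr // mul1r.
Qed.

(** Each of the $k+1$ terms of $1+x+\dots+x^k$ is at least $x^k$. This absorbs the factor produced
    by differentiating a power series. *)
Lemma natr_expr_le (R : realFieldType) (x : R) k : 0 < x -> x < 1 ->
  k.+1%:R * x ^+ k <= (1 - x)^-1.
Proof.
move=> x0 x1; rewrite -ler_pdivlMr ?exprn_gt0 //.
elim: k => [|k IH].
  by rewrite expr0 divr1 invf_ge1 ?subr_gt0 // lerBlDr lerDl ltW.
rewrite -natr1; apply: (le_trans (lerD IH (_ : 1 <= x ^- k.+1))).
  by rewrite invf_ge1 ?exprn_gt0 // exprn_ile1 // ltW.
have y0 : 0 < x ^- k.+1 by rewrite invr_gt0 exprn_gt0.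
have -> : x ^- k = x * x ^- k.+1.
  by rewrite exprS invfM mulVKf // gt_eqF.
rewrite -subr_ge0; have D : 1 - x != 0 by rewrite subr_eq0 gt_eqF.
by rewrite opprD addrA -mulrBr -{1}[x ^- k.+1]mul1r -mulrBl mulKf // subrr.
Qed.

Lemma pseries_diffs_bound (R : realType) (c : nat -> R) (r s C : R) :
  0 < s -> s < r -> (forall k, `|c k| * r ^+ k <= C) ->
  exists C', forall k, `|pseries_diffs c k| * s ^+ k <= C'.
Proof.
move=> s0 sr cC; have r0 := lt_trans s0 sr.
exists (C / r * (1 - s / r)^-1) => k.
have -> : `|pseries_diffs c k| * s ^+ k =
  (`|c k.+1| * r ^+ k.+1) / r * (k.+1%:R * (s / r) ^+ k).
  rewrite /pseries_diffs normrM normr_nat exprMn exprVn exprSr.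
  have rk : r ^+ k != 0 by rewrite expf_neq0 // gt_eqF.
  by have r1 : r != 0; [rewrite gt_eqF|field; rewrite r1 rk].
apply: ler_pM.
- by rewrite divr_ge0 ?mulr_ge0 ?exprn_ge0 // ltW.
- by rewrite mulr_ge0 ?exprn_ge0 ?divr_ge0 // ltW.
- by rewrite ler_pM2r ?invr_gt0.
- by rewrite natr_expr_le ?divr_gt0 // ltr_pdivrMr // mul1r.
Qed.

Lemma is_derive_pseries (R : realType) (c : nat -> R) (r C x : R) :
  0 < r -> (forall k, `|c k| * r ^+ k <= C) -> `|x| < r ->
  is_derive x 1 (fun t => limn (pseries c t)) (limn (pseries (pseries_diffs c) x)).
Proof.
move=> r0 cC xr.
have x0 := normr_ge0 x.
(* Quarter points between [|x|] and [r]: $|x| < K < s_2 < s_1 < r$. Each differentiation costs some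
   radius, and the series and its first two derived series must all converge at [K]. *)
pose s1 := (`|x| + 3 * r) / 4; pose s2 := (`|x| + r) / 2.
pose K := (3 * `|x| + r) / 4.
have [s10 s1r] : 0 < s1 /\ s1 < r by rewrite /s1; split; lra.
have [s20 s21] : 0 < s2 /\ s2 < s1 by rewrite /s1 /s2; split; lra.
have [K0 [Ks2 xK]] : 0 < K /\ K < s2 /\ `|x| < K by rewrite /K /s2; split; [|split]; lra.
have nK : `|K| = K by rewrite gtr0_norm.
have [C1 c1] := pseries_diffs_bound s10 s1r cC.
have [C2 c2] := pseries_diffs_bound s20 s21 c1.
apply: (pseries_snd_diffs (K := K)).
- by apply: (cvg_pseries_of_bound r0 cC); rewrite nK; lra.
- by apply: (cvg_pseries_of_bound s10 c1); rewrite nK; lra.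
- by apply: (cvg_pseries_of_bound s20 c2); rewrite nK; lra.
- by rewrite nK.
Qed.
Lemma cvg_bigsum (R : realType) (T : Type) (F : set_system T) (FF : Filter F)
    (I : eqType) (s : seq I) (f : I -> T -> R) (l : I -> R) :
  (forall i, i \in s -> f i x @[x --> F] --> l i) ->
  (\sum_(i <- s) f i x) @[x --> F] --> \sum_(i <- s) l i.
Proof.
elim: s => [|i s IH] fl.
  by rewrite big_nil; under eq_fun do rewrite big_nil; exact: cvg_cst.
rewrite big_cons; under eq_fun do rewrite big_cons; apply: cvgD.
  by apply: fl; rewrite mem_head.
by apply: IH => j js; apply: fl; rewrite in_cons js orbT.
Qed.

Lemma cvgn_eq (R : realType) (u : nat -> R) (a b : R) :
  u @ \oo --> a -> u @ \oo --> b -> a = b.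
Proof. by move=> ua ub; rewrite -(cvg_lim _ ua) // (cvg_lim _ ub). Qed.

(** * Algebra of resolvents *)

Section Resolvent.
Variables (S : pzRingType) (W : S).

(** [E] is the projection onto a vertex set and [W] the step operator: [g] is a two-sided inverse of
    $E-EWE$ in the corner ring of the idempotent [E], that is, the Green function of the walk killed
    outside the set. *)
Definition resolvent (E g : S) : Prop :=
  [/\ E * E = E, g = E + E * W * g & g = E + g * W * E].

Lemma resolvent_idl E g : resolvent E g -> E * g = g.
Proof. by case=> EE gl _; rewrite {1}gl mulrDr !mulrA EE -gl. Qed.

Lemma resolvent_idr E g : resolvent E g -> g * E = g.
Proof. by case=> EE _ gr; rewrite {1}gr mulrDl EE -!mulrA EE !mulrA -gr. Qed.

(** A walk that may use the extra vertex [e] either avoids it or is cut at its last visit there: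
    [g * e] up to that visit, then nothing, or one step followed by a walk counted by [g']. *)
Lemma resolvent_update E e g g' :
  resolvent (E + e) g -> resolvent E g' -> E * e = 0 -> e * E = 0 -> e * e = e ->
  g = g' + g * e * (1 + W * g').
Proof.
move=> rg rg' Ee eE ee.
have gE := resolvent_idr rg; have Eg' := resolvent_idl rg'.
have eg' : e * g' = 0 by rewrite -Eg' mulrA eE mul0r.
have Fg' : (E + e) * g' = g' by rewrite mulrDl Eg' eg' addr0.
have [_ _ gr] := rg; have [_ gl' _] := rg'.
have h1 : g * W * g' = g * g' - g'.
  rewrite -{1}Fg' mulrA.
  have -> : g * W * (E + e) = g - (E + e) by apply/eqP; rewrite eq_sym subr_eq addrC -gr.
  by rewrite mulrBl Fg'.
have h2 : E * W * g' = g' - E by apply/eqP; rewrite eq_sym subr_eq addrC -gl'.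
have h3 : g * W * g' = g * (g' - E) + g * e * (W * g').
  by rewrite -{1}gE mulrDr !mulrDl -h2 !mulrA.
have h4 : g * E = g' + g * e * (W * g').
  move: h3; rewrite h1 mulrBr -addrA => /addrI E0.
  by rewrite -[X in _ = _ + X](addNKr (g * E)) -E0 addrCA subrr addr0.
by rewrite mulrDr mulr1 addrCA -h4 addrC -mulrDr gE.
Qed.

Lemma resolvent_row E e g g' :
  resolvent (E + e) g -> resolvent E g' -> E * e = 0 -> e * E = 0 -> e * e = e ->
  e * g = e * g * e * (1 + W * g').
Proof.
move=> rg rg' Ee eE ee; rewrite {1}(resolvent_update rg rg' Ee eE ee) mulrDr.
by rewrite -{1}(resolvent_idl rg') [e * (E * _)]mulrA eE mul0r add0r !mulrA.
Qed.

(** The second resolvent identity; the derivative of the Green function with respect to the strength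
    of the weights comes from it. *)
Lemma resolvent_diff E g g' (W' : S) :
  g = E + E * W * g -> g * E = g -> E * g' = g' -> E * g = g -> g = E + g * W * E ->
  g' = E + E * W' * g' -> g' - g = g * (W' - W) * g'.
Proof.
move=> gl gE Eg' Eg gr g'l.
have a : g * W' * g' = g * g' - g.
  by rewrite -{1}gE -!mulrA; rewrite {2}g'l mulrDr gE !mulrA addrAC subrr add0r.
have b : g * W * g' = g * g' - g'.
  by rewrite -{1}Eg' mulrA; rewrite {2}gr mulrDl Eg' addrAC subrr add0r.
by rewrite mulrBr mulrBl a b opprB [RHS]addrC addrA subrK.
Qed.
End Resolvent.

(** * Green functions and loop sums of a killed matrix *)

Section GreenMatrix.
Variables (R : realType) (n : nat).
Implicit Types (W : 'M[R]_n) (B : {set 'I_n}).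

Definition mask B : 'M[R]_n := diag_mx (\row_i (i \in B)%:R).

Lemma maskE B i j : mask B i j = ((i == j) && (i \in B))%:R.
Proof. by rewrite !mxE; case: eqVneq => [->|_] //=; rewrite mulr1n. Qed.

Lemma mask_mulE B (X : 'M[R]_n) i j : (mask B * X) i j = (i \in B)%:R * X i j.
Proof. by rewrite -mulmxE /mask mul_diag_mx !mxE. Qed.

Lemma mul_maskE B (X : 'M[R]_n) i j : (X * mask B) i j = X i j * (j \in B)%:R.
Proof. by rewrite -mulmxE /mask mul_mx_diag !mxE. Qed.

Definition killed_pow W B k : 'M[R]_n := (mask B * W) ^+ k * mask B.

Definition green W B : 'M[R]_n :=
  \matrix_(i, j) limn (series (fun k => killed_pow W B k i j)).

(** The term [k = 0] is 0 because the inverse of 0 is 0. The rest is $-\log\det(1-W_B)$, the total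
    weight of the rooted loops in [B], each divided by its length. *)
Definition loop_sum W B : R :=
  limn (series (fun k => \tr (killed_pow W B k) / k%:R)).

Lemma mask_idem B : mask B * mask B = mask B.
Proof.
by apply/matrixP => i j; rewrite mask_mulE !maskE; case: (i \in B); rewrite ?mul1r ?mul0r ?andbF.
Qed.

Lemma killed_pow0 W B : killed_pow W B 0 = mask B.
Proof. by rewrite /killed_pow expr0 mul1r. Qed.

Lemma killed_powSl W B k : killed_pow W B k.+1 = mask B * W * killed_pow W B k.
Proof. by rewrite /killed_pow exprS mulrA. Qed.

Lemma killed_powSr W B k : killed_pow W B k.+1 = killed_pow W B k * W * mask B.
Proof. by rewrite /killed_pow exprSr !mulrA. Qed.

Lemma killed_powZ (t : R) W B k : killed_pow (t *: W) B k = t ^+ k *: killed_pow W B k.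
Proof.
elim: k => [|k IH]; first by rewrite !killed_pow0 scale1r.
by rewrite !killed_powSl IH -!mulmxE -!scalemxAr -!scalemxAl scalerA -exprSr.
Qed.

Section Decay.
Variables (P : 'M[R]_n) (h : 'I_n -> R) (rho : R).
Hypothesis h1 : forall i, 1 <= h i.
Hypothesis rho0 : 0 < rho.
Hypothesis P0 : forall i j, 0 <= P i j.
Hypothesis Ph : forall i, \sum_j P i j * h j <= rho * h i.

Definition decay_const : R := \sum_i h i.

(** [P] contracts by [rho] in the norm weighted by the supersolution [h]; domination by [P] and
    killing can only decrease the entries. *)
Lemma killed_pow_row_bound W B k i : (forall i j, `|W i j| <= P i j) ->
  \sum_j `|killed_pow W B k i j| * h j <= rho ^+ k * h i.
Proof.
move=> WP; elim: k i => [|k IH] i.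
  rewrite expr0 mul1r killed_pow0 (bigD1 i) //= big1 => [|j ji].
    by rewrite maskE eqxx addr0; case: (i \in B); rewrite ?normr1 ?normr0 ?mul1r // mul0r (le_trans ler01).
  by rewrite maskE eq_sym (negbTE ji) normr0 mul0r.
apply: (@le_trans _ _ (\sum_l P i l * \sum_j `|killed_pow W B k l j| * h j)).
  under [leRHS]eq_bigr do rewrite mulr_sumr.
  rewrite exchange_big /=; apply: ler_sum => j _.
  under [leRHS]eq_bigr do rewrite mulrA.
  rewrite -mulr_suml ler_wpM2r ?(le_trans ler01) //.
  rewrite killed_powSl -mulrA mask_mulE mxE normrM.
  apply: (@le_trans _ _ `|\sum_l W i l * killed_pow W B k l j|).
    by rewrite ler_piMl //; case: (i \in B); rewrite ?normr1 ?normr0.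
  apply: le_trans (ler_norm_sum _ _ _) _; apply: ler_sum => l _.
  by rewrite normrM ler_wpM2r.
apply: (@le_trans _ _ (\sum_l P i l * (rho ^+ k * h l))).
  by apply: ler_sum => l _; rewrite ler_wpM2l.
under eq_bigr do rewrite mulrCA.
by rewrite -mulr_sumr exprSr -mulrA ler_wpM2l // exprn_ge0 // ltW.
Qed.

Lemma killed_pow_bound W B k i j : (forall i j, `|W i j| <= P i j) ->
  `|killed_pow W B k i j| * rho^-1 ^+ k <= decay_const.
Proof.
move=> WP; rewrite exprVn ler_pdivrMr ?exprn_gt0 //.
apply: (@le_trans _ _ (rho ^+ k * h i)).
  apply: le_trans (killed_pow_row_bound B k i WP).
  rewrite (bigD1 j) //=; apply: (@le_trans _ _ (`|killed_pow W B k i j| * h j)).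
    by rewrite ler_peMr.
  by rewrite lerDl sumr_ge0 // => l _; rewrite mulr_ge0 // (le_trans ler01).
rewrite mulrC ler_wpM2r ?(exprn_ge0 _ (ltW rho0)) //.
rewrite /decay_const (bigD1 i) //= lerDl.
by rewrite sumr_ge0 // => l _; rewrite (le_trans ler01).
Qed.

Section Dominated.
Variable W : 'M[R]_n.
Hypothesis WP : forall i j, `|W i j| <= P i j.
Let r := rho^-1.
Let r0 : 0 < r. Proof. by rewrite invr_gt0. Qed.

(** Scaling all weights by [t] turns Green functions and loop sums into power series in [t], so that
    identities between them can be proved by differentiating in [t]. *)
Lemma series_killed_powZ (t : R) B i j :
  series (fun k => killed_pow (t *: W) B k i j) = pseries (fun k => killed_pow W B k i j) t.
Proof.
by apply/funext => m; apply: eq_bigr => k _; rewrite killed_powZ mxE mulrC.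
Qed.

Lemma green_cvg (t : R) B i j : `|t| < r ->
  series (fun k => killed_pow (t *: W) B k i j) @ \oo --> green (t *: W) B i j.
Proof.
move=> tr; rewrite mxE series_killed_powZ.
exact: (cvg_pseries_of_bound r0 (fun k => killed_pow_bound B k i j WP) tr).
Qed.

Lemma green_resolvent (t : R) B : `|t| < r ->
  resolvent (t *: W) (mask B) (green (t *: W) B).
Proof.
move=> tr; set V := t *: W.
have lim1 i j : (\sum_(0 <= k < m.+1) killed_pow V B k i j) @[m --> \oo] --> green V B i j.
  by have := green_cvg (B := B) (i := i) (j := j) tr; rewrite -cvg_shiftS.
split; first exact: mask_idem.
- apply/matrixP => i j; apply: (cvgn_eq (lim1 i j)).
  have -> : (fun m => \sum_(0 <= k < m.+1) killed_pow V B k i j) =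
    (fun m => mask B i j + \sum_l (mask B * V) i l * series (fun k => killed_pow V B k l j) m).
    apply/funext => m; rewrite big_nat_recl // killed_pow0; congr (_ + _).
    under eq_bigr do rewrite killed_powSl mxE.
    by rewrite exchange_big /=; apply: eq_bigr => l _; rewrite mulr_sumr.
  rewrite [X in _ --> X]mxE [X in _ --> _ + X]mxE; apply: cvgD; first exact: cvg_cst.
  apply: cvg_bigsum => l _; apply: cvgM; [exact: cvg_cst|exact: green_cvg].
- apply/matrixP => i j; apply: (cvgn_eq (lim1 i j)).
  have -> : (fun m => \sum_(0 <= k < m.+1) killed_pow V B k i j) =
    (fun m => mask B i j + \sum_l series (fun k => killed_pow V B k i l) m * (V * mask B) l j).
    apply/funext => m; rewrite big_nat_recl // killed_pow0; congr (_ + _).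
    under eq_bigr do rewrite killed_powSr -mulrA mxE.
    by rewrite exchange_big /=; apply: eq_bigr => l _; rewrite mulr_suml.
  rewrite [X in _ --> X]mxE -mulrA [X in _ --> _ + X]mxE; apply: cvgD; first exact: cvg_cst.
  apply: cvg_bigsum => l _; apply: cvgM; [exact: green_cvg|exact: cvg_cst].
Qed.

Lemma green_continuous (B : {set 'I_n}) i j (t : R) : `|t| < r ->
  green (s *: W) B i j @[s --> t] --> green (t *: W) B i j.
Proof.
move=> tr.
have E s : green (s *: W) B i j = limn (pseries (fun k => killed_pow W B k i j) s).
  by rewrite mxE series_killed_powZ.
have := is_derive_pseries r0 (fun k => killed_pow_bound B k i j WP) tr.
under eq_fun do rewrite -E.
by case=> /derivable1_diffP/differentiable_continuous.
Qed.

(** Differentiability comes from the power series; the value comes from the second resolvent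
    identity divided by the increment, and from continuity of the Green function in [t]. *)
Lemma is_derive_green B i j (t : R) : `|t| < r ->
  is_derive t 1 (fun s => green (s *: W) B i j)
    ((green (t *: W) B * W * green (t *: W) B) i j).
Proof.
move=> tr; set g := fun s => green (s *: W) B.
have E s : g s i j = limn (pseries (fun k => killed_pow W B k i j) s).
  by rewrite /g mxE series_killed_powZ.
have := is_derive_pseries r0 (fun k => killed_pow_bound B k i j WP) tr.
under eq_fun do rewrite -E.
case=> dU _; split => //.
apply: cvg_lim => //.
have lim0 l m : g (s + t) l m @[s --> (0 : R)^'] --> g t l m.
  apply: (@cvg_comp _ _ _ (fun s => s + t) (fun s => g s l m) _ (nbhs t)).
    apply: cvg_trans (_ : (s + t) @[s --> 0] --> t).
      by apply: cvg_app; exact: nbhs_dnbhs.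
    rewrite -[X in _ --> X]add0r; apply: cvgD => //; exact: cvg_cst.
  exact: green_continuous.
have lim1 : ((g t * W) * g (s + t)) i j @[s --> (0 : R)^'] --> ((g t * W) * g t) i j.
  under eq_fun do rewrite mxE.
  rewrite mxE; apply: cvg_bigsum => l _; apply: cvgM; [exact: cvg_cst|exact: lim0].
apply: cvg_trans lim1; apply: near_eq_cvg.
near=> s.
have s0 : s != 0 by near: s; exact: nbhs_dnbhs_neq.
have str : `|s + t| < r.
  have : `|s| < r - `|t|.
    near: s; apply: dnbhs0_lt; by rewrite subr_gt0.
  by move=> ?; rewrite (le_lt_trans (ler_normD _ _)) //; lra.
have rt := green_resolvent B tr; have rs := green_resolvent B str.
rewrite /= [s *: 1]mulr1.
have := resolvent_diff (let: And3 _ gl _ := rt in gl) (resolvent_idr rt) (resolvent_idl rs)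
  (resolvent_idl rt) (let: And3 _ _ gr := rt in gr) (let: And3 _ gl _ := rs in gl).
rewrite -scalerBl addrK => /matrixP/(_ i j).
move=> D; rewrite (_ : _ - _ = (g (s + t) - g t) i j).
  by rewrite D -!mulmxE -scalemxAr -scalemxAl [X in _ *: X]mxE [RHS]mulKf.
by rewrite [RHS]mxE [X in _ = _ + X]mxE.
Unshelve. all: by end_near. Qed.

Lemma trace_killed_powS B k : \tr (killed_pow W B k.+1) = \tr (W *m killed_pow W B k).
Proof.
rewrite killed_powSl -mulrA -!mulmxE mxtrace_mulC -mulmxA; congr (\tr (W *m _)).
by rewrite mulmxE /killed_pow -mulrA mask_idem.
Qed.

Lemma loop_coef_bound B k :
  `|\tr (killed_pow W B k) / k%:R| * r ^+ k <= \sum_(i < n) decay_const.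
Proof.
apply: (@le_trans _ _ (`|\tr (killed_pow W B k)| * r ^+ k)).
  rewrite ler_wpM2r ?exprn_ge0 ?(ltW r0) // normrM ler_piMr //.
  by case: k => [|k]; rewrite ?invr0 ?normr0 // ger0_norm ?invr_ge0 // invf_le1 // ler1n.
apply: (@le_trans _ _ (\sum_i `|killed_pow W B k i i| * r ^+ k)).
  by rewrite -mulr_suml ler_wpM2r ?exprn_ge0 ?(ltW r0) // ler_norm_sum.
by apply: ler_sum => i _; exact: killed_pow_bound.
Qed.

(** The weight $1/k$ cancels the factor $k$ of the derivative: this is Jacobi's formula for
    $-\log\det(1-tW_B)$. *)
Lemma is_derive_loop_sum B (t : R) : `|t| < r ->
  is_derive t 1 (fun s => limn (pseries (fun k => \tr (killed_pow W B k) / k%:R) s))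
    (\tr (W *m green (t *: W) B)).
Proof.
move=> tr.
have [dU eU] := is_derive_pseries r0 (fun k => loop_coef_bound B k) tr.
split => //; rewrite eU; apply: cvg_lim => //.
have -> : pseries (pseries_diffs (fun k => \tr (killed_pow W B k) / k%:R)) t =
  (fun m => \sum_i \sum_j W i j * series (fun k => killed_pow (t *: W) B k j i) m).
  apply/funext => m; rewrite /pseries /series /=.
  under [RHS]eq_bigr do under eq_bigr do rewrite mulr_sumr.
  under [RHS]eq_bigr do rewrite exchange_big /=.
  rewrite exchange_big /=; apply: eq_bigr => k _.
  rewrite /pseries_diffs mulrCA divff ?pnatr_eq0 // mulr1 trace_killed_powS.
  rewrite mulr_suml; apply: eq_bigr => i _; rewrite mxE mulr_suml.
  by apply: eq_bigr => j _; rewrite killed_powZ [in RHS]mxE -mulrA; congr (_ * _); rewrite mulrC.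
rewrite /mxtrace; under [X in _ --> X]eq_bigr do rewrite mxE.
do 2! apply: cvg_bigsum => ? _.
apply: cvgM; [exact: cvg_cst|exact: green_cvg].
Qed.

Lemma mask_setD1 B z : z \in B -> mask B = mask (B :\ z) + delta_mx z z.
Proof.
move=> zB; apply/matrixP => i j; rewrite [RHS]mxE !maskE mxE in_setD1.
case: (eqVneq i j) => [<-|ij] /=; last first.
  by rewrite add0r; case: eqVneq => //= iz; case: eqVneq => //= jz; rewrite iz jz eqxx in ij.
by rewrite andbb; case: eqVneq => [->|_] /=; rewrite ?zB ?addr0 ?add0r.
Qed.

Lemma mask_delta B z :
  [/\ mask (B :\ z) * delta_mx z z = 0, delta_mx z z * mask (B :\ z) = 0 &
    delta_mx z z * delta_mx z z = delta_mx z z :> 'M[R]_n].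
Proof.
split; last by rewrite -mulmxE mul_delta_mx.
- apply/matrixP => i j; rewrite mask_mulE !mxE in_setD1.
  by case: eqVneq => //= _; rewrite ?mul0r ?mulr0.
- apply/matrixP => i j; rewrite mul_maskE !mxE in_setD1 andbC.
  by case: eqVneq => //= _; rewrite ?mul0r ?mulr0.
Qed.

(** This is Cramer's rule $G_B(z,z)=\det(1-W_{B\setminus z})/\det(1-W_B)$, obtained by
    interpolation: [F] below is 1 at [t = 0], is the ratio of the two sides at [t = 1], and has
    derivative 0. *)
Lemma green_loop_sum B z : z \in B -> 1 < r ->
  expR (loop_sum W B) = green W B z z * expR (loop_sum W (B :\ z)).
Proof.
move=> zB r1; set C := B :\ z; set e : 'M[R]_n := delta_mx z z.
pose Lf D (t : R) : R := limn (pseries (fun k => \tr (killed_pow W D k) / k%:R) t).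
have Lf1 D : loop_sum W D = Lf D 1.
  by rewrite /loop_sum /Lf /pseries; under [in RHS]eq_fun do rewrite expr1n mulr1.
have Lf0 D : Lf D 0 = 0.
  apply: cvg_lim => //; rewrite -cvg_shiftS /=.
  rewrite (_ : (fun m => _) = fun=> 0); first exact: cvg_cst.
  apply/funext => m; rewrite /pseries /series /= big_nat_recl // big1 => [|k _].
    by rewrite invr0 mulr0 mul0r addr0.
  by rewrite expr0n mulr0.
pose U (t : R) : R := green (t *: W) B z z.
have U0 : U 0 = 1.
  have := green_resolvent B (_ : `|0| < r); rewrite normr0 => /(_ r0) [_ + _].
  rewrite !scale0r mulr0 mul0r addr0 => U0.
  by rewrite /U scale0r U0 maskE eqxx zB.
pose F t := U t * expR (Lf C t - Lf B t).
have dF (t : R) : `|t| < r -> is_derive t 1 F 0.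
  move=> tr.
  have rB := green_resolvent B tr; have rC := green_resolvent C tr.
  have [e1 e2 e3] := mask_delta B z.
  rewrite (mask_setD1 zB) in rB.
  have up := resolvent_update rB rC e1 e2 e3.
  have row := resolvent_row rB rC e1 e2 e3.
  have dB := is_derive_loop_sum B tr; have dC := is_derive_loop_sum C tr.
  have dU := is_derive_green B z z tr.
  move: up row dB dC dU; move EB: (green (t *: W) B) => gB; move EC: (green (t *: W) C) => gC.
  set X := (1 + t *: W * gC) => up row dB dC dU.
  have eM (M : 'M[R]_n) j : (e * M) z j = M z j.
    rewrite mxE (bigD1 z) //= big1 => [|l lz].
      by rewrite mxE !eqxx mul1r addr0.
    by rewrite mxE (negbTE lz) andbF mul0r.
  have tre (M : 'M[R]_n) : \tr (e *m M) = M z z.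
    rewrite /mxtrace (bigD1 z) //= big1 => [|l lz]; first by rewrite addr0 mulmxE eM.
    by rewrite mxE big1 // => m _; rewrite mxE (negbTE lz) mul0r.
  (* The update formula shows that $(XWG_B)_{zz}$ is both the logarithmic derivative of [U] and the
     amount by which the trace for [B] exceeds the one for [C]; the two contributions to the
     derivative of [F] cancel. *)
  have tr1 : \tr (W *m gC) - \tr (W *m gB) = - (X * W * gB) z z.
    rewrite {1}up mulmxDr mxtraceD opprD addrA subrr add0r; congr (- _).
    transitivity (\tr ((e *m X) *m (W *m gB))).
      by rewrite [RHS]mxtrace_mulC -!mulmxE !mulmxA.
    by rewrite -mulmxA tre -!mulmxE !mulmxA.
  have dU1 : (gB * W * gB) z z = gB z z * (X * W * gB) z z.
    have -> : (gB * W * gB) z z = (e * gB * (W * gB)) z z by rewrite -eM !mulrA.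
    rewrite row.
    have -> : e * gB * e = gB z z *: e.
      apply/matrixP => i j; rewrite mxE (bigD1 z) //= big1 => [|l lz].
        rewrite [e z j]mxE [RHS]mxE [e i j in RHS]mxE eqxx addr0 /=.
        case: (eqVneq i z) => [->|iz]; first by rewrite eM.
        rewrite mulr0 mxE big1 ?mul0r // => l _.
        by rewrite mxE (negbTE iz) mul0r.
      by rewrite [e l j]mxE (negbTE lz) mulr0.
    by rewrite -!mulmxE -!scalemxAl mxE -!mulmxA [in LHS]mulmxE eM -!mulmxE !mulmxA.
  have dL : is_derive t 1 (fun s => Lf C s - Lf B s) (\tr (W *m gC) - \tr (W *m gB)).
    exact: is_deriveB.
  pose G (s : R) : R := Lf C s - Lf B s.
  have dE := @is_derive1_comp R expR G t _ _ (is_derive_expR (G t)) dL.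
  apply: is_derive_eq (is_deriveM dU dE) _.
  by rewrite dU1 tr1 EB /GRing.scale /=; ring.
have F1 : F 1 = F 0.
  have lt_r (x : R) : 0 <= x <= 1 -> `|x| < r.
    by case/andP=> x0 x1; rewrite ger0_norm //; exact: le_lt_trans r1.
  have [x xi||c _] := @MVT R F (fun=> 0) 0 1 ltr01.
  - by apply: dF; apply: lt_r; rewrite !ltW // (itvP xi).
  - apply: derivable_within_continuous => x xi.
    by have [] := dF x _ => //; apply: lt_r; rewrite !(itvP xi).
  - by rewrite mul0r => /eqP; rewrite subr_eq0 => /eqP.
move: F1; rewrite /F U0 !Lf0 subrr expR0 mulr1 -!Lf1 /U scale1r expRB mulrA => E.
by rewrite -[LHS]mul1r -E mulfVK // gt_eqF // expR_gt0.
Qed.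

(** Unlike in [green], the start [i] may lie outside [B]; only the later vertices are confined to
    it. *)
Definition hit W B i j : R := (i == j)%:R + \sum_l W i l * green W B l j.

Lemma green_update B z i j : z \in B -> 1 < r ->
  green W B i j = green W (B :\ z) i j + green W B i z * hit W (B :\ z) z j.
Proof.
move=> zB r1; have tr : `|1 : R| < r by rewrite normr1.
have := green_resolvent B tr; have := green_resolvent (B :\ z) tr.
rewrite !scale1r => rC rB; rewrite (mask_setD1 zB) in rB.
have [e1 e2 e3] := mask_delta B z.
rewrite {1}(resolvent_update rB rC e1 e2 e3) [LHS]mxE; congr (_ + _).
rewrite -mulrA mxE (bigD1 z) //= big1 => [|l lz].
  rewrite addr0; congr (_ * _); rewrite mxE (bigD1 z) //= big1 => [|l lz].
    rewrite [X in X * _]mxE !eqxx mul1r addr0 [LHS]mxE /hit.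
    by congr (_ + _); rewrite mxE.
  by rewrite [X in X * _]mxE (negbTE lz) andbF mul0r.
rewrite [X in _ * X]mxE big1 ?mulr0 // => m _.
by rewrite [X in X * _]mxE (negbTE lz) mul0r.
Qed.

Lemma green_step B i j : 1 < r -> green W B i j = (i \in B)%:R * hit W B i j.
Proof.
move=> r1; have tr : `|1 : R| < r by rewrite normr1.
have := green_resolvent B tr; rewrite scale1r => -[_ gl _].
rewrite {1}gl [LHS]mxE -mulrA mask_mulE maskE /hit mulrDr; congr (_ + _ * _).
  by rewrite -natrM mulnb andbC.
by rewrite mxE.
Qed.

End Dominated.
End Decay.
End GreenMatrix.

(** * Walks killed on leaving a finite set of vertices *)

Definition nbrs (x : Z2) : seq Z2 :=
  [:: (x.1 + 1, x.2); (x.1 - 1, x.2); (x.1, x.2 + 1); (x.1, x.2 - 1)].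

Lemma adjE x y : adj x y = (y \in nbrs x).
Proof.
case: x y => [x1 x2] [y1 y2]; rewrite /adj /nbrs !inE !xpair_eqE /=.
by apply/idP/idP; lia.
Qed.

Lemma adj_sym x y : adj x y = adj y x.
Proof. by rewrite /adj; apply/idP/idP; lia. Qed.

Lemma nbrs_uniq x : uniq (nbrs x).
Proof. by case: x => x1 x2; rewrite /= !inE !xpair_eqE; lia. Qed.

(** Take $h(x)=M-x_1^2$: its average over the neighbours of $x$ is $h(x)-\frac12$, and $h\le M$
    turns this into the factor $1-1/(2M)$. The constant $M=(N+1)^2+1$ keeps $h\ge1$ on [A] and on
    its neighbours, so discarding the neighbours outside [A] only lowers the sum. *)
Lemma srw_decay (R : realType) (A : {fset Z2}) :
  exists (h : Z2 -> R) (rho : R), [/\ 0 < rho < 1,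
    forall x, x \in A -> 1 <= h x &
    forall x, x \in A -> \sum_(y <- A) (adj x y)%:R / 4 * h y <= rho * h x].
Proof.
have [N NA] : exists N : nat, forall x, x \in A -> (`|x.1| <= N)%N.
  exists (\sum_(x <- A) `|x.1|)%N => x xA.
  by rewrite (big_rem x) //= leq_addr.
pose M : R := (N.+1)%:R ^+ 2 + 1.
have M1 : 1 <= M by rewrite lerDr sqr_ge0.
pose h (x : Z2) : R := M - (x.1)%:~R ^+ 2.
have hN (x : Z2) : (`|x.1| <= N.+1)%N -> 1 <= h x.
  move=> xN; rewrite /h /M addrAC lerDr subr_ge0 -[leLHS]real_normK ?num_real //.
  by rewrite lerXn2r ?nnegrE // -intr_norm -abszE ler_nat.
have N1 x y : x \in A -> y \in nbrs x -> 1 <= h y.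
  by case: x y => [x1 x2] [y1 y2] /NA /= xN; rewrite -adjE /adj /= => yx; apply: hN => /=; lia.
exists h, (1 - (2 * M)^-1); split.
- apply/andP; split; last by rewrite ltrBlDr ltrDl invr_gt0; lra.
  by rewrite subr_gt0 invf_lt1; lra.
- by move=> x /NA xN; apply: hN; exact: leqW.
- move=> x xA.
  apply: (@le_trans _ _ (\sum_(y <- nbrs x) h y / 4)).
    rewrite (bigID (fun y => y \in nbrs x)) /= [X in _ + X]big1 ?addr0 => [|y yN]; last first.
      by rewrite adjE (negbTE yN) mul0r mul0r.
    rewrite [leRHS](bigID (fun y => y \in A)) /= -[leLHS]addr0; apply: lerD; last first.
      by rewrite big_seq_cond sumr_ge0 // => y /andP[/(N1 _ _ xA) hy _]; lra.
    rewrite -big_filter -[leRHS]big_filter le_eqVlt; apply/orP; left; apply/eqP.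
    transitivity (\sum_(y <- [seq y <- nbrs x | y \in A]) (adj x y)%:R / 4 * h y).
      apply: perm_big; apply: uniq_perm; rewrite ?filter_uniq ?nbrs_uniq ?fset_uniq //.
      by move=> y; rewrite !mem_filter andbC.
    rewrite !big_filter big_seq_cond [RHS]big_seq_cond; apply: eq_bigr => y /andP[yn _].
    by rewrite adjE yn mul1r mulrC.
  have hM : h x <= M by rewrite /h lerBlDr lerDl sqr_ge0.
  have : (2 * M)^-1 * h x <= 2^-1.
    by rewrite invfM -mulrA ler_piMr // mulrC ler_pdivrMr ?mul1r; lra.
  move=> hM2; rewrite mulrBl mul1r !big_cons big_nil /h /= !intrD !rmorphN !rmorph1.
  move: hM2; rewrite /h; move: (x.1%:~R : R) ((2 * M)^-1 * _) => c k; lra.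
Qed.

(** The start is not tested against the set, only the vertices after it. Thus [hsum] covers the
    Green function as well as the walks that leave a deleted vertex and never return to it. *)
Fixpoint kpow (R : realType) (w : Z2 -> Z2 -> R) (B : {fset Z2}) k (x y : Z2) : R :=
  if k is k'.+1 then \sum_(u <- B) w x u * kpow w B k' u y else (x == y)%:R.

Definition hsum (R : realType) (w : Z2 -> Z2 -> R) (B : {fset Z2}) (x y : Z2) : R :=
  limn (series (fun k => kpow w B k x y)).

Definition loopZ (R : realType) (w : Z2 -> Z2 -> R) (B : {fset Z2}) : R :=
  expR (limn (series (fun k => (\sum_(x <- B) kpow w B k x x) / k%:R))).

Section KilledWalks.
Variables (R : realType) (w : Z2 -> Z2 -> R).
Hypothesis Hw : forall x y, `|w x y| <= (adj x y)%:R / 4.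

Section Enumeration.
Variable A : {fset Z2}.
Let n := size A.
Let vtx (i : 'I_n) : Z2 := nth o0 A i.
Let W : 'M[R]_n := \matrix_(i, j) w (vtx i) (vtx j).
Let vset (B : {fset Z2}) : {set 'I_n} := [set i | vtx i \in B]%SET.

Let vtxA i : vtx i \in A. Proof. exact: mem_nth. Qed.

Let vtx_inj : injective vtx.
Proof.
by move=> i j /eqP; rewrite nth_uniq ?fset_uniq // => /eqP/val_inj.
Qed.

Let vtx_surj x : x \in A -> exists i, vtx i = x.
Proof.
move=> xA; have h : (index x A < n)%N by rewrite index_mem.
by exists (Ordinal h); rewrite /vtx /= nth_index.
Qed.

Let sum_vtx (F : Z2 -> R) : \sum_(u <- A) F u = \sum_i F (vtx i).
Proof. by rewrite (big_nth o0) big_mkord. Qed.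

Let sum_sub (B : {fset Z2}) (F : Z2 -> R) : {subset B <= A} ->
  \sum_(u <- B) F u = \sum_i (vtx i \in B)%:R * F (vtx i).
Proof.
move=> BA; rewrite -(sum_vtx (fun u => (u \in B)%:R * F u)).
rewrite [RHS](bigID (fun u => u \in B)) /= [X in _ + X]big1 ?addr0; last first.
  by move=> u /negbTE ->; rewrite mul0r.
rewrite -[RHS]big_filter; transitivity (\sum_(u <- [seq u <- A | u \in B]) F u).
  apply: perm_big; apply: uniq_perm; rewrite ?filter_uniq ?fset_uniq // => u.
  by rewrite mem_filter; case: (boolP (u \in B)) => //= /BA ->.
by rewrite !big_filter; apply: eq_bigr => u uB; rewrite uB mul1r.
Qed.

Let decay : exists (P : 'M[R]_n) (h : 'I_n -> R) (rho : R), [/\ [/\ forall i, 1 <= h i, 0 < rho & rho < 1],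
  forall i j, 0 <= P i j, forall i, \sum_j P i j * h j <= rho * h i &
  forall i j, `|W i j| <= P i j].
Proof.
have [h [rho [/andP[rho0 rho1] h1 hh]]] := srw_decay R A.
exists (\matrix_(i, j) ((adj (vtx i) (vtx j))%:R / 4)), (h \o vtx), rho.
split=> [|i j|i|i j].
- by split=> // i; exact: h1.
- by rewrite mxE.
- have := hh _ (vtxA i); rewrite sum_vtx => hi; apply: le_trans hi.
  by apply: ler_sum => j _; rewrite mxE.
- by rewrite !mxE Hw.
Qed.

Let kpowE (B : {fset Z2}) k i j : {subset B <= A} ->
  killed_pow W (vset B) k i j = (vtx i \in B)%:R * kpow w B k (vtx i) (vtx j).
Proof.
move=> BA; elim: k i => [|k IH] i.
  rewrite killed_pow0 maskE inE /= (inj_eq vtx_inj) -natrM mulnb andbC //.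
rewrite killed_powSl -mulrA mask_mulE inE /= sum_sub // mxE; congr (_ * _).
by apply: eq_bigr => l _; rewrite IH mxE mulrCA.
Qed.

Let greenE (B : {fset Z2}) i j : {subset B <= A} -> vtx i \in B ->
  green W (vset B) i j = hsum w B (vtx i) (vtx j).
Proof.
move=> BA iB; rewrite mxE /hsum; congr (limn (series _)).
by apply/funext => k; rewrite kpowE // iB mul1r.
Qed.

Let kpow_cvg_in (B : {fset Z2}) x y : {subset B <= A} -> x \in B -> y \in A ->
  series (fun k => kpow w B k x y) @ \oo --> hsum w B x y.
Proof.
move=> BA xB /vtx_surj[j <-]; have [i ix] := vtx_surj (BA _ xB).
have [P [h [rho [[h1 rho0 rho1] P0 Ph WP]]]] := decay.
have t1 : `|1 : R| < rho^-1 by rewrite normr1 invf_gt1.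
have := green_cvg h1 rho0 P0 Ph WP (B := vset B) (i := i) (j := j) t1.
rewrite scale1r greenE ?ix //.
rewrite (_ : (fun k => killed_pow W _ k i j) = fun k => kpow w B k x (vtx j)) //.
by apply/funext => k; rewrite kpowE // ix xB mul1r.
Qed.

(** A start outside [A] has no matrix index, but after one step the walk is in [B], where the matrix
    series converges. *)
Lemma kpow_cvg_step_in (B : {fset Z2}) x y : {subset B <= A} -> y \in A ->
  series (fun k => kpow w B k x y) @ \oo -->
  (x == y)%:R + \sum_(u <- B) w x u * hsum w B u y.
Proof.
move=> BA yA; rewrite -cvg_shiftS.
have E1 (m : nat) : series (fun k => kpow w B k x y) m.+1 =
  (x == y)%:R + \sum_(u <- B) w x u * series (fun k => kpow w B k u y) m.
  rewrite /series /= big_nat_recl //=; congr (_ + _).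
  by rewrite exchange_big /=; apply: eq_bigr => u _; rewrite mulr_sumr.
under eq_fun do rewrite E1; apply: cvgD; first exact: cvg_cst.
apply: cvg_bigsum => u uB; apply: cvgM; [exact: cvg_cst|exact: kpow_cvg_in].
Qed.

Let hitE (B : {fset Z2}) i j : {subset B <= A} ->
  hit W (vset B) i j = hsum w B (vtx i) (vtx j).
Proof.
move=> BA; rewrite [RHS](cvg_lim _ (@kpow_cvg_step_in B (vtx i) (vtx j) BA (vtxA j))) //.
rewrite /hit -(inj_eq vtx_inj); congr (_ + _).
rewrite sum_sub //; apply: eq_bigr => l _; rewrite mxE mulrCA; congr (_ * _).
have [P [h [rho [[h1 rho0 rho1] P0 Ph WP]]]] := decay.
case: (boolP (vtx l \in B)) => lB; first by rewrite mul1r greenE.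
by rewrite (green_step h1 rho0 P0 Ph WP) ?invf_gt1 // inE (negbTE lB) !mul0r.
Qed.

Let vset_D1 (B : {fset Z2}) i : vset (B `\ vtx i)%fset = (vset B :\ i)%SET.
Proof. by apply/setP => j; rewrite !inE (inj_eq vtx_inj). Qed.

Let sub_D1 (B : {fset Z2}) z : {subset B <= A} -> {subset (B `\ z)%fset <= A}.
Proof. by move=> BA u; rewrite !inE => /andP[_ /BA]. Qed.

Lemma hsum_in_in (B : {fset Z2}) z v : {subset B <= A} -> z \in B -> v \in A ->
  hsum w B z v = hsum w B z z * hsum w (B `\ z)%fset z v.
Proof.
move=> BA zB /vtx_surj[j <-]; have [i iz] := vtx_surj (BA _ zB); rewrite -iz in zB *.
have [P [h [rho [[h1 rho0 rho1] P0 Ph WP]]]] := decay.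
have r1 : 1 < rho^-1 by rewrite invf_gt1.
have zB' : i \in vset B by rewrite inE.
rewrite -(greenE j BA zB) -(greenE i BA zB) {1}(green_update h1 rho0 P0 Ph WP _ _ zB' r1).
rewrite (green_step h1 rho0 P0 Ph WP _ _ _ r1) !inE eqxx /= mul0r add0r.
by rewrite -vset_D1 hitE //; exact: sub_D1.
Qed.

Lemma hsum_update_in (B : {fset Z2}) x z v : {subset B <= A} -> z \in B -> x \in A -> v \in A ->
  x != z ->
  hsum w B x v = hsum w (B `\ z)%fset x v + hsum w B x z * hsum w (B `\ z)%fset z v.
Proof.
move=> BA zB /vtx_surj[i <-] /vtx_surj[j <-] xz; have [l lz] := vtx_surj (BA _ zB); rewrite -lz in zB xz *.
have [P [h [rho [[h1 rho0 rho1] P0 Ph WP]]]] := decay.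
have r1 : 1 < rho^-1 by rewrite invf_gt1.
have zB' : l \in vset B by rewrite inE.
have BA' := sub_D1 (z := vtx l) BA.
rewrite -!hitE // vset_D1 /hit.
rewrite (inj_eq vtx_inj) in xz; rewrite (negbTE xz) add0r -addrA; congr (_ + _).
rewrite mulr_suml -big_split /=; apply: eq_bigr => u _.
by rewrite {1}(green_update h1 rho0 P0 Ph WP _ _ zB' r1) mulrDr mulrA.
Qed.

Lemma loopZ_rec_in (B : {fset Z2}) z : {subset B <= A} -> z \in B ->
  loopZ w B = hsum w B z z * loopZ w (B `\ z)%fset.
Proof.
move=> BA zB; have [i iz] := vtx_surj (BA _ zB); rewrite -iz in zB *.
have [P [h [rho [[h1 rho0 rho1] P0 Ph WP]]]] := decay.
have r1 : 1 < rho^-1 by rewrite invf_gt1.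
have zB' : i \in vset B by rewrite inE.
have E (C : {fset Z2}) : {subset C <= A} -> loopZ w C = expR (loop_sum W (vset C)).
  move=> CA; rewrite /loopZ /loop_sum; congr (expR (limn (series _))).
  apply/funext => k; congr (_ / _); rewrite sum_sub //.
  by apply: eq_bigr => l _; rewrite kpowE.
by rewrite !E ?vset_D1 ?(green_loop_sum h1 rho0 P0 Ph WP zB' r1) ?greenE //; exact: sub_D1.
Qed.
End Enumeration.

Lemma hsum_step B x y :
  hsum w B x y = (x == y)%:R + \sum_(u <- B) w x u * hsum w B u y.
Proof.
(* The matrix enumeration must contain the endpoint, so it is taken over [B] with [y] adjoined. *)
have BA : {subset B <= (y |` B)%fset} by move=> u uB; rewrite !inE uB orbT.
by apply: cvg_lim => //; apply: kpow_cvg_step_in BA _; rewrite !inE eqxx.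
Qed.

Lemma kpow_cvg B x y : series (fun k => kpow w B k x y) @ \oo --> hsum w B x y.
Proof.
have BA : {subset B <= (y |` B)%fset} by move=> u uB; rewrite !inE uB orbT.
by rewrite hsum_step; apply: kpow_cvg_step_in BA _; rewrite !inE eqxx.
Qed.

(** Cut at the last visit to [z]: a closed walk at [z], then a walk that does not return. *)
Lemma hsum_in B z v : z \in B ->
  hsum w B z v = hsum w B z z * hsum w (B `\ z)%fset z v.
Proof.
have BA : {subset B <= (v |` B)%fset} by move=> u uB; rewrite !inE uB orbT.
by move=> zB; apply: hsum_in_in BA zB _; rewrite !inE eqxx.
Qed.

(** A walk either avoids [z] or is cut at its last visit to [z]. *)
Lemma hsum_update B x z v : z \in B -> x != z ->
  hsum w B x v = hsum w (B `\ z)%fset x v + hsum w B x z * hsum w (B `\ z)%fset z v.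
Proof.
have BA : {subset B <= (x |` (v |` B))%fset} by move=> u uB; rewrite !inE uB !orbT.
by move=> zB; apply: hsum_update_in BA zB _ _; rewrite !inE eqxx ?orbT.
Qed.

Lemma loopZ_rec B z : z \in B -> loopZ w B = hsum w B z z * loopZ w (B `\ z)%fset.
Proof. exact: (@loopZ_rec_in B). Qed.

Lemma loopZ_gt0 B : 0 < loopZ w B. Proof. exact: expR_gt0. Qed.
End KilledWalks.

(** * Self-avoiding paths and Fomin's identity *)

(** [n] is fuel, sufficient once it bounds the size of [B]. The lists omit the start [x], and each
    vertex entered is removed from [B]. *)
Fixpoint saws n (B : {fset Z2}) (x v : Z2) : seq (seq Z2) :=
  (if x == v then [:: [::]] else [::]) ++
  (if n is n'.+1 then
    [seq y :: t | y <- [seq y <- B | adj x y], t <- saws n' (B `\ y)%fset y v]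
   else [::]).

Definition fdel (B : {fset Z2}) (t : seq Z2) : {fset Z2} :=
  [fset u in B | u \notin t]%fset.

Lemma in_fdel B t u : (u \in fdel B t) = (u \in B) && (u \notin t).
Proof. by rewrite !inE. Qed.

Lemma fdel0 B : fdel B [::] = B.
Proof. by apply/fsetP => u; rewrite in_fdel andbT. Qed.

Lemma fdel_cons B y t : fdel (B `\ y)%fset t = fdel B (y :: t).
Proof.
by apply/fsetP => u; rewrite !in_fdel !inE negb_or; case: (u == y); rewrite /= ?andbF.
Qed.

Lemma fdel_cat B s t : fdel (fdel B s) t = fdel B (s ++ t).
Proof. by apply/fsetP => u; rewrite !in_fdel mem_cat negb_or andbA. Qed.

Lemma eq_fdel B s t : s =i t -> fdel B s = fdel B t.
Proof. by move=> st; apply/fsetP => u; rewrite !in_fdel st. Qed.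

Lemma card_fdel B t : (#|` fdel B t| <= #|` B|)%N.
Proof. by apply: fsubset_leq_card; apply/fsubsetP => u; rewrite in_fdel => /andP[]. Qed.

Lemma card_fsetD1_lt (B : {fset Z2}) y n :
  y \in B -> (#|` B| <= n.+1)%N -> (#|` (B `\ y)%fset| <= n)%N.
Proof. by move=> yB; rewrite (cardfsD1 y) yB. Qed.

Lemma mem_saws n B x v t : (#|` B| <= n)%N ->
  (t \in saws n B x v) =
  [&& path adj x t, uniq t, all (fun u => u \in B) t & last x t == v].
Proof.
elim: n B x t => [|n IH] B x t Bn /=; rewrite mem_cat.
  have B0 : B = fset0 by apply/cardfs0_eq/eqP; rewrite -leqn0.
  case: t => [|y t] /=; first by rewrite orbF; case: (x == v).
  by rewrite B0 !inE !andbF orbF; case: (x == v); rewrite ?inE.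
have -> : (t \in if x == v then [:: [::]] else [::]) = (t == [::]) && (x == v).
  by case: (x == v); rewrite ?inE ?andbT ?andbF.
case: t => [|y t].
  rewrite eqxx /= [X in _ || X](_ : _ = false) ?orbF //.
  by apply/negP => /allpairsPdep[y [t []]].
rewrite /=.
have -> : (y :: t \in [seq y0 :: t0 | y0 <- [seq y0 <- B | adj x y0], t0 <- saws n (B `\ y0)%fset y0 v])
  = [&& adj x y, y \in B & t \in saws n (B `\ y)%fset y v].
  apply/allpairsPdep/idP => [[y' [t' []]]|/and3P[xy yB ty]].
    by rewrite mem_filter => /andP[xy yB] ty [-> ->]; apply/and3P.
  by exists y, t; split; rewrite ?mem_filter ?xy.
case: (boolP (y \in B)) => yB; last by rewrite /= !andbF.
rewrite (IH _ _ _ (card_fsetD1_lt yB Bn)) /=.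
have -> : all (fun u => u \in (B `\ y)%fset) t = (y \notin t) && all (fun u => u \in B) t.
  elim: t {IH} => //= u t ->; rewrite !inE negb_or eq_sym.
  by case: (y == u); rewrite /= ?andbF // andbCA.
by case: (adj x y); case: (path _ _ _); case: (uniq t);
  case: (y \notin t); rewrite /= ?andbF.
Qed.

Lemma saws_uniq n B x v : uniq (saws n B x v).
Proof.
elim: n B x => [|n IH] B x /=; first by rewrite cats0; case: (x == v).
rewrite cat_uniq; apply/and3P; split; first by case: (x == v).
  by apply/hasPn => t /allpairsPdep[y [s [_ _ ->]]]; case: (x == v); rewrite ?inE.
apply: allpairs_uniq_dep => [|y _|[y s] [y' s'] _ _ /= [-> ->]] //.
by rewrite filter_uniq ?fset_uniq.
Qed.

Fixpoint wprod (R : realType) (w : Z2 -> Z2 -> R) (x : Z2) (t : seq Z2) : R :=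
  if t is y :: t' then w x y * wprod w y t' else 1.

Section Fomin.
Variables (R : realType) (w : Z2 -> Z2 -> R).
Hypothesis Hw : forall x y, `|w x y| <= (adj x y)%:R / 4.

Let w0 x y : ~~ adj x y -> w x y = 0.
Proof. by move=> xy; apply/eqP; rewrite -normr_le0 (le_trans (Hw x y)) // (negbTE xy) mul0r. Qed.

Lemma sum_saws n B x v (F : seq Z2 -> R) :
  \sum_(t <- saws n.+1 B x v) F t =
  (x == v)%:R * F [::] +
  \sum_(y <- B | adj x y) \sum_(t <- saws n (B `\ y)%fset y v) F (y :: t).
Proof.
rewrite /= big_cat big_allpairs_dep /= big_filter; congr (_ + _).
by case: (x == v); rewrite ?big_seq1 ?big_nil ?mul1r ?mul0r.
Qed.

(** After the first step to [y], cutting at the last visit to [y] produces the factor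
    [hsum w B y y], which is exactly the quotient of [loopZ] before and after the deletion of [y].
    Dividing by [loopZ w B] therefore makes the recursion close up. *)
Lemma hsum_saws n B x v : (#|` B| <= n)%N ->
  hsum w B x v / loopZ w B =
  \sum_(t <- saws n B x v) wprod w x t / loopZ w (fdel B t).
Proof.
elim: n B x => [|n IH] B x Bn; rewrite (hsum_step Hw).
  have B0 : B = fset0 by apply/cardfs0_eq/eqP; rewrite -leqn0.
  rewrite B0 big_nil addr0 /= cats0.
  by case: (x == v); rewrite ?big_seq1 ?big_nil ?mul0r // fdel0.
rewrite sum_saws mulrDl /= fdel0 mul1r; congr (_ + _).
rewrite mulr_suml [RHS]big_mkcond /= big_seq [RHS]big_seq; apply: eq_bigr => y yB.
case: ifP => [xy|/negbT/w0 ->]; last by rewrite !mul0r.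
under eq_bigr do rewrite /= -fdel_cons -mulrA.
rewrite -mulr_sumr -(IH _ _ (card_fsetD1_lt yB Bn)) (hsum_in Hw _ yB) (loopZ_rec Hw yB).
have Z0 := lt0r_neq0 (loopZ_gt0 w (B `\ y)%fset).
have h0 : hsum w B y y != 0.
  by have := lt0r_neq0 (loopZ_gt0 w B); rewrite (loopZ_rec Hw yB) mulf_eq0 negb_or => /andP[].
by field; rewrite h0 Z0.
Qed.

(** Let the first step go from [x] to [u]. Both entries from [u] acquire the factor [hsum w B u u],
    while by [hsum_update] the entries from [y] change by a multiple of the row of [u]. This row
    operation does not affect the determinant, so the induction passes to $B\setminus u$. *)
Lemma det_hsum_saws n B x y a b : (#|` B| <= n)%N -> y \notin B ->
  (hsum w B x a * hsum w B y b - hsum w B x b * hsum w B y a) / loopZ w B =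
  \sum_(t <- saws n B x a) wprod w x t * (hsum w (fdel B t) y b / loopZ w (fdel B t)) -
  \sum_(t <- saws n B x b) wprod w x t * (hsum w (fdel B t) y a / loopZ w (fdel B t)).
Proof.
elim: n B x => [|n IH] B x Bn yB; rewrite !(hsum_step Hw B x).
  have B0 : B = fset0 by apply/cardfs0_eq/eqP; rewrite -leqn0.
  rewrite B0 !big_nil !addr0 /= !cats0.
  case: (x == a); case: (x == b); rewrite ?big_seq1 ?big_nil ?fdel0 /=; ring.
rewrite !sum_saws /= !fdel0 !mul1r.
set Sa := \sum_(u <- B) _ * hsum w B u a; set Sb := \sum_(u <- B) _ * hsum w B u b.
set Ta := \sum_(u <- B | _) _; set Tb := \sum_(u <- B | _) _.
suff E : (Sa * hsum w B y b - Sb * hsum w B y a) / loopZ w B = Ta - Tb.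
  have F (p q : R) : p + Ta - (q + Tb) = p - q + (Ta - Tb) by ring.
  by rewrite F -E; ring.
transitivity (\sum_(u <- B) w x u *
   ((hsum w B u a * hsum w B y b - hsum w B u b * hsum w B y a) / loopZ w B)).
  by rewrite !mulr_suml -sumrB mulr_suml; apply: eq_bigr => u _; ring.
rewrite -sumrB [RHS]big_mkcond /= big_seq [RHS]big_seq; apply: eq_bigr => u uB.
case: ifP => [xu|/negbT/w0 ->]; last by rewrite mul0r.
have yu : y != u by apply: contraNneq yB => ->.
have yB' : y \notin (B `\ u)%fset by rewrite !inE (negbTE yB) andbF.
under [X in _ = X - _]eq_bigr do rewrite /= -fdel_cons -mulrA.
under [X in _ = _ - X]eq_bigr do rewrite /= -fdel_cons -mulrA.
rewrite -!mulr_sumr -mulrBr -(IH _ _ (card_fsetD1_lt uB Bn) yB'); congr (_ * _).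
rewrite (hsum_in Hw a uB) (hsum_in Hw b uB) (hsum_update Hw a uB yu) (hsum_update Hw b uB yu).
rewrite (loopZ_rec Hw uB).
have Z0 := lt0r_neq0 (loopZ_gt0 w (B `\ u)%fset).
have h0 : hsum w B u u != 0.
  by have := lt0r_neq0 (loopZ_gt0 w B); rewrite (loopZ_rec Hw uB) mulf_eq0 negb_or => /andP[].
by field; rewrite h0 Z0.
Qed.

Lemma fomin_identity n B x y a b : (#|` B| <= n)%N -> y \notin B ->
  (hsum w B x a * hsum w B y b - hsum w B x b * hsum w B y a) / loopZ w B =
  \sum_(s <- saws n B x a) \sum_(t <- saws n (fdel B s) y b)
    wprod w x s * wprod w y t / loopZ w (fdel B (s ++ t)) -
  \sum_(s <- saws n B x b) \sum_(t <- saws n (fdel B s) y a)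
    wprod w x s * wprod w y t / loopZ w (fdel B (s ++ t)).
Proof.
move=> Bn yB; rewrite (det_hsum_saws _ _ _ Bn yB).
congr (_ - _); apply: eq_bigr => s _;
  rewrite (hsum_saws _ _ (leq_trans (card_fdel B s) Bn)) mulr_sumr;
  by apply: eq_bigr => t _; rewrite fdel_cat mulrA.
Qed.
End Fomin.

(** * Unordered sums over walks, sorted by length *)

(** Infinite families of walks are cut into finite lists, one for each length, so that unordered
    sums become ordinary series that can be compared with [hsum] and [loopZ]. *)
Definition graded (T : choiceType) (D : set T) (l : nat -> seq T) : Prop :=
  [/\ forall k, uniq (l k), forall x, D x <-> exists k, x \in l k &
    forall x j k, x \in l j -> x \in l k -> j = k].

Section GradedSums.
Variables (R : realType) (T : choiceType) (D : set T) (l : nat -> seq T).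
Hypothesis gDl : graded D l.

Lemma esum_graded (u : T -> R) : (forall x, 0 <= u x) ->
  (\esum_(x in D) (u x)%:E = \sum_(0 <= k <oo) (\sum_(x <- l k) u x)%:E)%E.
Proof.
case: gDl => ul Dl tl u0.
have -> : D = \bigcup_k [set` l k].
  apply/seteqP; split=> x; first by move/Dl => [k xk]; exists k.
  by move=> [k _ xk]; apply/Dl; exists k.
rewrite nneseries_sum_bigcup.
- apply: eq_eseriesr => k _; rewrite esum_fset //.
    by rewrite -fsbig_seq // sumEFin.
  by move=> x _; rewrite lee_fin.
- by apply/trivIsetP => i j _ _ ij; apply/seteqP; split=> // x [/= xi xj];
    rewrite (tl _ _ _ xi xj) eqxx in ij.
- by move=> x; rewrite lee_fin.
Qed.

Lemma fine_esum_graded (u : T -> R) : (forall x, 0 <= u x) ->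
  cvgn (series (fun k => \sum_(x <- l k) u x)) ->
  fine (\esum_(x in D) (u x)%:E)%E = limn (series (fun k => \sum_(x <- l k) u x)).
Proof.
move=> u0 cu; rewrite esum_graded //.
rewrite (_ : limn _ = (limn (series (fun k => \sum_(x <- l k) u x)))%:E) //.
rewrite -EFin_lim //; congr (limn _); apply/funext => m.
by rewrite /series /= sumEFin.
Qed.

Lemma rsum_graded (u : T -> R) :
  cvgn (series (fun k => \sum_(x <- l k) `|u x|)) ->
  rsum D u = limn (series (fun k => \sum_(x <- l k) u x)).
Proof.
move=> cu.
have dom (v : T -> R) : (forall x, 0 <= v x <= `|u x|) ->
    cvgn (series (fun k => \sum_(x <- l k) v x)).
  move=> vu; apply: series_le_cvg cu => k.
  - by apply: sumr_ge0 => x _; have /andP[] := vu x.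
  - by apply: sumr_ge0 => x _.
  - by apply: ler_sum => x _; have /andP[] := vu x.
have cp : cvgn (series (fun k => \sum_(x <- l k) (u^\+)%R x)).
  by apply: dom => x; rewrite /funrpos le_max lexx orbT ge_max ler_norm normr_ge0.
have cn : cvgn (series (fun k => \sum_(x <- l k) (u^\-)%R x)).
  by apply: dom => x; rewrite /funrneg le_max lexx orbT ge_max -normrN ler_norm normr_ge0.
have up0 x : 0 <= (u^\+)%R x by rewrite /funrpos le_max lexx orbT.
have un0 x : 0 <= (u^\-)%R x by rewrite /funrneg le_max lexx orbT.
rewrite /rsum !fine_esum_graded // -limB //.
rewrite (_ : series _ - series _ = series (fun k => \sum_(x <- l k) u x)) //.
apply/funext => m; rewrite /GRing.add /= /series /= -sumrB; apply: eq_bigr => k _.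
by rewrite -sumrB; apply: eq_bigr => x _; rewrite -[in RHS](funrposBneg u).
Qed.
End GradedSums.

Fixpoint wl k (B : {fset Z2}) (x v : Z2) : seq (seq Z2) :=
  if k is k'.+1 then [seq y :: t | y <- [seq y <- B | adj x y], t <- wl k' B y v]
  else if x == v then [:: [::]] else [::].

Lemma mem_wl k B x v t : (t \in wl k B x v) =
  [&& size t == k, path adj x t, all (fun u => u \in B) t & last x t == v].
Proof.
elim: k x t => [|k IH] x [|y t] //=; first by case: (x == v).
- by case: (x == v); rewrite // inE.
- by apply/negP => /allpairsPdep[? [? []]].
apply/allpairsPdep/idP => [[y' [t' []]]|].
  rewrite mem_filter IH => /andP[xy yB] /and4P[/eqP tk p a l] [-> ->].
  by rewrite tk eqxx xy yB p a l.
rewrite eqSS => /and4P[tk /andP[xy p] /andP[yB a] l]; exists y, t; split=> //.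
  by rewrite mem_filter xy.
by rewrite IH tk p a l.
Qed.

Lemma wl_uniq k B x v : uniq (wl k B x v).
Proof.
elim: k x => [|k IH] x /=; first by case: (x == v).
apply: allpairs_uniq_dep => [|y _|[y s] [y' s'] _ _ /= [-> ->]] //.
by rewrite filter_uniq ?fset_uniq.
Qed.

Lemma sum_wl (R : realType) (w : Z2 -> Z2 -> R) k B x v :
  (forall x y, ~~ adj x y -> w x y = 0) ->
  \sum_(t <- wl k B x v) wprod w x t = kpow w B k x v.
Proof.
move=> w0; elim: k x => [|k IH] x /=.
  by case: (x == v); rewrite ?big_seq1 ?big_nil.
rewrite big_allpairs_dep /= big_filter big_mkcond; apply: eq_bigr => y _.
case: ifP => [xy|/negbT/w0 ->]; last by rewrite mul0r.
by rewrite -IH mulr_sumr.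
Qed.

Definition wtails (B : {fset Z2}) (x v : Z2) : set (seq Z2) :=
  [set t | [&& path adj x t, all (fun u => u \in B) t & last x t == v]].

Lemma wtails_graded B x v : graded (wtails B x v) (fun k => wl k B x v).
Proof.
split=> [k|t|t j k]; first exact: wl_uniq.
  split; first by move=> h; exists (size t); rewrite mem_wl eqxx.
  by case=> k; rewrite mem_wl => /andP[].
by rewrite !mem_wl => /andP[/eqP <- _] /andP[/eqP].
Qed.

Definition wp (R : realType) (x y : Z2) : R := (adj x y)%:R / 4.

Lemma wp_bound (R : realType) x y : `|wp R x y| <= (adj x y)%:R / 4.
Proof. by rewrite ger0_norm ?divr_ge0. Qed.

Lemma wprod_wp (R : realType) x t : path adj x t -> wprod (@wp R) x t = 4 ^- size t.
Proof.
elim: t x => [|y t IH] x /=; first by rewrite expr0 invr1.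
by case/andP=> xy /IH ->; rewrite /wp xy mul1r exprS invfM.
Qed.

Lemma esum_wtails (R : realType) B x v :
  (\esum_(t in wtails B x v) (4 ^- size t)%:E)%E = (hsum (@wp R) B x v)%:E.
Proof.
rewrite (esum_graded (wtails_graded B x v)); last by move=> t; rewrite invr_ge0 exprn_ge0.
have cv := @kpow_cvg R _ (@wp_bound R) B x v.
rewrite -(cvg_lim _ cv) // -EFin_lim; last by apply/cvg_ex; exists (hsum (@wp R) B x v).
congr (limn _); apply/funext => m; rewrite /series /= sumEFin; congr (_%:E).
apply: eq_bigr => k _; rewrite -sum_wl => [|y z /negbTE yz]; last by rewrite /wp yz mul0r.
rewrite big_seq [RHS]big_seq; apply: eq_bigr => t.
by rewrite mem_wl => /and4P[_ p _ _]; rewrite wprod_wp.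
Qed.

Lemma esumZl (R : realType) (T : choiceType) (D : set T) (c : R) (a : T -> \bar R) :
  0 <= c -> (forall x, (0 <= a x)%E) ->
  (\esum_(x in D) (c%:E * a x) = c%:E * \esum_(x in D) a x)%E.
Proof.
move=> c0 a0.
(* Only this inequality is proved from the definition of the sum; the reverse one is the same
   inequality for the constant [c^-1]. *)
have le (e : R) (b : T -> \bar R) : 0 <= e -> (forall x, (0 <= b x)%E) ->
    (\esum_(x in D) (e%:E * b x) <= e%:E * \esum_(x in D) b x)%E.
  move=> e0 b0; apply: ge_ereal_sup => /= _ [X [finX XD] <-].
  rewrite fsbig_finite //= -ge0_sume_distrr; last by move=> x _.
  apply: lee_wpmul2l; first by rewrite lee_fin.
  by rewrite -fsbig_finite //; apply: ereal_sup_ubound; exists X.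
move: c0; rewrite le_eqVlt => /orP[/eqP <-|c0].
  by rewrite mul0e esum1 // => x _; rewrite mul0e.
apply/eqP; rewrite eq_le; apply/andP; split; first by apply: le => //; exact: ltW.
have := le c^-1 (fun x => c%:E * a x)%E.
rewrite invr_ge0 (ltW c0) => /(_ isT).
under eq_esum do rewrite muleA -EFinM mulVf ?gt_eqF // mul1e.
move=> h; rewrite -lee_pdivlMl //; apply: h => x.
by rewrite mule_ge0 // lee_fin ltW.
Qed.

Lemma esum_setX (R : realType) (T1 T2 : choiceType) (D1 : set T1) (D2 : set T2)
    (u : T1 -> R) (v : T2 -> R) (U V : R) :
  (forall x, 0 <= u x) -> (forall x, 0 <= v x) ->
  (\esum_(x in D1) (u x)%:E = U%:E)%E -> (\esum_(x in D2) (v x)%:E = V%:E)%E ->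
  (\esum_(k in D1 `*` D2) (u k.1 * v k.2)%:E = (U * V)%:E)%E.
Proof.
move=> u0 v0 EU EV.
have -> : D1 `*` D2 = D1 `*`` (fun=> D2) by [].
rewrite -(esum_esum (a := fun i j => (u i * v j)%:E)) => [|i j _ _]; last first.
  by rewrite lee_fin mulr_ge0.
have V0 : 0 <= V by rewrite -lee_fin -EV esum_ge0 // => x _; rewrite lee_fin.
transitivity (\esum_(i in D1) (V%:E * (u i)%:E))%E; last first.
  by rewrite esumZl ?EU -?EFinM 1?mulrC // => x; rewrite lee_fin.
apply: eq_esum => i _; under eq_esum do rewrite EFinM.
by rewrite esumZl ?EV 1?muleC // => x; rewrite lee_fin.
Qed.

(** * Chronological loop erasure *)

(** [shorten x] restarts after the last visit to [x], so a closed piece at [x] placed in front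
    leaves no trace. *)
Lemma shorten_cat_loop (x : Z2) s t : last x s = x -> shorten x (s ++ t) = shorten x t.
Proof.
elim: s => //= y s IH xs; rewrite ifT.
  by apply: IH; case: s xs => //.
by rewrite -cat_cons mem_cat -{1}xs mem_last.
Qed.

Lemma last_visit_split (x : Z2) t : exists t1 t2,
  [/\ t = t1 ++ t2, last x t1 = x & x \notin t2].
Proof.
elim: t => [|y t [t1 [t2 [-> x1 x2]]]]; first by exists [::], [::].
case: t1 x1 => [|z t1] /= x1; last by exists (y :: z :: t1), t2.
case: (eqVneq x y) => [<-|xy]; first by exists [:: x], t2.
by exists [::], (y :: t2); rewrite in_cons negb_or xy.
Qed.

Lemma last_visit_uniq (x : Z2) t1 t2 s1 s2 :
  last x t1 = x -> x \notin t2 -> last x s1 = x -> x \notin s2 ->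
  t1 ++ t2 = s1 ++ s2 -> t1 = s1 /\ t2 = s2.
Proof.
(* Read backwards, the first occurrence of [x] gives the length of the second part, hence the
   cut. *)
have ix u v : last x u = x -> x \notin v -> index x (rev (u ++ v)) = size v.
  move=> xu xv; rewrite rev_cat index_cat mem_rev (negbTE xv) size_rev.
  by case/lastP: u xu => [|u y]; rewrite ?addn0 // last_rcons rev_rcons /= => ->; rewrite eqxx addn0.
move=> t1x t2x s1x s2x e.
have sz : size t2 = size s2 by rewrite -(ix _ _ t1x t2x) e ix.
have : t1 ++ t2 == s1 ++ s2 by rewrite e.
rewrite eqseq_cat; first by case/andP=> /eqP -> /eqP ->.
by have /eqP := congr1 size e; rewrite !size_cat sz eqn_add2r => /eqP.
Qed.

Lemma all_fsetD1 (B : {fset Z2}) (x : Z2) t :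
  all (fun u => u \in (B `\ x)%fset) t = (x \notin t) && all (fun u => u \in B) t.
Proof.
elim: t => //= u t ->; rewrite !inE negb_or [u == x]eq_sym.
by case: (x == u); rewrite /= ?andbF // andbCA.
Qed.

Section LoopErasure.
Variable R : realType.
Notation w := (@wp R).
Let Hw := @wp_bound R.

Definition lerw_tails (B : {fset Z2}) (x v : Z2) (Phi : pred (seq Z2)) : set (seq Z2) :=
  [set t | wtails B x v t /\ Phi (shorten x t)].

Let avoid_tails (B : {fset Z2}) (x v : Z2) (Phi : pred (seq Z2)) : set (seq Z2) :=
  [set t | wtails (B `\ x)%fset x v t /\ Phi (shorten x t)].

(** Cut at the last visit to [x]: the first part is an arbitrary closed walk in [B], and the loop
    erasure depends on the second part alone. *)
Let lerw_split B x v Phi : x \in B ->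
  set_bij (wtails B x x `*` avoid_tails B x v Phi) (lerw_tails B x v Phi)
    (fun k => k.1 ++ k.2).
Proof.
move=> xB; split.
- move=> [t1 t2] /= [/and3P[p1 a1 /eqP l1] [/and3P[p2 + l2] f2]].
  rewrite all_fsetD1 => /andP[_ a2]; split; last by rewrite /= shorten_cat_loop.
  by rewrite /wtails /= cat_path p1 l1 p2 all_cat a1 a2 last_cat l1.
- move=> [t1 t2] [s1 s2]; rewrite !inE /=.
  move=> [/and3P[_ _ /eqP l1] [/and3P[_ + _] _]] [/and3P[_ _ /eqP l2] [/and3P[_ + _] _]].
  rewrite !all_fsetD1 => /andP[x2 _] /andP[x2' _] e.
  by have [-> ->] := last_visit_uniq l1 x2 l2 x2' e.
- move=> t [/and3P[]]; have [t1 [t2 [-> x1 x2]]] := last_visit_split x t.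
  rewrite cat_path all_cat last_cat x1 shorten_cat_loop // => /andP[p1 p2] /andP[a1 a2] l2 f2.
  exists (t1, t2) => //; split => /=; first by rewrite /wtails /= p1 a1 x1 eqxx.
  by split => //; rewrite /wtails /= p2 l2 all_fsetD1 x2 a2.
Qed.

(** The first step of the erased path. The tail starts at a neighbour [y] and never meets [x] again,
    so its erasure keeps [y] and continues with the erasure from [y]. *)
Let esum_avoid B x v Phi (F : Z2 -> R) :
  (forall y, y \in (B `\ x)%fset -> adj x y ->
    (\esum_(t in lerw_tails (B `\ x)%fset y v (fun s => Phi (y :: s))) (4 ^- size t)%:E)%E = (F y)%:E) ->
  (\esum_(t in avoid_tails B x v Phi) (4 ^- size t)%:E)%E =
  ((x == v)%:R * (Phi [::])%:R + \sum_(y <- (B `\ x)%fset | adj x y) w x y * F y)%:E.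
Proof.
move=> HF; set C := (B `\ x)%fset in HF *.
have n0 (t : seq Z2) : (0 <= (4 ^- size t : R)%:E)%E by rewrite lee_fin invr_ge0 exprn_ge0.
rewrite (esumID [set [::]]) // EFinD; congr (_ + _)%E.
  case: (boolP ((x == v) && Phi [::])) => h.
    rewrite (_ : _ `&` _ = [set [::]]).
      by rewrite esum_set1 // expr0 invr1; case/andP: h => -> ->; rewrite mulr1.
    by apply/seteqP; split=> [t []//|t /= ->]; split=> //; split; rewrite /wtails /= ?andbT; case/andP: h.
  rewrite (_ : _ `&` _ = set0).
    by rewrite esum_set0 -natrM mulnb (negbTE h).
  apply/seteqP; split=> // t [[/and3P[_ _ l] f] /= e]; move: l f h; rewrite e /= => -> ->.
  by [].
pose J y := [set t | adj x y /\ lerw_tails C y v (fun s => Phi (y :: s)) t].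
rewrite (@reindex_esum R (Z2 * seq Z2)%type (seq Z2) ([set` C] `*`` J) _ (fun k => k.1 :: k.2)); last first.
  split.
  - move=> [y t] /= [yC [xy [/and3P[p a l] f]]].
    have xyt : x \notin y :: t.
      have : all (fun u => u \in C) (y :: t) by rewrite /= yC a.
      by rewrite /C all_fsetD1 => /andP[].
    split=> //; split; first by rewrite /wtails /= xy p a l yC.
    by rewrite /= (negbTE xyt).
  - by move=> [y t] [y' t'] _ _ /= [-> ->].
  - move=> [|y t] [[/and3P[p a l] f] ne]; first by case: ne.
    exists (y, t) => //; move: p a l => /= /andP[xy p] /andP[yC a] l.
    have xyt : x \notin y :: t.
      have : all (fun u => u \in C) (y :: t) by rewrite /= yC a.
      by rewrite /C all_fsetD1 => /andP[].
    split=> //=; split=> //; split; first by rewrite /wtails /= p a l.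
    by move: f; rewrite /= (negbTE xyt).
rewrite -(esum_esum (a := fun y t => (4 ^- size (y :: t))%:E)) => [|y t _ _]; last exact: n0.
rewrite esum_fset => [||y _]; [|exact: finite_fset|by apply: esum_ge0 => t _; exact: n0].
rewrite -fsbig_seq ?fset_uniq // -sumEFin [RHS]big_mkcond /= big_seq [RHS]big_seq.
apply: eq_bigr => y yC; case: ifP => xy; last first.
  rewrite (_ : J y = set0) ?esum_set0 //.
  by apply/seteqP; split=> // t []; rewrite xy.
rewrite EFinM -HF // /w xy mul1r -esumZl; [|by rewrite invr_ge0|exact: n0].
rewrite (_ : J y = lerw_tails C y v (fun s => Phi (y :: s))).
  by apply: eq_esum => t _; rewrite -EFinM /= exprS invfM.
by apply/seteqP; split=> [t []|t] //; split.
Qed.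

(** The law of the loop-erased walk, by induction on the size of [B]: the closed walks at [x]
    contribute [hsum w B x x], the quotient of [loopZ] before and after the deletion of [x]. The
    condition [Phi] is handed on with the vertex [y] put in front. *)
Lemma esum_lerw n B x v Phi : (#|` B| <= n.+1)%N -> x \in B ->
  (\esum_(t in lerw_tails B x v Phi) (4 ^- size t)%:E)%E =
  (\sum_(t <- saws n (B `\ x)%fset x v)
    (Phi t)%:R * (wprod w x t * (loopZ w B / loopZ w (fdel (B `\ x)%fset t))))%:E.
Proof.
elim: n B x Phi => [|n IH] B x Phi Bn xB.
  have B0 : (B `\ x)%fset = fset0.
    by apply/cardfs0_eq/eqP; rewrite -leqn0 (card_fsetD1_lt xB Bn).
  rewrite (@reindex_esum R (seq Z2 * seq Z2)%type (seq Z2) (wtails B x x `*` avoid_tails B x v Phi) _ (fun k => k.1 ++ k.2)); last exact: lerw_split.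
  under eq_esum do rewrite /= size_cat exprD invfM.
  rewrite (esum_setX (u := fun t => 4 ^- size t) (v := fun t => 4 ^- size t) _ _ (esum_wtails R B x x) (esum_avoid (F := fun=> 0) _)).
  - rewrite B0 big_nil addr0 /= cats0 (loopZ_rec Hw xB) B0; congr (_%:E).
    case: (x == v); rewrite ?big_seq1 ?big_nil ?mul0r ?mulr0 // !mul1r fdel0.
    by rewrite mulfK ?lt0r_neq0 ?loopZ_gt0 // mulrC.
  - by move=> t; rewrite invr_ge0 exprn_ge0.
  - by move=> t; rewrite invr_ge0 exprn_ge0.
  - by rewrite B0.
rewrite (@reindex_esum R (seq Z2 * seq Z2)%type (seq Z2) (wtails B x x `*` avoid_tails B x v Phi) _ (fun k => k.1 ++ k.2)); last exact: lerw_split.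
under eq_esum do rewrite /= size_cat exprD invfM.
set C := (B `\ x)%fset.
pose F y := \sum_(t <- saws n (C `\ y)%fset y v)
  (Phi (y :: t))%:R * (wprod w y t * (loopZ w C / loopZ w (fdel (C `\ y)%fset t))).
rewrite (esum_setX (u := fun t => 4 ^- size t) (v := fun t => 4 ^- size t) _ _ (esum_wtails R B x x) (esum_avoid (F := F) _)).
- rewrite sum_saws -/C /= fdel0 (loopZ_rec Hw xB) -/C mul1r; congr (_%:E).
  have Z0 : loopZ w C != 0 by rewrite lt0r_neq0 ?loopZ_gt0.
  rewrite mulrDr; congr (_ + _); first by rewrite mulfK // mulrC -mulrA.
  rewrite mulr_sumr; apply: eq_bigr => y _; rewrite /F !mulr_sumr.
  apply: eq_bigr => t _; rewrite fdel_cons; ring.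
- by move=> t; rewrite invr_ge0 exprn_ge0.
- by move=> t; rewrite invr_ge0 exprn_ge0.
- move=> y yC xy; rewrite (IH C) //; exact: card_fsetD1_lt.
Qed.
End LoopErasure.

(** * Crossing parities of closed lattice walks *)

Fixpoint xpar (c : Z2 -> Z2 -> bool) (x : Z2) (t : seq Z2) : bool :=
  if t is y :: t' then c x y (+) xpar c y t' else false.

Lemma xpar_cat c x s t : xpar c x (s ++ t) = xpar c x s (+) xpar c (last x s) t.
Proof. by elim: s x => //= y s IH x; rewrite IH addbA. Qed.

Lemma eq_xpar c c' x t : (forall y z, y \in x :: t -> z \in t -> adj y z -> c y z = c' y z) ->
  path adj x t -> xpar c x t = xpar c' x t.
Proof.
elim: t x => //= y t IH x cc /andP[xy p]; rewrite cc ?mem_head // IH // => u v ut vt.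
by apply: cc; rewrite in_cons ?ut ?vt orbT.
Qed.

Lemma xpar_addb c c' x t :
  xpar (fun y z => c y z (+) c' y z) x t = xpar c x t (+) xpar c' x t.
Proof. by elim: t x => //= y t IH x; rewrite IH addbACA. Qed.

Lemma xpar_andb b c x t : xpar (fun y z => b && c y z) x t = b && xpar c x t.
Proof. by elim: t x => [|y t IH] x /=; rewrite ?andbF // IH andb_addr. Qed.

Lemma xpar_sum (s : seq Z2) (c : Z2 -> Z2 -> Z2 -> bool) x t :
  xpar (fun y z => \big[addb/false]_(p <- s) c p y z) x t =
  \big[addb/false]_(p <- s) xpar (c p) x t.
Proof.
elim: t x => [|y t IH] x /=; first by rewrite big1.
by rewrite IH -big_split.
Qed.

Lemma xpar_coboundary (u : Z2 -> bool) x t :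
  xpar (fun y z => u y (+) u z) x t = u x (+) u (last x t).
Proof. by elim: t x => [|y t IH] x /=; rewrite ?addbb // IH; case: (u x); case: (u y); case: (u _). Qed.

Lemma xpar_rev c x t : (forall y z, c y z = c z y) ->
  xpar c (last x t) (rev (belast x t)) = xpar c x t.
Proof.
move=> cs; elim: t x => //= y t IH x.
rewrite rev_cons -cats1 xpar_cat IH /= addbF addbC; congr (_ (+) _).
rewrite cs; congr (c _ _); case: t {IH} => //= z t.
by rewrite rev_cons last_rcons.
Qed.

(** The edges that meet the horizontal ray going right from the centre of the square with lower left
    corner [p]. For a closed walk, the parity of such crossings is its winding number around that
    centre modulo 2. *)
Definition cross (p x y : Z2) : bool :=
  [&& x.1 == y.1, p.1 < x.1 &
    ((x.2 == p.2) && (y.2 == p.2 + 1)) || ((y.2 == p.2) && (x.2 == p.2 + 1))].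

Lemma cross_sym p x y : cross p x y = cross p y x.
Proof. by rewrite /cross; lia. Qed.

Definition same_edge (u v x y : Z2) : bool :=
  ((x == u) && (y == v)) || ((x == v) && (y == u)).

Lemma xpar_same_edge0 u v x t :
  (u \notin x :: t) || (v \notin x :: t) -> xpar (same_edge u v) x t = false.
Proof.
elim: t x => //= y t IH x h; rewrite IH; last first.
  by case/orP: h; rewrite in_cons negb_or => /andP[_ ->]; rewrite ?orbT.
rewrite addbF /same_edge; case/orP: h; rewrite !in_cons !negb_or => /and3P[h1 h2 _].
  by rewrite ![_ == u]eq_sym (negbTE h1) (negbTE h2) andbF.
by rewrite ![_ == v]eq_sym (negbTE h1) (negbTE h2) andbF.
Qed.

Lemma adj_cases (P : Z2 -> Z2 -> Prop) :
  (forall x1 x2, P (x1, x2) (x1 + 1, x2)) -> (forall x1 x2, P (x1 + 1, x2) (x1, x2)) ->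
  (forall x1 x2, P (x1, x2) (x1, x2 + 1)) -> (forall x1 x2, P (x1, x2 + 1) (x1, x2)) ->
  forall x y, adj x y -> P x y.
Proof.
move=> h1 h2 h3 h4 [x1 x2] [y1 y2]; rewrite adjE !inE !xpair_eqE /=.
case/or4P=> /andP[/eqP -> /eqP ->] //.
- by have := h2 (x1 - 1) x2; rewrite subrK.
- by have := h4 x1 (x2 - 1); rewrite subrK.
Qed.

Section ClosedWalk.
Variables (x : Z2) (t : seq Z2).
Hypothesis pt : path adj x t.
Hypothesis ct : last x t = x.
Local Notation N p := (xpar (cross p) x t).

(** Moving the square one unit to the left lengthens the ray by a single vertical edge. *)
Lemma winding_hor i j : N (i, j) (+) N (i - 1, j) = xpar (same_edge (i, j) (i, j + 1)) x t.
Proof.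
rewrite /= -xpar_addb; apply: eq_xpar pt => -[y1 y2] [z1 z2] _ _ _.
by rewrite /cross /same_edge !xpair_eqE /=; lia.
Qed.

(** The edges that leave the half-line [u] are those crossing one of the two rays and one horizontal
    edge; a closed walk uses such edges an even number of times. *)
Lemma winding_ver i j : N (i, j) (+) N (i, j - 1) = xpar (same_edge (i, j) (i + 1, j)) x t.
Proof.
pose u (y : Z2) := (i < y.1) && (y.2 == j).
have -> : xpar (same_edge (i, j) (i + 1, j)) x t =
  xpar (fun y z => (u y (+) u z) (+) same_edge (i, j) (i + 1, j) y z) x t.
  by rewrite xpar_addb xpar_coboundary ct addbb.
rewrite /= -xpar_addb; apply: eq_xpar pt => y z _ _.
move: y z; apply: adj_cases => y1 y2; rewrite /cross /same_edge /u !xpair_eqE /=; lia.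
Qed.

Definition corners (v : Z2) : seq Z2 :=
  [:: v; (v.1 - 1, v.2); (v.1, v.2 - 1); (v.1 - 1, v.2 - 1)].

Lemma winding_corners v p : v \notin x :: t -> p \in corners v -> N p = N v.
Proof.
case: v => i j vt.
have h1 := winding_hor i j; have h2 := winding_hor i (j - 1).
have h3 := winding_ver i j; have h4 := winding_ver (i - 1) j.
move: h1 h2 h3 h4; rewrite !subrK !xpar_same_edge0 ?vt ?orbT //.
rewrite /corners !inE /= => h1 h2 h3 h4 /or4P[] /eqP -> //; move: h1 h2 h3 h4;
  by do 4?[case: (xpar _ x t)].
Qed.

Lemma winding_adj v v' : v \notin x :: t -> v' \notin x :: t -> adj v v' -> N v = N v'.
Proof.
move=> vt vt' vv'; move: v v' vv' vt vt'; apply: adj_cases => i j ht ht'.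
- by apply: (winding_corners ht'); rewrite /corners !inE /= addrK eqxx orbT.
- by apply/esym/(winding_corners ht); rewrite /corners !inE /= addrK eqxx orbT.
- by apply: (winding_corners ht'); rewrite /corners !inE /= addrK eqxx !orbT.
- by apply/esym/(winding_corners ht); rewrite /corners !inE /= addrK eqxx !orbT.
Qed.

Lemma winding_path v s : path adj v s -> all (fun y => y \notin x :: t) (v :: s) ->
  N v = N (last v s).
Proof.
elim: s v => //= u s IH v /andP[vu p] /and3P[hv hu hs].
by rewrite (winding_adj hv hu vu) IH // hu.
Qed.

Lemma winding_far v : (forall y, y \in x :: t -> y.1 <= v.1) -> N v = false.
Proof.
move=> vf; rewrite (eq_xpar (c' := fun _ _ => false)) //; last first.
  by move=> y z yt _ _; rewrite /cross ltNge (vf y yt) /= andbF.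
by elim: (t) (x) => //=.
Qed.

(** Since the complement of [A] is connected, [v] is joined off the walk to a vertex to the right of
    all of [A], whose ray meets nothing; the parity is constant along the joining path. *)
Lemma winding_out (A : {fset Z2}) v : lconnected (fun y => y \notin A) ->
  all (fun y => y \in A) (x :: t) -> v \notin A -> forall p, p \in corners v -> N p = false.
Proof.
move=> cA /allP tA vA p pv.
have off y : y \notin A -> y \notin x :: t by apply: contra => /tA.
rewrite (winding_corners (off _ vA) pv).
have [K KA] : exists K : int, forall y, y \in A -> y.1 < K.
  exists (Posz (\sum_(y <- A) `|y.1|)%N.+1) => y yA.
  suff : (`|y.1| <= \sum_(y <- A) `|y.1|)%N by lia.
  by rewrite (big_rem y) //= leq_addr.
pose f : Z2 := (K, 0).
have fA : f \notin A by apply/negP => /KA /=; rewrite ltxx.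
have [s [ps sA <-]] := cA f v fA vA.
rewrite -(winding_path ps); last first.
  rewrite /= off //=; apply/allP => y ys; apply: off; exact: (allP sA).
by apply: winding_far => y /tA /KA /ltW.
Qed.
End ClosedWalk.

(** * Signs of closed walks from signs of unit squares *)

Definition plaq (sb : Z2 -> Z2 -> bool) (p : Z2) : bool :=
  sb (p.1, p.2) (p.1 + 1, p.2) (+) sb (p.1 + 1, p.2) (p.1 + 1, p.2 + 1) (+)
  sb (p.1, p.2 + 1) (p.1 + 1, p.2 + 1) (+) sb (p.1, p.2) (p.1, p.2 + 1).

Definition pcorners (p : Z2) : seq Z2 :=
  [:: (p.1, p.2); (p.1 + 1, p.2); (p.1, p.2 + 1); (p.1 + 1, p.2 + 1)].

Section Holonomy.
Variables (A : {fset Z2}) (sb : Z2 -> Z2 -> bool) (w : Z2).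
Hypothesis sb_sym : forall y z, sb y z = sb z y.
Hypothesis sbA : forall y z, sb y z -> y \in A.
Hypothesis plaqA : forall p, all (fun v => v \in A) (pcorners p) -> plaq sb p = (p == w).
Hypothesis wA : w \in A.
Hypothesis cA : lconnected (fun y => y \notin A).

Let bound : exists K : nat, forall y, y \in A -> `|y.1| < K%:Z /\ `|y.2| < K%:Z.
Proof.
exists (\sum_(y <- A) (`|y.1| + `|y.2|))%N.+1 => -[y1 y2] yA.
have : (`|y1| + `|y2| <= \sum_(y <- A) (`|y.1| + `|y.2|))%N.
  by rewrite (big_rem _ yA) //= leq_addr.
by move: (\sum_(y <- A) _)%N => S /= h; split; lia.
Qed.

(* Summing [sb] along rows from the far left is a gauge that trivializes the
   horizontal edges, so that the sign of a vertical edge becomes the product of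
   the plaquettes to its left. *)
Lemma xpar_plaquettes x t : path adj x t -> last x t = x -> all (fun y => y \in A) (x :: t) ->
  xpar sb x t = xpar (cross w) x t.
Proof.
move=> pt ct /allP tA; have [K KA] := bound.
pose row (j : int) (k : nat) : bool :=
  \big[addb/false]_(0 <= r < k) sb (r%:Z - K%:Z, j) (r%:Z - K%:Z + 1, j).
pose h (y : Z2) : bool := row y.2 `|(y.1 + K%:Z)%R|%N.
pose box := [seq ((i%:Z - K%:Z, j%:Z - K%:Z) : Z2) | i <- iota 0 (K + K), j <- iota 0 (K + K)].
have ubox : uniq box.
  apply: allpairs_uniq; rewrite ?iota_uniq // => -[i j] [i' j'] _ _ /= [e1 e2].
  by congr (_, _); lia.
have mbox y : y \in A -> y \in box.
  case: y => i j ijA; have [/= y1 y2] := KA _ ijA; apply/allpairsP.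
  exists (`|(i + K%:Z)%R|%N, `|(j + K%:Z)%R|%N); rewrite !mem_iota /=.
  by split; [lia|lia|apply/eqP; rewrite xpair_eqE; lia].
have rowS j k : row j k.+1 = row j k (+) sb (k%:Z - K%:Z, j) (k%:Z - K%:Z + 1, j).
  by rewrite /row big_nat_recr.
(* Consecutive squares of a row share a vertical edge, so their product telescopes; the edge at the
   far left lies outside [A] and has trivial sign. *)
have col (j : int) (k : nat) :
    sb (- K%:Z, j) (- K%:Z, j + 1) = false ->
    \big[addb/false]_(0 <= i < k) plaq sb (i%:Z - K%:Z, j) =
    row j k (+) row (j + 1) k (+) sb (k%:Z - K%:Z, j) (k%:Z - K%:Z, j + 1).
  move=> s0; elim: k => [|k IH]; first by rewrite /row !big_nil sub0r s0.
  rewrite big_nat_recr //= IH !rowS /plaq /=.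
  rewrite (_ : k.+1%:Z - K%:Z = k%:Z - K%:Z + 1); last by lia.
  by do 2 case: (row _ _); do 4 case: (sb _ _).
have step y z : y \in A -> z \in A -> adj y z ->
    sb y z = (h y (+) h z) (+) \big[addb/false]_(p <- box) (plaq sb p && cross p y z).
  have hor i j : (i, j) \in A -> sb (i, j) (i + 1, j) =
      (h (i, j) (+) h (i + 1, j)) (+)
      \big[addb/false]_(p <- box) (plaq sb p && cross p (i, j) (i + 1, j)).
    move=> ijA; have [/= Ki _] := KA _ ijA.
    rewrite big1 => [|p _]; last first.
      by rewrite /cross /= (_ : (i == i + 1) = false) ?andbF //; lia.
    rewrite addbF /h /= (_ : `|(i + 1 + K%:Z)%R|%N = `|(i + K%:Z)%R|%N.+1); last by lia.
    rewrite rowS addbA addbb addFb.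
    by rewrite (_ : (`|(i + K%:Z)%R|%N : int) - K%:Z = i) //; lia.
  have ver i j : (i, j) \in A -> sb (i, j) (i, j + 1) =
      (h (i, j) (+) h (i, j + 1)) (+)
      \big[addb/false]_(p <- box) (plaq sb p && cross p (i, j) (i, j + 1)).
    move=> ijA; have [/= Ki Kj] := KA _ ijA.
    set k := `|(i + K%:Z)%R|%N.
    have ki : k%:Z - K%:Z = i by rewrite /k; lia.
    have -> : \big[addb/false]_(p <- box) (plaq sb p && cross p (i, j) (i, j + 1)) =
        \big[addb/false]_(0 <= a < k) plaq sb (a%:Z - K%:Z, j).
      rewrite /box big_allpairs_dep (big_nat_widen _ _ (K + K)); last by rewrite /k; lia.
      rewrite /index_iota subn0 [RHS]big_mkcond; apply: eq_bigr => a _.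
      have jm : `|(j + K%:Z)%R|%N \in iota 0 (K + K) by rewrite mem_iota; lia.
      rewrite (bigD1_seq _ jm (iota_uniq _ _)) /=.
      rewrite big1 => [|b /eqP bj].
        rewrite addbF (_ : (`|(j + K%:Z)%R|%N : int) - K%:Z = j); last by lia.
        rewrite /cross /= !eqxx /= andbT (_ : (a%:Z - K%:Z < i) = (a < k)%N); last by rewrite /k; lia.
        by case: ifP; rewrite ?andbT ?andbF.
      rewrite /cross /= (_ : (j == b%:Z - K%:Z) = false); last by apply/eqP; lia.
      by rewrite (_ : (j + 1 == b%:Z - K%:Z) && (j == b%:Z - K%:Z + 1) = false) ?andbF //; lia.
    rewrite col ?ki; last first.
      by apply/negP => /sbA /KA [] /=; lia.
    by rewrite /h /=; case: (row _ _); case: (row _ _); case: (sb _ _).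
  move=> yA zA yz; move: y z yz yA zA; apply: adj_cases => i j iA jA.
  - exact: hor.
  - rewrite sb_sym hor // [h _ (+) h (_ + 1, _)]addbC.
    by under eq_bigr do rewrite cross_sym.
  - exact: ver.
  - rewrite sb_sym ver // [h _ (+) h (_, _ + 1)]addbC.
    by under eq_bigr do rewrite cross_sym.
rewrite (eq_xpar (c' := fun y z => (h y (+) h z) (+)
   \big[addb/false]_(p <- box) (plaq sb p && cross p y z))) //; last first.
  by move=> y z yt zt; apply: step; apply: tA; rewrite // in_cons zt orbT.
rewrite xpar_addb xpar_coboundary ct addbb addFb xpar_sum.
(* The rule for squares is available only when all corners lie in [A]. A square with a corner
   outside is not encircled by the walk, so that both sides vanish. *)
have term p : xpar (fun y z => plaq sb p && cross p y z) x t = (p == w) && xpar (cross p) x t.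
  rewrite xpar_andb; case: (boolP (xpar (cross p) x t)); rewrite ?andbF // !andbT => Np.
  apply: plaqA; apply/allP => v vp; apply: contraLR Np => vA.
  rewrite (winding_out pt ct cA _ vA) //; first exact/allP.
  case: p vp => i j; rewrite /pcorners /corners !inE /=.
  by case/or4P=> /eqP -> /=; rewrite ?addrK eqxx ?orbT.
under eq_bigr do rewrite term.
by rewrite (bigD1_seq w) ?mbox //= eqxx big1 ?addbF // => p /negbTE ->.
Qed.
End Holonomy.

(* The lower left corner of the plaquette to the right of the step [u -> v]. *)
Definition right_plaq (u v : Z2) : Z2 :=
  if v.2 == u.2 then (if v.1 == u.1 + 1 then (u.1, u.2 - 1) else v)
  else if v.2 == u.2 + 1 then u else (v.1 - 1, v.2).

Lemma right_plaq_corner u v : adj u v -> right_plaq u v \in corners v.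
Proof.
move: u v; apply: adj_cases => i j; rewrite /right_plaq /corners !inE /= ?eqxx ?orbT //=.
- by rewrite addrK eqxx ?orbT.
- have -> : (i == i + 1 + 1) = false by lia.
  by rewrite eqxx.
- have -> : (j + 1 == j) = false by lia.
  by rewrite addrK eqxx !orbT.
- have -> : (j == j + 1) = false by lia.
  have -> : (j == j + 1 + 1) = false by lia.
  by rewrite eqxx orbT.
Qed.

Lemma same_edgeC u v y z : same_edge u v y z = same_edge v u y z.
Proof. by rewrite /same_edge orbC. Qed.

(** The squares on the right of the incoming and of the outgoing step are joined, around the
    right-hand side of the vertex, across edges that the walk does not use there, and [N] does not
    change across those. *)
Lemma right_plaq_turn (N E : Z2 -> bool) (i j : int) u w :
  N (i, j) (+) N (i - 1, j) = E (i, j + 1) ->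
  N (i, j - 1) (+) N (i - 1, j - 1) = E (i, j - 1) ->
  N (i, j) (+) N (i, j - 1) = E (i + 1, j) ->
  N (i - 1, j) (+) N (i - 1, j - 1) = E (i - 1, j) ->
  (forall v, v != u -> v != w -> E v = false) ->
  u \in nbrs (i, j) -> w \in nbrs (i, j) -> u != w ->
  N (right_plaq u (i, j)) = N (right_plaq (i, j) w).
Proof.
move=> h1 h2 h3 h4 hE; have := hE (i + 1, j); have := hE (i - 1, j).
have := hE (i, j + 1); have := hE (i, j - 1); rewrite -{}h1 -{}h2 -{}h3 -{}h4 {hE E}.
have n1 : (j - 1 == j) = false by lia.
have n2 : (j + 1 == j) = false by lia.
have n3 : (j == j - 1) = false by lia.
have n4 : (i + 1 == i) = false by lia.
have n5 : (i - 1 == i + 1) = false by lia.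
have n6 : (j == j + 1) = false by lia.
have n7 : (j - 1 == j + 1) = false by lia.
have n8 : (i == i + 1) = false by lia.
have n9 : (i - 1 == i) = false by lia.
have n10 : (i == i - 1) = false by lia.
have n11 : (i + 1 == i - 1) = false by lia.
have n12 : (j + 1 == j - 1) = false by lia.
have m1 : (i == i + 1 + 1) = false by lia.
have m2 : (j == j + 1 + 1) = false by lia.
pose nn := (n1, n2, n3, n4, n5, n6, n7, n8, n9, n10, n11, n12, m1, m2).
move=> e1 e2 e3 e4; rewrite !inE /= => /or4P[] /eqP eu /or4P[] /eqP ew uw;
  move: e1 e2 e3 e4 uw; rewrite {}eu {}ew /right_plaq !xpair_eqE /= ?eqxx /= ?subrK ?addrK ?eqxx !nn //= ?eqxx;
  case: (N (i, j)) (N (i - 1, j)) (N (i, j - 1)) (N (i - 1, j - 1)) => [] [] [] [] //= e1 e2 e3 e4 _;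
  first [by have := e1 isT isT|by have := e2 isT isT|by have := e3 isT isT|by have := e4 isT isT].
Qed.

(** * The parity on the right-hand side of a simple stretch *)

Section SimplePassage.
Variables (x : Z2) (t : seq Z2).
Hypothesis pt : path adj x t.
Hypothesis ct : last x t = x.
Local Notation N p := (xpar (cross p) x t).

Lemma xpar_same_edge_passage p1 u v v' w r : x :: t = p1 ++ [:: u; v; w] ++ r ->
  v \notin p1 -> v != u -> v \notin w :: r -> v' != u -> v' != w ->
  xpar (same_edge v v') x t = false.
Proof.
move=> e vp vu vr uv' wv'.
have tail : xpar (same_edge v v') u [:: v, w & r] = false.
  rewrite /= xpar_same_edge0 ?vr // addbF /same_edge eqxx.
  have /negbTE wv : w != v by move: vr; rewrite in_cons negb_or eq_sym => /andP[].
  by rewrite [u == v]eq_sym [u == v']eq_sym [w == v']eq_sym (negbTE uv') (negbTE wv') (negbTE vu) wv !andbF.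
case: p1 e vp => [|y p1] /= [-> ->]; first by [].
rewrite in_cons negb_or => /andP[vy vp]; rewrite xpar_cat xpar_same_edge0 /=; last first.
  by rewrite in_cons negb_or vy vp.
rewrite -/(xpar (same_edge v v') u [:: v, w & r]) in tail *.
move: tail => /= ->; rewrite addbF /same_edge [u == v]eq_sym (negbTE vu) andbF orbF.
have := mem_last y p1; rewrite in_cons; case: eqP => [->|_] /=; last first.
  by move=> h; case: eqP => // E; rewrite E (negbTE vp) in h.
by rewrite eq_sym (negbTE vy).
Qed.

Lemma right_plaq_passage p1 u v w r : x :: t = p1 ++ [:: u; v; w] ++ r ->
  v \notin p1 -> v != u -> v \notin w :: r -> u != w ->
  N (right_plaq u v) = N (right_plaq v w).
Proof.
move=> e vp vu vr uw.
have [auv avw] : adj u v /\ adj v w.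
  have : sorted adj (p1 ++ [:: u; v; w] ++ r) by rewrite -e /=.
  case: (p1) => [|y p2] /=; first by move=> /and3P[].
  by rewrite cat_path /= => /and5P[].
have E v' : v' != u -> v' != w -> xpar (same_edge v v') x t = false.
  by apply: xpar_same_edge_passage e _ _ _.
case: v vp vu vr auv avw E {e} => i j _ _ _ auv avw E.
pose Ef v' := xpar (same_edge (i, j) v') x t.
apply: (@right_plaq_turn (fun p => N p) Ef i j) => //; rewrite /Ef -?adjE //.
- exact: winding_hor.
- by have := winding_hor pt i (j - 1); rewrite subrK => ->; apply: eq_xpar pt => *; exact: same_edgeC.
- exact: winding_ver.
- by have := winding_ver pt ct (i - 1) j; rewrite subrK => ->; apply: eq_xpar pt => *; exact: same_edgeC.
- by rewrite adj_sym.
Qed.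
End SimplePassage.

(** Along a stretch whose vertices are visited only once, the parity on the right-hand side is
    carried over each turn in succession. *)
Lemma right_plaq_chain x t p1 u v q b r : path adj x t -> last x t = x ->
  x :: t = p1 ++ u :: v :: q ++ b :: r -> uniq (v :: q) -> u != b ->
  (forall y, y \in v :: q -> [/\ y \notin p1, y != u & y \notin b :: r]) ->
  xpar (cross (right_plaq u v)) x t = xpar (cross (right_plaq (last v q) b)) x t.
Proof.
move=> pt ct; elim: q p1 u v => [|w q IH] p1 u v e uq ub dis.
  have [vp vu vr] := dis v (mem_head _ _).
  exact: (right_plaq_passage (r := r) pt ct e).
have [vp vu vr] := dis v (mem_head _ _).
have uw : u != w.
  have wq : w \in [:: v, w & q] by rewrite !inE eqxx orbT.
  by have [_ wu _] := dis w wq; rewrite eq_sym.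
move: uq; rewrite /= => /andP[vwq uq].
rewrite (@right_plaq_passage x t pt ct p1 u v w (q ++ b :: r)) //; last first.
  by rewrite -cat_cons mem_cat negb_or vwq vr.
apply: (IH (rcons p1 u)) => //.
- by rewrite cat_rcons.
- by move: vr; rewrite in_cons negb_or => /andP[].
- move=> y yq; have yq' : y \in v :: w :: q by rewrite in_cons yq orbT.
  have [yp yu yr] := dis y yq'; split=> //; first by rewrite mem_rcons in_cons negb_or yu.
  by apply: contraTneq yq => ->.
Qed.

Lemma xpar_same_edge_once x t p1 u v w r : x :: t = p1 ++ [:: u, v, w & r] ->
  v \notin p1 -> v != u -> v \notin w :: r -> u != w ->
  xpar (same_edge v u) x t = true.
Proof.
move=> e vp vu vr uw.
have tail : xpar (same_edge v u) u [:: v, w & r] = true.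
  have /negbTE wv : w != v by move: vr; rewrite in_cons negb_or eq_sym => /andP[].
  rewrite /= xpar_same_edge0 ?vr // addbF /same_edge !eqxx [w == u]eq_sym (negbTE uw) wv.
  by rewrite !andbF orbT.
case: p1 e vp => [|y p1] /= [-> ->]; first by [].
rewrite in_cons negb_or => /andP[vy vp]; rewrite xpar_cat xpar_same_edge0; last first.
  by rewrite in_cons negb_or vy vp.
rewrite /= in tail *; rewrite tail /same_edge [u == v]eq_sym (negbTE vu) andbF orbF.
have := mem_last y p1; rewrite in_cons; case: eqP => [->|_] /=; last first.
  by move=> h; case: eqP => // E; rewrite E (negbTE vp) in h.
by rewrite eq_sym (negbTE vy).
Qed.

(** * Crosscuts through the edge 01 and their signs *)

Definition middle_edge (o : bool) : seq Z2 := if o then [:: o1; o0] else [:: o0; o1].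

Definition crosscut (A : {fset Z2}) (x y : Z2) (o : bool) (g : seq Z2) : Prop :=
  [/\ path adj x g, uniq (x :: g), all (fun u => u \in A) (x :: g), last x g = y &
    infix (middle_edge o) (x :: g)].

Section Crosscuts.
Variables (A : {fset Z2}) (a b : Z2 * Z2).
Hypothesis ha : is_bdedge A a.
Hypothesis hb : is_bdedge A b.

(** Close [g] by the path [zeta] outside [A]. From the middle edge to the exit edge the parity on
    the right is constant. If [g] goes from 0 to 1, the square on the right of the middle edge is
    the one around $w_0$; if it goes from 1 to 0, it is the square above, separated from the former
    by an edge that is used exactly once. *)
Lemma crosscut_side zeta o g : path adj b.2 zeta -> last b.2 zeta = a.2 ->
  all (fun u => u \notin A) (b.2 :: zeta) -> crosscut A a.1 b.1 o g ->
  let C := g ++ b.2 :: zeta ++ [:: a.1] in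
  xpar (cross (0, -1)) a.1 C = xpar (cross (right_plaq b.1 b.2)) a.1 C (+) o.
Proof.
move=> pz lz /allP zA [pg ug /allP gA lg /infixP[p1 [q e]]] C.
have [aA a2A aa] := ha; have [bA b2A bb] := hb.
set u := nth o0 (middle_edge o) 0; set v := nth o0 (middle_edge o) 1.
have em : middle_edge o = [:: u; v] by rewrite /u /v; case: (o).
rewrite em /= in e.
have pC : path adj a.1 C by rewrite /C cat_path pg lg /= bb cat_path pz lz /= adj_sym aa.
have cC : last a.1 C = a.1 by rewrite /C last_cat /= last_cat.
have eC : a.1 :: C = p1 ++ u :: v :: q ++ b.2 :: (zeta ++ [:: a.1]).
  by rewrite /C -cat_cons e -catA.
have lq : last v q = b.1.
  by have := congr1 (last a.1) e; rewrite last_cat /= lg => ->.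
move: (ug); rewrite e cat_uniq => /and3P[_ /hasPn hp /= /and3P[uvq vq uq]].
have a1 : a.1 \in rcons p1 u.
  by case: p1 e {eC hp} => [|y p1] /= [e1 _]; rewrite e1 inE eqxx.
have uA : u \in A by apply: gA; rewrite e mem_cat inE eqxx orbT.
have dis y : y \in v :: q -> [/\ y \notin p1, y != u & y \notin b.2 :: zeta ++ [:: a.1]].
  move=> yq; have yp : y \notin p1 by apply: hp; rewrite in_cons yq orbT.
  have yu : y != u by apply: contraNneq uvq => <-.
  split=> //; rewrite -cat_cons mem_cat negb_or mem_seq1; apply/andP; split.
    apply/negP => /zA; rewrite gA // e mem_cat in_cons yq !orbT //.
  by apply: contraTneq a1 => <-; rewrite mem_rcons in_cons negb_or yu.
have ub : u != b.2 by apply: contraNneq b2A => <-.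
have := right_plaq_chain pC cC eC _ ub dis; rewrite /= vq uq lq => /(_ isT) <-.
have vu : v != u by have [] := dis v (mem_head _ _).
have [_ _ vr] := dis v (mem_head _ _).
have once : xpar (same_edge v u) a.1 C = true.
  case: q e lq hp uvq vq uq dis eC => [|w q] e lq hp uvq vq uq dis eC.
    have [vp _ _] := dis v (mem_head _ _).
    exact: (xpar_same_edge_once eC vp vu vr ub).
  apply: (xpar_same_edge_once (w := w) (r := q ++ b.2 :: zeta ++ [:: a.1]) eC) => //.
  - by have [] := dis v (mem_head _ _).
  - by rewrite -cat_cons mem_cat negb_or vq.
  - by apply: contraNneq uvq => ->; rewrite !inE eqxx orbT.
move: once; rewrite /u /v; case: (o) => /= once; last by rewrite addbF.
have := winding_ver pC cC 0 0; rewrite sub0r add0r once.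
by rewrite (_ : right_plaq o1 o0 = (0, 0)) //; case: (xpar _ _ _); case: (xpar _ _ _).
Qed.

Section Signs.
Variable sb : Z2 -> Z2 -> bool.
Hypothesis sb_sym : forall y z, sb y z = sb z y.
Hypothesis sbA : forall y z, sb y z -> y \in A.
Hypothesis plaqA : forall p, all (fun v => v \in A) (pcorners p) -> plaq sb p = (p == (0, -1)).
Hypothesis wA : (0, -1) \in A.
Hypothesis cA : lconnected (fun y => y \notin A).

(** The sign of the loop formed by [g] and the reverse of [g'] is its parity around $w_0$. By
    [crosscut_side], with the same [zeta] for both paths, this equals its parity at the square on
    the right of the exit edge plus the difference of the two directions; and the former is 0, since
    that square has the corner [b.2] outside [A]. *)
Lemma crosscut_signs o o' g g' : crosscut A a.1 b.1 o g -> crosscut A a.1 b.1 o' g' ->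
  xpar sb a.1 g (+) xpar sb a.1 g' = (o != o').
Proof.
move=> cg cg'; have [aA a2A aa] := ha; have [bA b2A bb] := hb.
have [zeta [pz zA lz]] := cA b2A a2A.
have zA' : all (fun u => u \notin A) (b.2 :: zeta) by rewrite /= b2A.
have := crosscut_side pz lz zA' cg; have := crosscut_side pz lz zA' cg'.
have [pg ug gA lg _] := cg; have [pg' ug' gA' lg' _] := cg'.
rewrite /= !xpar_cat lg lg' => e' e.
pose l := g ++ rev (belast a.1 g').
have pl : path adj a.1 l.
  rewrite /l cat_path pg lg -lg' rev_path /=.
  by rewrite (eq_path (e' := adj)) // => y z; rewrite adj_sym.
have cl : last a.1 l = a.1.
  rewrite /l last_cat lg -lg'; case: (g') => [|y g''] //=.
  by rewrite rev_cons last_rcons.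
have lA : all (fun y => y \in A) (a.1 :: l).
  apply/allP => y; rewrite in_cons mem_cat mem_rev => /or3P[/eqP -> //|yg|yg].
    by apply: (allP gA); rewrite in_cons yg orbT.
  by apply: (allP gA'); exact: mem_belast yg.
have xl c : (forall y z, c y z = c z y) -> xpar c a.1 l = xpar c a.1 g (+) xpar c a.1 g'.
  by move=> cs; rewrite /l xpar_cat lg -lg' xpar_rev.
rewrite -(xl _ sb_sym) (xpar_plaquettes sb_sym sbA plaqA wA cA pl cl lA) (xl _ (cross_sym _)).
have := winding_out pl cl cA lA b2A (right_plaq_corner bb).
rewrite (xl _ (cross_sym _)).
move: e e'.
case: (xpar (cross (0, -1)) a.1 g); case: (xpar (cross (0, -1)) a.1 g');
case: (xpar _ a.1 g); case: (xpar _ a.1 g');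
case: (xpar _ b.1 _); case: (xpar _ b.1 _); case: (o); case: (o'); by [].
Qed.

(** The vertex 0 is a corner of the square around $w_0$ and is not visited, so the parity at that
    square is carried along [s] to the complement of [A], where it is 0. *)
Lemma loop_sign_avoiding x t s : path adj x t -> last x t = x ->
  all (fun y => y \in A) (x :: t) -> path adj o0 s -> last o0 s \notin A ->
  all (fun y => y \notin x :: t) (o0 :: s) -> xpar sb x t = false.
Proof.
move=> pt ct tA ps sA off.
rewrite (xpar_plaquettes sb_sym sbA plaqA wA cA pt ct tA).
have o0t : o0 \notin x :: t by case/andP: off.
rewrite (winding_corners pt ct (v := o0) o0t); last by rewrite /corners !inE.
rewrite (winding_path pt ct ps off).
by apply: (winding_out pt ct cA tA sA); rewrite mem_head.
Qed.
End Signs.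
End Crosscuts.

(** * Continuous arguments along curves *)

(** Compactness of the interval in additive form: at the supremum of the [x] with [P a x], the local
    property carries [P] beyond it unless it is [b]. *)
Lemma cousin (R : realType) (P : R -> R -> Prop) (a b : R) : a <= b ->
  (forall x y z, a <= x -> x <= y -> y <= z -> z <= b -> P x y -> P y z -> P x z) ->
  (forall x, a <= x <= b -> exists2 d, 0 < d &
     forall y z, a <= y -> y <= x -> x <= z -> z <= b -> x - d < y -> z < x + d -> P y z) ->
  P a b.
Proof.
move=> ab cat loc; pose S : set R := [set x | a <= x <= b /\ P a x].
have Sa : S a.
  split; first by rewrite lexx.
  have [|d d0 h] := loc a; first by rewrite lexx.
  by apply: h => //; rewrite ?ltrBlDr ltrDl.
have ubS : has_ubound S by exists b => x [/andP[]].
have sS : has_sup S by split; [exists a|].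
have as_ : a <= sup S by exact: ub_le_sup.
have sb : sup S <= b by apply: ge_sup => [|x [/andP[]]]; [exists a|].
have [|d d0 h] := loc (sup S); first by rewrite as_.
have [x [/andP[ax xb] Px] sx] := sup_adherent d0 sS.
have xs : x <= sup S by apply: ub_le_sup => //; split; rewrite ?ax.
pose z := Num.min b (sup S + d / 2).
have d2 : 0 < d / 2 by rewrite divr_gt0.
have sz : sup S <= z by rewrite le_min sb lerDl ltW.
have zb : z <= b by rewrite ge_min lexx.
have Pz : P a z.
  apply: (cat _ x) => //; first exact: le_trans xs sz.
  by apply: h => //; rewrite /z gt_min ltrD2l ltr_pdivrMr // ltr_pMr // ltr1n orbT.
have zs : z <= sup S by apply: ub_le_sup => //; split; rewrite // (le_trans as_ sz).
have : z = b by move: zs; rewrite /z; case: (leP b (sup S + d / 2)) => // _; lra.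
by move=> <-.
Qed.

Lemma cosD2piz (R : realType) (k : int) (y : R) : cos (y + 2 * pi * k%:~R) = cos y.
Proof.
have cosDn (n : nat) (z : R) : cos (z + 2 * pi * n%:R) = cos z.
  by rewrite mulr_natr mulr_natl; exact: periodicn (@cosD2pi R) n z.
case: k => k; first exact: cosDn.
by rewrite NegzE mulrNz mulrN -[LHS](cosDn k.+1) subrK.
Qed.

Lemma sinD2piz (R : realType) (k : int) (y : R) : sin (y + 2 * pi * k%:~R) = sin y.
Proof.
have sinDn (n : nat) (z : R) : sin (z + 2 * pi * n%:R) = sin z.
  by rewrite mulr_natr mulr_natl; exact: periodicn (@sinD2pi R) n z.
case: k => k; first exact: sinDn.
by rewrite NegzE mulrNz mulrN -[LHS](sinDn k.+1) subrK.
Qed.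

Lemma floor_2pi (R : realType) (x y : R) (n : int) : x - y = 2 * pi * n%:~R ->
  Num.floor (x / (2 * pi)) = Num.floor (y / (2 * pi)) + n.
Proof.
have p2 : 2 * pi != 0 :> R by rewrite gt_eqF // mulr_gt0 // pi_gt0.
move=> /eqP; rewrite subr_eq => /eqP ->; rewrite mulrDl mulrAC divff // mul1r.
by rewrite floorDzr ?intr_int // intrKfloor addrC.
Qed.

Lemma cos_eq1_int (R : realType) (x : R) : cos x = 1 -> exists n : int, x = 2 * pi * n%:~R.
Proof.
move=> cx; have pi0 := pi_gt0 R; have p2 : 0 < 2 * pi :> R by rewrite mulr_gt0.
pose n := Num.floor (x / (2 * pi)); exists n.
pose y := x - 2 * pi * n%:~R.
have cy : cos y = 1 by rewrite -(cosD2piz n) /y subrK.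
have y0 : 0 <= y.
  by rewrite subr_ge0 mulrC -ler_pdivlMr // ge_floor.
have y1 : y < 2 * pi.
  have : x / (2 * pi) < (n + 1)%:~R by exact: lt_succ_floor.
  by rewrite ltr_pdivrMr // intrD mulrDl mul1r mulrC /y ltrBlDl.
suff : y = 0 by move/eqP; rewrite subr_eq0 => /eqP.
have z0 : (0 : R) \in `[0, pi] by rewrite in_itv /= lexx ltW.
have [ypi|piy] := leP y pi.
  have yi : y \in `[0, pi] by rewrite in_itv /= y0.
  by apply: (cos_inj yi z0); rewrite cos0.
have yi : 2 * pi - y \in `[0, pi] by rewrite in_itv /=; apply/andP; split; lra.
have cy' : cos (2 * pi - y) = cos 0.
  by rewrite cos0; have := cosD2piz 1 (- y); rewrite cosN cy mulr1 addrC.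
by have := cos_inj yi z0 cy'; lra.
Qed.

Section Turning.
Variable R : realType.
Implicit Types (X Y Th phi : R -> R) (a b x y t : R) (k : int).

Definition polar x y theta : Prop :=
  x = Num.sqrt (x ^+ 2 + y ^+ 2) * cos theta /\ y = Num.sqrt (x ^+ 2 + y ^+ 2) * sin theta.

Definition branch Th a b : int :=
  Num.floor (Th b / (2 * pi)) - Num.floor (Th a / (2 * pi)).

(** The lift is continuous on the whole line and not only on the interval, which makes
    reparametrization and gluing simple; [clamp] will reduce curves given on an interval to this
    situation. *)
Definition turn X Y a b k : Prop := exists2 Th, continuous Th &
  (forall t, a <= t <= b -> polar (X t) (Y t) (Th t)) /\ k = branch Th a b.

Let p2 : 0 < 2 * pi :> R. Proof. by rewrite mulr_gt0 // pi_gt0. Qed.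

Lemma polar_unique x y theta theta' : 0 < x ^+ 2 + y ^+ 2 ->
  polar x y theta -> polar x y theta' -> exists n : int, theta - theta' = 2 * pi * n%:~R.
Proof.
move=> r0 [cx sy] [cx' sy']; apply: cos_eq1_int; rewrite cosB.
set r := Num.sqrt _ in cx sy cx' sy'.
have r1 : r != 0 by rewrite sqrtr_eq0 -ltNge.
have rr : r ^+ 2 = x ^+ 2 + y ^+ 2 by rewrite sqr_sqrtr // ltW.
apply: (mulfI (expf_neq0 2 r1)); rewrite mulr1 [RHS]rr !expr2.
clearbody r; rewrite [LHS](_ : _ = (r * cos theta) * (r * cos theta') +
  (r * sin theta) * (r * sin theta')); last by ring.
by rewrite -cx -cx' -sy -sy'.
Qed.

Lemma branch_shift Th Th' a b (n : int) :
  Th a - Th' a = 2 * pi * n%:~R -> Th b - Th' b = 2 * pi * n%:~R ->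
  branch Th a b = branch Th' a b.
Proof.
by rewrite /branch => /floor_2pi -> /floor_2pi ->; rewrite opprD addrACA subrr addr0.
Qed.

(** The difference of two lifts is continuous with values in $2\pi\mathbb Z$. If it changed, it
    would take a value halfway between two multiples of $2\pi$. *)
Lemma branch_unique X Y Th Th' a b : a <= b ->
  (forall t, a <= t <= b -> 0 < X t ^+ 2 + Y t ^+ 2) ->
  {within `[a, b], continuous Th} -> {within `[a, b], continuous Th'} ->
  (forall t, a <= t <= b -> polar (X t) (Y t) (Th t)) ->
  (forall t, a <= t <= b -> polar (X t) (Y t) (Th' t)) ->
  branch Th a b = branch Th' a b.
Proof.
move=> ab r0 cT cT' pT pT'.
have D t : a <= t <= b -> exists n : int, Th t - Th' t = 2 * pi * n%:~R.
  by move=> tab; apply: polar_unique (pT t tab) (pT' t tab); exact: r0.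
have [m em] : exists n : int, Th a - Th' a = 2 * pi * n%:~R by apply: D; rewrite lexx.
have [n en] : exists n : int, Th b - Th' b = 2 * pi * n%:~R by apply: D; rewrite lexx ab.
case: (eqVneq m n) => [mn|mn]; first by apply: branch_shift em _; rewrite mn.
have ivt (l : int) (v : R) : v = 2 * pi * (l%:~R + 2^-1) ->
    Num.min (Th a - Th' a) (Th b - Th' b) <= v <= Num.max (Th a - Th' a) (Th b - Th' b) ->
    False.
  move=> ev vab.
  have cD : {within `[a, b], continuous (fun t => Th t - Th' t)}.
    by move=> t; apply: continuousB; [exact: cT|exact: cT'].
  have [c cab] := IVT ab cD vab; rewrite in_itv /= in cab.
  have [k ->] := D c cab; rewrite ev => /(mulfI (lt0r_neq0 p2)) h.
  have : (2 * k)%:~R = (2 * l + 1)%:~R :> R by rewrite intrD !intrM h; lra.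
  by move/intr_inj; lia.
have half (l l' : int) : l < l' ->
    2 * (pi : R) * l%:~R <= 2 * (pi : R) * (l%:~R + 2^-1) <= 2 * (pi : R) * l'%:~R.
  move=> ll; rewrite !(ler_pM2l p2) lerDl invr_ge0 ler0n /=.
  have : (l + 1)%:~R <= l'%:~R :> R by rewrite ler_int; lia.
  by rewrite intrD; lra.
exfalso; case: (ltgtP m n) mn => // [mn|nm] _.
  apply: (ivt m _ erefl); have /andP[h1 h2] := half _ _ mn.
  by rewrite ge_min le_max em en h1 h2 orbT.
apply: (ivt n _ erefl); have /andP[h1 h2] := half _ _ nm.
by rewrite ge_min le_max em en h1 h2 orbT.
Qed.

Lemma turn_branch X Y a b k Th : a <= b ->
  (forall t, a <= t <= b -> 0 < X t ^+ 2 + Y t ^+ 2) -> turn X Y a b k ->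
  {within `[a, b], continuous Th} ->
  (forall t, a <= t <= b -> polar (X t) (Y t) (Th t)) -> branch Th a b = k.
Proof.
move=> ab r0 [T1 c1 [p1 ->]] cT pT.
by apply: (branch_unique ab r0 cT _ pT p1); exact: continuous_subspaceT.
Qed.

Lemma turn_unique X Y a b k k' : a <= b ->
  (forall t, a <= t <= b -> 0 < X t ^+ 2 + Y t ^+ 2) -> turn X Y a b k -> turn X Y a b k' -> k = k'.
Proof.
move=> ab r0 tk [Th cT [pT ->]]; apply/esym/(turn_branch ab r0 tk) => //.
exact: continuous_subspaceT.
Qed.

Lemma eq_turn X Y X' Y' a b k : (forall t, a <= t <= b -> X t = X' t /\ Y t = Y' t) ->
  turn X Y a b k -> turn X' Y' a b k.
Proof.
move=> e [Th cT [pT ->]]; exists Th => //; split=> // t tab.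
by have [<- <-] := e t tab; exact: pT.
Qed.

Lemma turn_comp X Y a b a' b' k phi : continuous phi ->
  (forall t, a' <= t <= b' -> a <= phi t <= b) -> phi a' = a -> phi b' = b ->
  turn X Y a b k -> turn (X \o phi) (Y \o phi) a' b' k.
Proof.
move=> cphi hphi ea eb [Th cT [pT ->]]; exists (Th \o phi).
  by move=> t; apply: continuous_comp; [exact: cphi|exact: cT].
by split; [move=> t /hphi; exact: pT|rewrite /branch /= ea eb].
Qed.

Lemma turn_rev X Y a b a' b' k phi : continuous phi ->
  (forall t, a' <= t <= b' -> a <= phi t <= b) -> phi a' = b -> phi b' = a ->
  turn X Y a b k -> turn (X \o phi) (Y \o phi) a' b' (- k).
Proof.
move=> cphi hphi ea eb [Th cT [pT ->]]; exists (Th \o phi).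
  by move=> t; apply: continuous_comp; [exact: cphi|exact: cT].
by split; [move=> t /hphi; exact: pT|rewrite /branch /= ea eb opprB].
Qed.

Lemma continuous_minl (m : R) : continuous (fun t : R => Num.min t m).
Proof. by move=> t; apply: continuous_min; [exact: cvg_id|exact: cvg_cst]. Qed.

Lemma continuous_maxl (m : R) : continuous (fun t : R => Num.max t m).
Proof. by move=> t; apply: continuous_max; [exact: cvg_id|exact: cvg_cst]. Qed.

Lemma turn_cat X Y a m b k k' : a <= m -> m <= b -> 0 < X m ^+ 2 + Y m ^+ 2 ->
  turn X Y a m k -> turn X Y m b k' -> turn X Y a b (k + k').
Proof.
move=> am mb r0 [T1 c1 [p1 ->]] [T2 c2 [p2' ->]].
have [n en] : exists n : int, T1 m - T2 m = 2 * pi * n%:~R.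
  by apply: polar_unique r0 (p1 m _) (p2' m _); rewrite ?am ?lexx ?mb.
(* Equal to [T1] before [m] and to [T2] shifted by a multiple of $2\pi$ after it, and continuous
   without any case distinction. *)
pose T t := T1 (Num.min t m) + T2 (Num.max t m) - T2 m.
have Tl t : t <= m -> T t = T1 t.
  by move=> tm; rewrite /T min_l // max_r // addrK.
have Tr t : m <= t -> T t = T2 t + 2 * pi * n%:~R.
  by move=> tm; rewrite /T min_r // max_l // -en; lra.
exists T.
  move=> t; apply: cvgB; last exact: cvg_cst.
  apply: cvgD.
    apply: (@continuous_comp _ _ _ (fun t => Num.min t m) T1); last exact: c1.
    exact: continuous_minl.
  apply: (@continuous_comp _ _ _ (fun t => Num.max t m) T2); last exact: c2.
  exact: continuous_maxl.
split.
  move=> t /andP[ta tb]; have [tm|/ltW tm] := leP t m.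
    by rewrite Tl //; apply: p1; rewrite ta.
  have pt : polar (X t) (Y t) (T2 t) by apply: p2'; rewrite tm.
  by rewrite Tr // /polar cosD2piz sinD2piz.
rewrite /branch [in RHS]Tr // [in RHS]Tl // (floor_2pi en).
rewrite (@floor_2pi _ (T2 b + _) (T2 b) n); last by rewrite addrAC subrr add0r.
by lia.
Qed.

End Turning.

Section Angles.
Variable R : realType.
Implicit Types (X Y : R -> R) (a b x y t : R).

Definition modulus x y : R := Num.sqrt (x ^+ 2 + y ^+ 2).

(** The argument in $(-\pi,\pi)$ from the half-angle formula $\tan(\theta/2)=y/(r+x)$; the
    denominator vanishes exactly on the closed negative half-axis. *)
Definition half_arg x y : R := 2 * atan (y / (modulus x y + x)).

Lemma polar_half_arg x y : 0 < modulus x y + x -> polar x y (half_arg x y).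
Proof.
rewrite /polar /half_arg -/(modulus x y) => d0; set r := modulus x y in d0 *.
have r0 : 0 <= r by exact: sqrtr_ge0.
have r2 : r ^+ 2 = x ^+ 2 + y ^+ 2 by rewrite sqr_sqrtr // addr_ge0 // sqr_ge0.
clearbody r; have rp : 0 < r.
  rewrite lt_neqAle r0 andbT; apply/eqP => re; rewrite -re add0r in d0.
  have := sqr_ge0 y; have : 0 < x ^+ 2 by rewrite exprn_gt0.
  by rewrite -re expr0n /= in r2; lra.
set u := y / (r + x); have u1 : 1 + u ^+ 2 = 2 * r / (r + x).
  have dn : r + x != 0 by rewrite gt_eqF.
  rewrite /u expr_div_n; apply: (mulIf (expf_neq0 2 dn)).
  rewrite mulrDl mul1r divfK ?expf_neq0 // expr2 mulrA divfK //.
  have -> : y ^+ 2 = r ^+ 2 - x ^+ 2 by rewrite r2; ring.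
  by ring.
have s0 : Num.sqrt (1 + u ^+ 2) != 0 by rewrite sqrtr_eq0 -ltNge ltr_pwDl // sqr_ge0.
have c2 : cos (atan u) ^+ 2 = (r + x) / (2 * r).
  rewrite cos_atan exprVn sqr_sqrtr ?u1 ?invf_div //.
  by rewrite divr_ge0 ?mulr_ge0 // ltW.
have sn : sin (atan u) = u * cos (atan u).
  by rewrite -{2}(atanK u) /tan divfK // cos_atan invr_neq0.
have rn : r != 0 by rewrite gt_eqF.
rewrite mulr_natl cos_mulr2n sin_mulr2n sn c2 [cos _ * _]mulrCA -expr2 c2.
have dn : r + x != 0 by rewrite gt_eqF.
by split; rewrite /u; field; rewrite ?rn ?dn.
Qed.

Lemma half_arg_bound x y : - pi < half_arg x y < pi.
Proof.
have := atan_gtNpi2 (y / (modulus x y + x)); have := atan_ltpi2 (y / (modulus x y + x)).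
by rewrite /half_arg; lra.
Qed.

(** The integer part of the argument in $(-\pi,\pi)$ divided by $2\pi$: it changes only across the
    positive half-axis, which is the branch cut. *)
Definition below (y : R) : int := if y < 0 then -1 else 0.

Lemma floor_half_arg x y : 0 < modulus x y + x ->
  Num.floor (half_arg x y / (2 * pi)) = below y.
Proof.
move=> d0; have p2 : 0 < 2 * pi :> R by rewrite mulr_gt0 // pi_gt0.
have /andP[h1 h2] := half_arg_bound x y; have pi0 := pi_gt0 R.
rewrite /below; case: ltP => y0.
  have hn : half_arg x y < 0.
    by rewrite /half_arg pmulr_rlt0 // -[ltRHS](@atan0 R) lt_atan // pmulr_llt0 // invr_gt0.
  apply: floor_def; rewrite addNr (_ : (-1)%:~R = -1) // ler_pdivlMr // ltr_pdivrMr // mul0r.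
  by rewrite mulN1r hn andbT; lra.
have hp : 0 <= half_arg x y.
  by rewrite /half_arg mulr_ge0 // -[leLHS](@atan0 R) le_atan // divr_ge0 // ltW.
apply: floor_def; rewrite add0r ler_pdivlMr // ltr_pdivrMr // mul0r mul1r hp /=; lra.
Qed.

Lemma modulus_continuous (T : topologicalType) (f g : T -> R) : continuous f -> continuous g ->
  continuous (fun z : T => modulus (f z) (g z)).
Proof.
move=> cf cg t; apply: (@continuous_comp _ _ _ (fun z => f z ^+ 2 + g z ^+ 2) Num.sqrt); last exact: sqrt_continuous.
by apply: cvgD; apply: cvgM; do ?[exact: cf|exact: cg].
Qed.

Lemma half_arg_continuous (T : topologicalType) (f g : T -> R) : continuous f -> continuous g ->
  (forall z, 0 < modulus (f z) (g z) + f z) -> continuous (fun z : T => half_arg (f z) (g z)).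
Proof.
move=> cf cg d0 t; apply: cvgM; first exact: cvg_cst.
apply: (@continuous_comp _ _ _ (fun z => g z / (modulus (f z) (g z) + f z)) (@atan R)); last exact: continuous_atan.
apply: cvgM; first exact: cg.
apply: cvgV; first by rewrite gt_eqF.
by apply: cvgD; [exact: modulus_continuous|exact: cf].
Qed.

Lemma turn_right X Y a b : continuous X -> continuous Y ->
  (forall t, 0 < modulus (X t) (Y t) + X t) -> turn X Y a b (below (Y b) - below (Y a)).
Proof.
move=> cX cY d0; exists (fun t => half_arg (X t) (Y t)); first exact: half_arg_continuous.
by split=> [t _|]; [exact: polar_half_arg|rewrite /branch !floor_half_arg].
Qed.

Lemma modulusN x y : modulus (- x) (- y) = modulus x y.
Proof. by rewrite /modulus !sqrrN. Qed.

(** Off the positive half-axis there is a continuous argument in $(0,2\pi)$, namely [half_arg] of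
    the opposite point plus $\pi$, and every integer part is then 0. *)
Lemma turn_slit X Y a b : continuous X -> continuous Y ->
  (forall t, 0 < modulus (X t) (Y t) - X t) -> turn X Y a b 0.
Proof.
move=> cX cY d0.
have d1 t : 0 < modulus (- X t) (- Y t) + - X t by rewrite modulusN.
have pi0 := pi_gt0 R.
exists (fun t => half_arg (- X t) (- Y t) + pi).
  move=> t; apply: cvgD; last exact: cvg_cst.
  by apply: (@half_arg_continuous _ (fun t => - X t) (fun t => - Y t)) => // s; apply: cvgN; do ?[exact: cX|exact: cY].
have p2 : 0 < 2 * pi :> R by rewrite mulr_gt0.
have fl t : Num.floor ((half_arg (- X t) (- Y t) + pi) / (2 * pi)) = 0.
  apply: floor_def; rewrite add0r ler_pdivlMr // ltr_pdivrMr // mul0r mul1r.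
  by have := half_arg_bound (- X t) (- Y t); lra.
split=> [t _|]; last by rewrite /branch !fl subrr.
have := polar_half_arg (d1 t); rewrite /polar -/(modulus (- X t) (- Y t)) modulusN cosDpi sinDpi.
by rewrite !mulrN /modulus => -[<- <-]; rewrite !opprK.
Qed.
End Angles.

Section Clamp.
Variable R : realType.
Implicit Types (a b t : R).

Definition clamp a b t : R := Num.max (Num.min t b) a.

Lemma clamp_continuous a b : continuous (clamp a b).
Proof.
move=> t; apply: (@continuous_comp _ _ _ (fun t => Num.min t b) (fun t => Num.max t a)).
  exact: continuous_minl.
exact: continuous_maxl.
Qed.

Lemma clamp_itv a b t : a <= b -> a <= clamp a b t <= b.
Proof. by move=> ab; rewrite /clamp le_max lexx orbT ge_max ge_min lexx orbT ab. Qed.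

Lemma clamp_id a b t : a <= t <= b -> clamp a b t = t.
Proof. by case/andP=> ta tb; rewrite /clamp min_l // max_l. Qed.

Lemma positive_near (g : R -> R) x : {for x, continuous g} -> 0 < g x ->
  exists2 d, 0 < d & forall t, `|t - x| < d -> 0 < g t.
Proof.
move=> cg gx; have : \forall t \near x, 0 < g t by apply: cvgr_gt cg _ gx.
case/nbhs_ballP => d /= d0 h; exists d => // t tx; apply: h.
by rewrite /ball /= distrC.
Qed.

Lemma positive_near2 (g : R * R -> R) x y : {for (x, y), continuous g} -> 0 < g (x, y) ->
  exists2 d, 0 < d & forall s t, `|s - x| < d -> `|t - y| < d -> 0 < g (s, t).
Proof.
move=> cg gx; have : \forall z \near (x, y), 0 < g z by apply: cvgr_gt cg _ gx.
case/nbhs_ballP => d /= d0 h; exists d => // s t sx ty; apply: h.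
by split; rewrite /ball /= distrC.
Qed.

Lemma modulus_dichotomy (x y : R) : 0 < x ^+ 2 + y ^+ 2 ->
  0 < modulus x y + x \/ 0 < modulus x y - x.
Proof.
move=> r0; have m0 : 0 < modulus x y by rewrite sqrtr_gt0.
by have [x0|x0] := leP 0 x; [left; rewrite ltr_pwDl|right; rewrite subr_gt0 (lt_trans x0)].
Qed.

Lemma clamp_comp_continuous (X : R -> R) a b : a <= b ->
  (forall t, a <= t <= b -> {for t, continuous X}) -> continuous (X \o clamp a b).
Proof.
move=> ab cX t; apply: continuous_comp; first exact: clamp_continuous.
by apply: cX; exact: clamp_itv.
Qed.

Lemma turn_clamp (X Y : R -> R) a b k :
  turn (X \o clamp a b) (Y \o clamp a b) a b k -> turn X Y a b k.
Proof. by apply: eq_turn => t tab; rewrite /= clamp_id. Qed.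

Lemma turn_right_on (X Y : R -> R) a b : a <= b ->
  (forall t, a <= t <= b -> {for t, continuous X} /\ {for t, continuous Y}) ->
  (forall t, a <= t <= b -> 0 < modulus (X t) (Y t) + X t) ->
  turn X Y a b (below (Y b) - below (Y a)).
Proof.
move=> ab cXY d0; apply: turn_clamp.
have := @turn_right R (X \o clamp a b) (Y \o clamp a b) a b.
rewrite /= !clamp_id ?lexx ?ab //; apply=> [||t]; last by apply: d0; exact: clamp_itv.
  by apply: clamp_comp_continuous => // t /cXY[].
by apply: clamp_comp_continuous => // t /cXY[].
Qed.

Lemma turn_slit_on (X Y : R -> R) a b : a <= b ->
  (forall t, a <= t <= b -> {for t, continuous X} /\ {for t, continuous Y}) ->
  (forall t, a <= t <= b -> 0 < modulus (X t) (Y t) - X t) -> turn X Y a b 0.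
Proof.
move=> ab cXY d0; apply: turn_clamp.
apply: turn_slit => [||t]; last by apply: d0; exact: clamp_itv.
  by apply: clamp_comp_continuous => // t /cXY[].
by apply: clamp_comp_continuous => // t /cXY[].
Qed.

(** Near each time the curve misses the negative or the positive half-axis, where a lift is
    explicit; [cousin] glues the local lifts. *)
Lemma turn_exists (X Y : R -> R) a b : a <= b ->
  (forall t, a <= t <= b -> {for t, continuous X} /\ {for t, continuous Y}) ->
  (forall t, a <= t <= b -> 0 < X t ^+ 2 + Y t ^+ 2) -> exists k, turn X Y a b k.
Proof.
move=> ab cXY r0.
apply: (@cousin _ (fun y z => exists k, turn X Y y z k) _ _ ab).
  move=> x y z ax xy yz zb [k tk] [k' tk']; exists (k + k').
  by apply: turn_cat tk tk' => //; apply: r0; rewrite (le_trans ax xy) (le_trans yz zb).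
move=> x xab; have [cX cY] := cXY x xab.
have cM : {for x, continuous (fun t => modulus (X t) (Y t))}.
  apply: (@continuous_comp _ _ _ (fun t => X t ^+ 2 + Y t ^+ 2) Num.sqrt); last exact: sqrt_continuous.
  by apply: cvgD; apply: cvgM.
have sub y z t : a <= y -> z <= b -> y <= t <= z -> a <= t <= b.
  by move=> ay zb /andP[yt tz]; rewrite (le_trans ay) ?(le_trans tz).
have close y z d t : x - d < y -> z < x + d -> y <= t <= z -> `|t - x| < d.
  by move=> h1 h2 /andP[h3 h4]; rewrite ltr_norml; apply/andP; split; lra.
case: (modulus_dichotomy (r0 x xab)) => mx.
  have [d d0 hd] := positive_near (g := fun t => modulus (X t) (Y t) + X t) (cvgD cM cX) mx.
  exists d => // y z ay yx xz zb dy zd; exists (below (Y z) - below (Y y)).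
  apply: turn_right_on => [|t tyz|t tyz]; first exact: le_trans xz.
    by apply: cXY; exact: sub tyz.
  by apply: hd; exact: close tyz.
have [d d0 hd] := positive_near (g := fun t => modulus (X t) (Y t) - X t) (cvgB cM cX) mx.
exists d => // y z ay yx xz zb dy zd; exists 0.
apply: turn_slit_on => [|t tyz|t tyz]; first exact: le_trans xz.
  by apply: cXY; exact: sub tyz.
by apply: hd; exact: close tyz.
Qed.

(** The signed number of crossings of the branch cut, hence an integer even when the curve is not
    closed. The default 0 concerns only curves without a lift. *)
Definition winding (X Y : R -> R) a b : int := xget 0 [set k | turn X Y a b k].

Lemma windingP (X Y : R -> R) a b : a <= b ->
  (forall t, a <= t <= b -> {for t, continuous X} /\ {for t, continuous Y}) ->
  (forall t, a <= t <= b -> 0 < X t ^+ 2 + Y t ^+ 2) -> turn X Y a b (winding X Y a b).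
Proof.
move=> ab cXY r0; rewrite /winding; case: xgetP => [k _ //|h].
by have [k tk] := turn_exists ab cXY r0; case: (h k).
Qed.

Lemma turn_winding (X Y : R -> R) a b k : a <= b ->
  (forall t, a <= t <= b -> 0 < X t ^+ 2 + Y t ^+ 2) -> turn X Y a b k -> winding X Y a b = k.
Proof.
move=> ab r0 tk; rewrite /winding; case: xgetP => [k' _ tk'|h]; last by case: (h k).
exact: turn_unique r0 tk' tk.
Qed.

Lemma winding_cat (X Y : R -> R) a m b : a <= m -> m <= b ->
  (forall t, a <= t <= b -> {for t, continuous X} /\ {for t, continuous Y}) ->
  (forall t, a <= t <= b -> 0 < X t ^+ 2 + Y t ^+ 2) ->
  winding X Y a b = winding X Y a m + winding X Y m b.
Proof.
move=> am mb cXY r0; apply: turn_winding => //; first exact: le_trans mb.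
apply: (turn_cat am mb); first by apply: r0; rewrite am.
  by apply: windingP => // t /andP[ta tm]; [apply: cXY|apply: r0]; rewrite ta (le_trans tm).
by apply: windingP => // t /andP[ta tm]; [apply: cXY|apply: r0]; rewrite tm (le_trans am).
Qed.

End Clamp.

(** * Circulation around rectangles *)

Section Rectangle.
Variable R : realType.
Variables u v : R -> R -> R.

Definition regular (x y : R) : Prop :=
  [/\ {for (x, y), continuous (fun p => u p.1 p.2)},
      {for (x, y), continuous (fun p => v p.1 p.2)} & 0 < u x y ^+ 2 + v x y ^+ 2].

Definition circulation (x1 x2 y1 y2 : R) : int :=
  winding (u^~ y1) (v^~ y1) x1 x2 + winding (u x2) (v x2) y1 y2
  - winding (u^~ y2) (v^~ y2) x1 x2 - winding (u x1) (v x1) y1 y2.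

Lemma regular_hor x y : regular x y -> {for x, continuous (u^~ y)} /\ {for x, continuous (v^~ y)}.
Proof.
have c : {for x, continuous (fun s : R => (s, y))} by exact: (cvg_pair cvg_id (cvg_cst _)).
by case=> cu cv _; split; [apply: (continuous_comp c cu)|apply: (continuous_comp c cv)].
Qed.

Lemma regular_ver x y : regular x y -> {for y, continuous (u x)} /\ {for y, continuous (v x)}.
Proof.
have c : {for y, continuous (fun s : R => (x, s))} by exact: (cvg_pair (cvg_cst _) cvg_id).
by case=> cu cv _; split; [apply: (continuous_comp c cu)|apply: (continuous_comp c cv)].
Qed.

Lemma winding_hor_cat y x1 x2 x3 : x1 <= x2 -> x2 <= x3 -> (forall x, x1 <= x <= x3 -> regular x y) ->
  winding (u^~ y) (v^~ y) x1 x3 = winding (u^~ y) (v^~ y) x1 x2 + winding (u^~ y) (v^~ y) x2 x3.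
Proof.
move=> h1 h2 r; apply: winding_cat => // t /r; first exact: regular_hor.
by case.
Qed.

Lemma winding_ver_cat x y1 y2 y3 : y1 <= y2 -> y2 <= y3 -> (forall y, y1 <= y <= y3 -> regular x y) ->
  winding (u x) (v x) y1 y3 = winding (u x) (v x) y1 y2 + winding (u x) (v x) y2 y3.
Proof.
move=> h1 h2 r; apply: winding_cat => // t /r; first exact: regular_ver.
by case.
Qed.

Lemma circulation_cat_hor x1 x2 x3 y1 y2 : x1 <= x2 -> x2 <= x3 ->
  (forall x, x1 <= x <= x3 -> regular x y1 /\ regular x y2) ->
  circulation x1 x3 y1 y2 = circulation x1 x2 y1 y2 + circulation x2 x3 y1 y2.
Proof.
move=> h1 h2 r; rewrite /circulation.
rewrite (@winding_hor_cat y1 x1 x2 x3) // => [|x /r[]//].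
by rewrite (@winding_hor_cat y2 x1 x2 x3) // => [|x /r[]//]; lia.
Qed.

Lemma circulation_cat_ver x1 x2 y1 y2 y3 : y1 <= y2 -> y2 <= y3 ->
  (forall y, y1 <= y <= y3 -> regular x1 y /\ regular x2 y) ->
  circulation x1 x2 y1 y3 = circulation x1 x2 y1 y2 + circulation x1 x2 y2 y3.
Proof.
move=> h1 h2 r; rewrite /circulation.
rewrite (@winding_ver_cat x1 y1 y2 y3) // => [|y /r[]//].
by rewrite (@winding_ver_cat x2 y1 y2 y3) // => [|y /r[]//]; lia.
Qed.

(** When the image misses a half-axis, the count along a side is a difference of values at its
    endpoints, or 0, so the four sides cancel. *)
Lemma circulation_local x1 x2 y1 y2 : x1 <= x2 -> y1 <= y2 ->
  (forall x y, x1 <= x <= x2 -> y1 <= y <= y2 -> regular x y) ->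
  (forall x y, x1 <= x <= x2 -> y1 <= y <= y2 -> 0 < modulus (u x y) (v x y) + u x y) \/
  (forall x y, x1 <= x <= x2 -> y1 <= y <= y2 -> 0 < modulus (u x y) (v x y) - u x y) ->
  circulation x1 x2 y1 y2 = 0.
Proof.
move=> hx hy r; have X1 : x1 <= x1 <= x2 by rewrite lexx.
have X2 : x1 <= x2 <= x2 by rewrite lexx hx.
have Y1 : y1 <= y1 <= y2 by rewrite lexx.
have Y2 : y1 <= y2 <= y2 by rewrite lexx hy.
have ch y : y1 <= y <= y2 -> forall x, x1 <= x <= x2 ->
    {for x, continuous (u^~ y)} /\ {for x, continuous (v^~ y)}.
  by move=> hy' x hx'; apply: regular_hor; exact: r.
have cv x : x1 <= x <= x2 -> forall y, y1 <= y <= y2 ->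
    {for y, continuous (u x)} /\ {for y, continuous (v x)}.
  by move=> hx' y hy'; apply: regular_ver; exact: r.
have rh y : y1 <= y <= y2 -> forall x, x1 <= x <= x2 -> 0 < u x y ^+ 2 + v x y ^+ 2.
  by move=> hy' x hx'; have [] := r x y hx' hy'.
have rv x : x1 <= x <= x2 -> forall y, y1 <= y <= y2 -> 0 < u x y ^+ 2 + v x y ^+ 2.
  by move=> hx' y hy'; have [] := r x y hx' hy'.
case=> d0.
  have th y : y1 <= y <= y2 -> winding (u^~ y) (v^~ y) x1 x2 = below (v x2 y) - below (v x1 y).
    move=> hy'; apply: (turn_winding hx (rh y hy')).
    by apply: (turn_right_on hx (ch y hy')) => x hx'; exact: d0.
  have tv x : x1 <= x <= x2 -> winding (u x) (v x) y1 y2 = below (v x y2) - below (v x y1).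
    move=> hx'; apply: (turn_winding hy (rv x hx')).
    by apply: (turn_right_on hy (cv x hx')) => y hy'; exact: d0.
  by rewrite /circulation !th // !tv //; lia.
have th y : y1 <= y <= y2 -> winding (u^~ y) (v^~ y) x1 x2 = 0.
  move=> hy'; apply: (turn_winding hx (rh y hy')).
  by apply: (turn_slit_on hx (ch y hy')) => x hx'; exact: d0.
have tv x : x1 <= x <= x2 -> winding (u x) (v x) y1 y2 = 0.
  move=> hx'; apply: (turn_winding hy (rv x hx')).
  by apply: (turn_slit_on hy (cv x hx')) => y hy'; exact: d0.
by rewrite /circulation !th // !tv.
Qed.

(** [cousin] is used twice: in [x], and for its local hypothesis at a fixed [x], in [y]. The inner
    property includes the width [d] of a vertical strip about [x], and gluing keeps the smaller
    width. *)
Lemma circulation_eq0 x1 x2 y1 y2 : x1 <= x2 -> y1 <= y2 ->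
  (forall x y, x1 <= x <= x2 -> y1 <= y <= y2 -> regular x y) ->
  circulation x1 x2 y1 y2 = 0.
Proof.
move=> hx hy r.
have sub (a b c d t : R) : a <= c -> d <= b -> c <= t <= d -> a <= t <= b.
  by move=> ac db /andP[ct td]; rewrite (le_trans ac) ?(le_trans td).
apply: (@cousin _ (fun a b => circulation a b y1 y2 = 0) _ _ hx).
  move=> a b c xa ab bc cx e1 e2; rewrite (@circulation_cat_hor a b c) ?e1 ?e2 //.
  by move=> x xac; split; apply: r; rewrite ?lexx ?hy //; exact: sub xac.
move=> x xx.
apply: (@cousin _ (fun a b => exists2 d, 0 < d & forall y z, x1 <= y -> y <= x -> x <= z -> z <= x2 ->
   x - d < y -> z < x + d -> circulation y z a b = 0) _ _ hy).
  move=> a b c ya ab bc cy [d d0 hd] [d' d0' hd']; exists (Num.min d d'); first by rewrite lt_min d0.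
  move=> y z h1 h2 h3 h4 h5 h6.
  have m1 : Num.min d d' <= d by rewrite ge_min lexx.
  have m2 : Num.min d d' <= d' by rewrite ge_min lexx orbT.
  rewrite (@circulation_cat_ver y z a b c) // => [|t tac].
    by rewrite hd ?hd' //; lra.
  have tyy : y1 <= t <= y2 by exact: sub tac.
  by split; apply: r; rewrite // ?h1 ?h4 ?andbT //=; [exact: le_trans h2 (le_trans h3 h4)|exact: le_trans h1 (le_trans h2 h3)].
move=> y yy; have [cu cv r0] := r x y xx yy.
have cM : {for (x, y), continuous (fun p => modulus (u p.1 p.2) (v p.1 p.2))}.
  apply: (@continuous_comp _ _ _ (fun p => u p.1 p.2 ^+ 2 + v p.1 p.2 ^+ 2) Num.sqrt); last exact: sqrt_continuous.
  by apply: cvgD; apply: cvgM.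
have close a b d t (c : R) : c - d < a -> b < c + d -> a <= t <= b -> `|t - c| < d.
  by move=> h1 h2 /andP[h3 h4]; rewrite ltr_norml; apply/andP; split; lra.
case: (modulus_dichotomy r0) => mx.
  have [d d0 hd] := positive_near2 (g := fun p => modulus (u p.1 p.2) (v p.1 p.2) + u p.1 p.2) (cvgD cM cu) mx.
  exists d => // c1 c2 yc1 c1y yc2 c2y dc1 dc2; exists d => // a1 a2 xa1 a1x xa2 a2x da1 da2.
  apply: circulation_local; [exact: le_trans xa2|exact: le_trans yc2| |left] => s t hs ht.
    by apply: r; [exact: sub hs|exact: sub ht].
  by apply: hd; [exact: close hs|exact: close ht].
have [d d0 hd] := positive_near2 (g := fun p => modulus (u p.1 p.2) (v p.1 p.2) - u p.1 p.2) (cvgB cM cu) mx.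
exists d => // c1 c2 yc1 c1y yc2 c2y dc1 dc2; exists d => // a1 a2 xa1 a1x xa2 a2x da1 da2.
apply: circulation_local; [exact: le_trans xa2|exact: le_trans yc2| |right] => s t hs ht.
  by apply: r; [exact: sub hs|exact: sub ht].
by apply: hd; [exact: close hs|exact: close ht].
Qed.

(** The outer rectangle is cut into the inner one and four others that do not contain the
    exceptional point. *)
Lemma circulation_annulus x0 x1 x2 x3 y0 y1 y2 y3 (cx cy : R) :
  x0 <= x1 -> x1 < cx -> cx < x2 -> x2 <= x3 -> y0 <= y1 -> y1 < cy -> cy < y2 -> y2 <= y3 ->
  (forall x y, x0 <= x <= x3 -> y0 <= y <= y3 -> (x, y) != (cx, cy) -> regular x y) ->
  circulation x0 x3 y0 y3 = circulation x1 x2 y1 y2.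
Proof.
move=> h1 h2 h3 h4 h5 h6 h7 h8 r.
have sub (a b c d t : R) : a <= c -> d <= b -> c <= t <= d -> a <= t <= b.
  by move=> ac db /andP[ct td]; rewrite (le_trans ac) ?(le_trans td).
have x12 : x1 <= x2 by rewrite ltW // (lt_trans h2).
have y12 : y1 <= y2 by rewrite ltW // (lt_trans h6).
have x13 := le_trans x12 h4; have y13 := le_trans y12 h8.
have x02 := le_trans h1 x12; have y02 := le_trans h5 y12.
have x03 := le_trans h1 x13; have y03 := le_trans h5 y13.
have RL x y : x0 <= x <= x1 -> y0 <= y <= y3 -> regular x y.
  move=> xx yy; apply: r => //; first exact: sub xx.
  by case/andP: xx => _ xx; rewrite xpair_eqE lt_eqF // (le_lt_trans xx).
have RR x y : x2 <= x <= x3 -> y0 <= y <= y3 -> regular x y.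
  move=> xx yy; apply: r => //; first exact: sub xx.
  by case/andP: xx => xx _; rewrite xpair_eqE gt_eqF // (lt_le_trans h3).
have RB x y : x0 <= x <= x3 -> y0 <= y <= y1 -> regular x y.
  move=> xx yy; apply: r => //; first exact: sub yy.
  by case/andP: yy => _ yy; rewrite xpair_eqE (lt_eqF (le_lt_trans yy h6)) andbF.
have RT x y : x0 <= x <= x3 -> y2 <= y <= y3 -> regular x y.
  move=> xx yy; apply: r => //; first exact: sub yy.
  by case/andP: yy => yy _; rewrite xpair_eqE (gt_eqF (lt_le_trans h7 yy)) andbF.
have X1 : x0 <= x1 <= x1 by rewrite h1 lexx.
have X2 : x2 <= x2 <= x3 by rewrite h4 lexx.
have Y0 : y0 <= y0 <= y1 by rewrite h5 lexx.
have Y3 : y2 <= y3 <= y3 by rewrite h8 lexx.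
have X10 : x0 <= x1 <= x3 by rewrite h1.
have X20 : x0 <= x2 <= x3 by rewrite h4 andbT.
rewrite (@circulation_cat_hor x0 x1 x3 y0 y3) //; last by move=> x hx; split; [apply: RB|apply: RT].
have hB x : x1 <= x <= x3 -> regular x y0 /\ regular x y3.
  by move=> hx; have hx' : x0 <= x <= x3 by [exact: sub hx]; split; [apply: RB|apply: RT].
rewrite (@circulation_cat_hor x1 x2 x3 y0 y3) //.
have hL y : y0 <= y <= y3 -> regular x1 y /\ regular x2 y by move=> hy; split; [apply: RL|apply: RR].
have hL1 y : y1 <= y <= y3 -> regular x1 y /\ regular x2 y by move=> /(sub y0 y3 _ _ _ h5 (lexx _))/hL.
rewrite (@circulation_cat_ver x1 x2 y0 y1 y3) // (@circulation_cat_ver x1 x2 y1 y2 y3) //.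
rewrite (@circulation_eq0 x0 x1 y0 y3) // (@circulation_eq0 x2 x3 y0 y3) //.
have sx x : x1 <= x <= x2 -> x0 <= x <= x3 by exact: sub.
rewrite (@circulation_eq0 x1 x2 y0 y1) //; last by move=> x y /sx; exact: RB.
rewrite (@circulation_eq0 x1 x2 y2 y3) //; last by move=> x y /sx; exact: RT.
by rewrite !add0r !addr0.
Qed.

(* The four sides of a rectangle whose image stays, side by side, in the right,
   upper, left and lower half-planes: only the right side crosses the branch cut. *)
Lemma circulation_quadrants x1 x2 y1 y2 : x1 <= x2 -> y1 <= y2 ->
  (forall x, x1 <= x <= x2 -> regular x y1 /\ v x y1 < 0) ->
  (forall x, x1 <= x <= x2 -> regular x y2 /\ 0 < v x y2) ->
  (forall y, y1 <= y <= y2 -> regular x1 y /\ u x1 y < 0) ->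
  (forall y, y1 <= y <= y2 -> regular x2 y /\ 0 < u x2 y) ->
  circulation x1 x2 y1 y2 = 1.
Proof.
move=> hx hy rb rt rl rr.
have X2 : x1 <= x2 <= x2 by rewrite lexx hx.
have mpos (a b : R) : 0 < b ^+ 2 -> 0 < modulus a b - a.
  move=> b0; rewrite subr_gt0; have [a0|a0] := ltP a 0; first by rewrite (lt_le_trans a0) ?sqrtr_ge0.
  rewrite -[X in X < _]ger0_norm // -sqrtr_sqr ltr_sqrt ?ltrDl //.
  by rewrite ltr_wpDl ?sqr_ge0.
have lt0_mod (a b : R) : a < 0 -> 0 < modulus a b - a.
  by move=> a0; rewrite subr_gt0 (lt_le_trans a0) ?sqrtr_ge0.
have gt0_mod (a b : R) : 0 < a -> 0 < modulus a b + a.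
  by move=> a0; rewrite ltr_wpDl // sqrtr_ge0.
have wb : winding (u^~ y1) (v^~ y1) x1 x2 = 0.
  apply: turn_winding => // [x /rb[[]]//|].
  apply: turn_slit_on => // x /rb[rx vx]; first exact: regular_hor.
  by apply: mpos; rewrite exprn_even_gt0 //= lt_eqF.
have wt : winding (u^~ y2) (v^~ y2) x1 x2 = 0.
  apply: turn_winding => // [x /rt[[]]//|].
  apply: turn_slit_on => // x /rt[rx vx]; first exact: regular_hor.
  by apply: mpos; rewrite exprn_gt0.
have wl : winding (u x1) (v x1) y1 y2 = 0.
  apply: turn_winding => // [y /rl[[]]//|].
  by apply: turn_slit_on => // y /rl[rx ux]; [exact: regular_ver|exact: lt0_mod].
have wr : winding (u x2) (v x2) y1 y2 = below (v x2 y2) - below (v x2 y1).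
  apply: turn_winding => // [y /rr[[]]//|].
  by apply: turn_right_on => // y /rr[rx ux]; [exact: regular_ver|exact: gt0_mod].
rewrite /circulation wb wt wl wr /below.
have [_ ->] := rb x2 X2; have [_ v2] := rt x2 X2.
by rewrite ltNge (ltW v2).
Qed.
End Rectangle.

(** * Coordinates on the complex plane, the domain and lattice segments *)

Section ComplexTopology.
Variable R : realType.
Local Notation Re := (@complex.Re R).
Local Notation Im := (@complex.Im R).

Lemma ler_Re_norm (z : Cx R) : `|Re z|%:C%C <= `|z|. Proof. exact: normc_ge_Re. Qed.

Lemma ler_Im_norm (z : Cx R) : `|Im z|%:C%C <= `|z|.
Proof. by case: z => a b; rewrite normc_def lecR /= -sqrtr_sqr ler_wsqrtr // lerDr sqr_ge0. Qed.

Lemma ler_norm_Complex (s t : R) : `|Complex s t : Cx R| <= (`|s| + `|t|)%:C%C.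
Proof.
have -> : (Complex s t : Cx R) = s%:C%C + 'i%C * t%:C%C by exact: (complexE (Complex s t)).
have n (r : R) : `|r%:C%C : R[i]| = `|r|%:C%C by rewrite normc_def /= expr0n /= addr0 sqrtr_sqr.
apply: le_trans (ler_normD _ _) _; rewrite normrM n.
have -> : `|'i%C : R[i]| = 1 by rewrite normc_def /= expr0n expr1n /= add0r sqrtr1.
by rewrite mul1r n -rmorphD.
Qed.

Lemma nbhs_Complex (x y : R) (P : set (Cx R)) : nbhs (Complex x y : Cx R) P <->
  exists2 d : R, 0 < d & forall s t, `|s - x| < d -> `|t - y| < d -> P (Complex s t).
Proof.
split.
  case/nbhs_ballP => -[e e'] /=; rewrite ltcE /= => /andP[/eqP -> e0] h.
  exists (e / 2) => [|s t sx ty]; first by rewrite divr_gt0.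
  apply: h; rewrite /ball /= -normrN opprB.
  by rewrite (le_lt_trans (ler_norm_Complex _ _)) // ltcR [ltRHS](splitr e) ltrD.
case=> d d0 h; apply/nbhs_ballP; exists d%:C%C => [|[s t]] /=; first by rewrite ltcR.
rewrite /ball /= => hst; apply: h; rewrite -ltcR (le_lt_trans _ hst) // -normrN opprB.
  exact: (ler_Re_norm (Complex s t - Complex x y)).
exact: (ler_Im_norm (Complex s t - Complex x y)).
Qed.

Lemma continuous_Re (z : Cx R) : {for z, continuous (Re : Cx R -> R)}.
Proof.
case: z => x y P /nbhs_ballP[e /= e0 h]; apply/nbhs_Complex; exists e => // s t sx _; apply: h.
by rewrite /ball /= distrC.
Qed.

Lemma continuous_Im (z : Cx R) : {for z, continuous (Im : Cx R -> R)}.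
Proof.
case: z => x y P /nbhs_ballP[e /= e0 h]; apply/nbhs_Complex; exists e => // s t _ ty; apply: h.
by rewrite /ball /= distrC.
Qed.

Lemma continuous_Complex (T : topologicalType) (F : set_system T) (p q : T -> R) (x y : R) : Filter F ->
  p @ F --> x -> q @ F --> y -> (fun t => Complex (p t) (q t) : Cx R) @ F --> (Complex x y : Cx R).
Proof.
move=> FF px qy P /nbhs_Complex[d d0 h].
move/cvgrPdist_lt: px => /(_ d d0) px; move/cvgrPdist_lt: qy => /(_ d d0) qy.
rewrite /= nbhs_filterE; apply: filterS2 px qy => t pt qt.
by apply: h; rewrite distrC.
Qed.

Lemma DAE (A : {fset Z2}) (x y : R) : DA A (Complex x y : Cx R) <->
  exists2 d : R, 0 < d & forall s t, `|s - x| < d -> `|t - y| < d ->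
    exists2 v : Z2, v \in A & `|s - v.1%:~R| <= 2^-1 /\ `|t - v.2%:~R| <= 2^-1.
Proof.
rewrite /DA; split => [/nbhs_Complex|] [d d0 h].
  exists d => // s t sx ty; have [v vA [[p q] [/= hp hq]] e] := h s t sx ty.
  by exists v => //; case: e => <- <-; rewrite !(addrC _%:~R) !addrK.
apply/nbhs_Complex; exists d => // s t sx ty; have [v vA [hs ht]] := h s t sx ty.
exists v => //; exists (Complex (s - v.1%:~R) (t - v.2%:~R)) => //.
by apply/eqP; rewrite eq_complex /= addrC subrK eqxx addrC subrK eqxx.
Qed.

Lemma DA_box (A : {fset Z2}) (X0 X1 Y0 Y1 : int) (x y : R) :
  (forall v : Z2, X0 <= v.1 <= X1 -> Y0 <= v.2 <= Y1 -> v \in A) ->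
  X0%:~R - 2^-1 < x < X1%:~R + 2^-1 -> Y0%:~R - 2^-1 < y < Y1%:~R + 2^-1 ->
  DA A (Complex x y : Cx R).
Proof.
move=> hA hx hy; apply/DAE.
have slack (a b c : R) : a < c < b -> exists2 d, 0 < d & forall s, `|s - c| < d -> a < s < b.
  case/andP=> ac cb; exists (Num.min (c - a) (b - c)); first by rewrite lt_min !subr_gt0 ac cb.
  by move=> s; rewrite lt_min !ltr_norml => /andP[/andP[h1 _] /andP[_ h2]]; apply/andP; split; lra.
have cell (a b : int) (s : R) : a%:~R - 2^-1 < s < b%:~R + 2^-1 ->
    exists2 n : int, a <= n <= b & `|s - n%:~R| <= 2^-1.
  move=> /andP[h1 h2]; have := floor_le (s + 2^-1); have := floorD1_gt (s + 2^-1).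
  rewrite intrD => h3 h4; exists (Num.floor (s + 2^-1)); last by rewrite ler_norml; apply/andP; split; lra.
  apply/andP; split.
    by rewrite -ltzD1 -(ltr_int R) intrD; lra.
  by rewrite -ltzD1 -(ltr_int R) intrD; lra.
have [d1 d10 h1] := slack _ _ _ hx; have [d2 d20 h2] := slack _ _ _ hy.
exists (Num.min d1 d2) => [|s t]; first by rewrite lt_min d10.
rewrite !lt_min => /andP[sx _] /andP[_ ty].
have [n hn sn] := cell _ _ _ (h1 s sx); have [m hm tm] := cell _ _ _ (h2 t ty).
by exists (n, m) => //; apply: hA.
Qed.

(** $w_0$ is the common corner of four unit cells. A small displacement in each diagonal direction
    stays in the union of the cells of [A] and falls into just one of the four. *)
Lemma DA_w0_corners (A : {fset Z2}) : DA A (w0 R) -> all (fun v => v \in A) (pcorners (0, -1)).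
Proof.
case/DAE=> d d0 h; pose e := Num.min (d / 2) 2^-1.
have e0 : 0 < e by rewrite lt_min divr_gt0 //=.
have ed : e < d by rewrite (@le_lt_trans _ _ (d / 2)) ?ge_min ?lexx //; lra.
have e1 : e <= 2^-1 by rewrite ge_min lexx orbT.
have near (c : R) (k : bool) : `|c + (-1) ^+ k * e - c| < d.
  by rewrite addrAC subrr add0r normrM normr_sign mul1r gtr0_norm.
have pick (n : int) (k : bool) : `|2^-1 + (-1) ^+ k * e - n%:~R| <= 2^-1 -> n = 1 - k%:Z.
  rewrite ler_norml => /andP[h1 h2].
  have : (1 - k%:Z - 1)%:~R < n%:~R :> R /\ n%:~R < (1 - k%:Z + 1)%:~R :> R.
    by case: k h1 h2 => /=; rewrite ?expr1 ?expr0 => h1 h2; split; lra.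
  by rewrite !ltr_int => -[]; lia.
have pick' (n : int) (k : bool) : `|- 2^-1 + (-1) ^+ k * e - n%:~R| <= 2^-1 -> n = - k%:Z.
  move=> hn; suff : n + 1 = 1 - k%:Z by lia.
  apply: pick; rewrite intrD; apply: le_trans hn; rewrite le_eqVlt; apply/orP; left; apply/eqP.
  by congr `|_|; field.
have corner (k k' : bool) : (1 - k%:Z, - k'%:Z) \in A.
  have [[n m] vA [/= /pick hn /pick' hm]] := h _ _ (near _ k) (near _ k').
  by rewrite -hn -hm.
apply/allP => v; rewrite !inE => /or4P[] /eqP ->; [exact: (corner true true)|exact: (corner false true)|
  exact: (corner true false)|exact: (corner false false)].
Qed.
End ComplexTopology.

Section LatticeSegments.
Variable R : realType.

Definition seg (y z : Z2) (t : R) : Cx R :=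
  Complex ((1 - t) * y.1%:~R + t * z.1%:~R) ((1 - t) * y.2%:~R + t * z.2%:~R).

Lemma seg_continuous y z : continuous (seg y z).
Proof.
move=> t; apply: continuous_Complex; apply: cvgD; apply: cvgM; do ?exact: cvg_cst; do ?exact: cvg_id;
  by apply: cvgB; [exact: cvg_cst|exact: cvg_id].
Qed.

Lemma segC y z t : seg y z t = seg z y (1 - t).
Proof. by rewrite /seg subKr; congr Complex; rewrite addrC. Qed.

Lemma seg_interp (s : nat -> Z2) (n : nat) (t : R) : n%:R <= t <= n.+1%:R ->
  interp s t = seg (s n) (s n.+1) (t - n%:R).
Proof.
(* At [t = n.+1] the truncation jumps to the next segment, which starts at the point where this one
   ends. *)
case/andP=> nt; rewrite le_eqVlt => /orP[/eqP ->|tn].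
  rewrite /interp natrK subrr subr0 rmorph0 rmorph1 mul1r mul0r addr0.
  by rewrite /seg (_ : n.+1%:R - n%:R = 1) ?subrr ?mul0r ?mul1r ?add0r // -natrB // subSnn.
have -> : interp s t = ((1 - (t - n%:R))%:C)%C * emb R (s n) + ((t - n%:R)%:C)%C * emb R (s n.+1).
  by rewrite /interp (truncn_def (n := n)) // nt tn.
by apply/eqP; rewrite eq_complex /= !mul0r !subr0 !addr0 !eqxx.
Qed.
End LatticeSegments.

(** * The conformal map near its zero and on unit squares *)

Section Conformal.
Variables (R : realType) (A : {fset Z2}) (f : Cx R -> Cx R).
Hypothesis hf : is_conformal A f.
Hypothesis hw0 : DA A (w0 R).
Local Notation Re := (@complex.Re R).
Local Notation Im := (@complex.Im R).
Let U (x y : R) : R := Re (f (Complex x y)).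
Let V (x y : R) : R := Im (f (Complex x y)).

Lemma conformal_continuous z : DA A z -> {for z, continuous f}.
Proof.
by have [_ df _ _ _] := hf; move=> /df /derivable1_diffP /differentiable_continuous.
Qed.

Lemma conformal_inj : {in DA A &, injective f}.
Proof. by have [[]] := hf. Qed.

Lemma Complex_neq0 (z : Cx R) : z != 0 -> 0 < Re z ^+ 2 + Im z ^+ 2.
Proof.
case: z => x y; rewrite eq_complex /= => xy.
by rewrite lt_neqAle addr_ge0 ?sqr_ge0 // andbT eq_sym paddr_eq0 ?sqr_ge0 // !sqrf_eq0.
Qed.

Lemma continuous_ReIm (x y : R) : DA A (Complex x y) ->
  {for (x, y), continuous (fun p => U p.1 p.2)} /\ {for (x, y), continuous (fun p => V p.1 p.2)}.
Proof.
move=> D; have c : {for (x, y), continuous (fun p : R * R => f (Complex p.1 p.2))}.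
  apply: (@continuous_comp _ _ _ (fun p : R * R => Complex p.1 p.2 : Cx R) f); last exact: conformal_continuous.
  by apply: continuous_Complex; [exact: cvg_fst|exact: cvg_snd].
split; [apply: (continuous_comp c); exact: continuous_Re|apply: (continuous_comp c); exact: continuous_Im].
Qed.

Lemma conformal_neq0 z : DA A z -> z != w0 R -> f z != 0.
Proof.
have [_ _ f0 _ _] := hf => Dz; apply: contraNneq => fz.
by apply/eqP; apply: conformal_inj; rewrite ?inE // fz f0.
Qed.

Lemma conformal_regular (x y : R) : DA A (Complex x y) -> (x, y) != (2^-1, - 2^-1) -> regular U V x y.
Proof.
move=> D xy; have [cu cv] := continuous_ReIm D; split => //.
apply: Complex_neq0; apply: conformal_neq0 => //.
by apply: contra xy; rewrite eq_complex xpair_eqE.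
Qed.

Lemma conformal_linear : exists2 c : R, 0 < c & exists2 d : R, 0 < d &
  forall e x y : R, 0 < e -> e < d -> `|x| <= e -> `|y| <= e ->
    [/\ DA A (Complex (2^-1 + x) (- 2^-1 + y)), `|U (2^-1 + x) (- 2^-1 + y) - c * x| <= c * e / 2
      & `|V (2^-1 + x) (- 2^-1 + y) - c * y| <= c * e / 2].
Proof.
have [_ df f0 f'0 _] := hf.
have [c c0 ec] : exists2 c : R, 0 < c & derive1 f (w0 R) = c%:C%C.
  by case: (derive1 f (w0 R)) f'0 => c c'; rewrite ltcE /= => /andP[/eqP -> c0]; exists c.
exists c => //; have := df _ hw0; rewrite /derivable -/(derive _ _ _).
move=> /cvg_ex[l hl]; have el : l = c%:C%C by rewrite -ec derive1E /derive; apply/esym/cvg_lim.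
(* On the square of half-side [e] the modulus is at most [2 * e], so the precision [c / 4] gives an
   error of at most [c * e / 2]. The linear part sends each side to distance [c * e] from an axis,
   and half of this remains. *)
have e0 : 0 < (c / 4)%:C%C :> R[i] by rewrite ltcR divr_gt0.
move: hl => /cvgrPdist_lt /(_ _ e0); rewrite near_withinE => /nbhs_Complex[d1 d10 h1].
have /nbhs_Complex[d2 d20 h2] : nbhs (w0 R) (DA A) by apply: open_nbhs_nbhs; split=> //; exact: open_interior.
exists (Num.min d1 d2) => [|e x y eg0]; first by rewrite lt_min d10.
rewrite lt_min => /andP[ed1 ed2] xe ye.
have [e2 e3] := (le_lt_trans xe ed1, le_lt_trans ye ed1).
have hh : `|f (Complex (2^-1 + x) (- 2^-1 + y)) - c%:C%C * (Complex x y : R[i])| <= (c * e / 2)%:C%C.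
  have [h0|h0] := eqVneq (Complex x y : Cx R) 0.
    by case: h0 => -> ->; rewrite !addr0 f0 sub0r mulr0 oppr0 normr0 lecR divr_ge0 ?mulr_ge0 ?ltW.
  have ew : (Complex x y : Cx R) *: (1 : Cx R) + w0 R = Complex (2^-1 + x) (- 2^-1 + y).
    by rewrite /GRing.scale /= mulr1; apply/eqP; rewrite eq_complex /= ![_ + 2^-1]addrC ![_ - 2^-1]addrC !eqxx.
  have := h1 x y; rewrite !subr0 e2 e3 => /(_ isT isT h0); rewrite /= ew f0 subr0 el => hl'.
  have nz : `|Complex x y : Cx R| <= (e + e)%:C%C.
    by rewrite (le_trans (ler_norm_Complex _ _)) // lecR lerD.
  rewrite (_ : _ - _ = - (Complex x y : R[i]) * (c%:C%C - (Complex x y : R[i])^-1 * f (Complex (2^-1 + x) (- 2^-1 + y)))).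
    rewrite normrM normrN; apply: le_trans (ler_pM _ _ nz (ltW hl')) _ => //.
    by rewrite -rmorphM lecR; lra.
  by rewrite mulrBr mulrA !mulNr divff // mul1r opprK mulrC addrC.
split.
- by apply: h2; rewrite addrAC subrr add0r ?(le_lt_trans xe) ?(le_lt_trans ye).
- rewrite -lecR (le_trans _ hh) //; apply: le_trans (ler_Re_norm _).
  by rewrite /U; case: (f _) => p q; rewrite lecR /= mul0r subr0.
- rewrite -lecR (le_trans _ hh) //; apply: le_trans (ler_Im_norm _).
  by rewrite /V; case: (f _) => p q; rewrite lecR /= mul0r addr0.
Qed.
End Conformal.

Lemma sqr_box (R : realType) (c e : R) : 0 < e ->
  [/\ c - e <= c + e, c - e <= c - e <= c + e & c - e <= c + e <= c + e].
Proof. by move=> e0; rewrite !lexx andbT; split; lra. Qed.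

Lemma box_sides (R : realType) (m a b t : R) : `|a - t| <= m -> `|b| < m ->
  (t = m + m -> 0 < a - b) /\ (t = - (m + m) -> a - b < 0).
Proof.
rewrite ler_norml ltr_norml => /andP[h1 h2] /andP[h3 h4].
by split=> e; move: h1 h2; rewrite e; lra.
Qed.

Lemma half_int (R : realType) (n : int) : n%:~R <= 2^-1 :> R -> 2^-1 <= n%:~R + 1 :> R -> n = 0.
Proof.
move=> h1 h2; have n1 : n < 1 by rewrite -(ltr_int R); lra.
have n0 : -1 < n by rewrite -(ltr_int R) mulrNz; lra.
lia.
Qed.

Section ConformalSigns.
Variables (R : realType) (A : {fset Z2}) (f : Cx R -> Cx R).
Hypothesis hf : is_conformal A f.
Hypothesis hw0 : DA A (w0 R).
Local Notation Re := (@complex.Re R).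
Local Notation Im := (@complex.Im R).
Let U (x y : R) : R := Re (f (Complex x y)).
Let V (x y : R) : R := Im (f (Complex x y)).

(** The map is shifted by every small [p] and [q], not only by 0: a nonzero circulation around a
    nearby value is what forces that value to be taken. *)
Lemma conformal_circulation : exists2 d : R, 0 < d & forall e : R, 0 < e -> e < d ->
  (forall x y : R, `|x| <= e -> `|y| <= e -> DA A (Complex (2^-1 + x) (- 2^-1 + y))) /\
  exists2 r : R, 0 < r & forall p q : R, `|p| < r -> `|q| < r ->
    circulation (fun x y => U x y - p) (fun x y => V x y - q) (2^-1 - e) (2^-1 + e) (- 2^-1 - e) (- 2^-1 + e) = 1.
Proof.
have [c c0 [d d0 lin]] := conformal_linear hf hw0; exists d; first exact: d0.
move=> e e0 ed; split=> [x y xe ye|]; first by have [] := lin e x y e0 ed xe ye.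
have ce : 0 < c * e / 2 by rewrite divr_gt0 ?mulr_gt0.
exists (c * e / 2) => // p q hp hq.
have main (x y : R) : 2^-1 - e <= x <= 2^-1 + e -> - 2^-1 - e <= y <= - 2^-1 + e ->
    [/\ {for (x, y), continuous (fun z => U z.1 z.2 - p)}, {for (x, y), continuous (fun z => V z.1 z.2 - q)},
      `|U x y - c * (x - 2^-1)| <= c * e / 2 & `|V x y - c * (y - - 2^-1)| <= c * e / 2].
  rewrite -!ler_distl => hx hy; have [D h1 h2] := lin e _ _ e0 ed hx hy.
  have ex : 2^-1 + (x - 2^-1) = x by rewrite addrC subrK.
  have ey : - 2^-1 + (y - - 2^-1) = y by rewrite addrC subrK.
  rewrite ex ey in D h1 h2; have [cu cv] := continuous_ReIm hf D.
  by split => //; apply: cvgB => //; exact: cvg_cst.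
have reg (x y : R) : 2^-1 - e <= x <= 2^-1 + e -> - 2^-1 - e <= y <= - 2^-1 + e -> U x y - p != 0 \/ V x y - q != 0 ->
    regular (fun x y => U x y - p) (fun x y => V x y - q) x y.
  move=> hx hy nz; have [cu cv _ _] := main x y hx hy; split=> //=.
  rewrite lt_neqAle addr_ge0 ?sqr_ge0 // andbT eq_sym paddr_eq0 ?sqr_ge0 // !sqrf_eq0.
  by case: nz => /negPf ->; rewrite ?andbF.
have [hx0 EX EX'] := sqr_box 2^-1 e0; have [hy0 EY EY'] := sqr_box (- 2^-1) e0.
have e2 (t : R) : c * (t + e - t) = c * e / 2 + c * e / 2 by rewrite addrC addKr -splitr.
have e2' (t : R) : c * (t - e - t) = - (c * e / 2 + c * e / 2).
  by rewrite addrC addKr -splitr mulrN.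
apply: circulation_quadrants => // t ht.
- have h : V t (- 2^-1 - e) - q < 0 by have [_ _ _ /box_sides/(_ hq)[_]] := main _ _ ht EY; apply.
  by split=> //; apply: reg => //; right; rewrite lt_eqF.
- have h : 0 < V t (- 2^-1 + e) - q by have [_ _ _ /box_sides/(_ hq)[+ _]] := main _ _ ht EY'; apply.
  by split=> //; apply: reg => //; right; rewrite gt_eqF.
- have h : U (2^-1 - e) t - p < 0 by have [_ _ /box_sides/(_ hp)[_ +] _] := main _ _ EX ht; apply.
  by split=> //; apply: reg => //; left; rewrite lt_eqF.
- have h : 0 < U (2^-1 + e) t - p by have [_ _ /box_sides/(_ hp)[+ _] _] := main _ _ EX' ht; apply.
  by split=> //; apply: reg => //; left; rewrite gt_eqF.
Qed.

(** The open mapping property at $w_0$ by a degree argument: an omitted value would make the shifted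
    map free of zeros, with circulation 0 instead of 1. *)
Lemma conformal_onto : exists2 d : R, 0 < d & forall e : R, 0 < e -> e < d -> exists2 r : R, 0 < r &
  forall p q : R, `|p| < r -> `|q| < r -> exists x y : R, [/\ `|x| <= e, `|y| <= e,
    DA A (Complex (2^-1 + x) (- 2^-1 + y)) & f (Complex (2^-1 + x) (- 2^-1 + y)) = Complex p q].
Proof.
have [d d0 h] := conformal_circulation; exists d => // e e0 ed.
have [D [r r0 circ]] := h e e0 ed; exists r => // p q hp hq.
have [hx0 _ _] := sqr_box 2^-1 e0; have [hy0 _ _] := sqr_box (- 2^-1) e0.
apply: contrapT => no; have := circ p q hp hq; rewrite circulation_eq0 //.
move=> x y; rewrite -!ler_distl => hx hy.
have ex : 2^-1 + (x - 2^-1) = x by rewrite addrC subrK.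
have ey : - 2^-1 + (y - - 2^-1) = y by rewrite addrC subrK.
have Dxy := D _ _ hx hy; rewrite ex ey in Dxy.
have [cu cv] := continuous_ReIm hf Dxy.
split; [by apply: cvgB => //; exact: cvg_cst|by apply: cvgB => //; exact: cvg_cst|].
rewrite lt_neqAle addr_ge0 ?sqr_ge0 // andbT eq_sym paddr_eq0 ?sqr_ge0 // !sqrf_eq0 !subr_eq0.
apply/negP => /andP[/eqP eu /eqP ev]; apply: no; exists (x - 2^-1), (y - - 2^-1).
by rewrite ex ey; split=> //; apply/eqP; rewrite eq_complex /= -eu -ev !eqxx.
Qed.

(** By injectivity $w_0$ is the only zero of [f]. The unit square around it is shrunk to a small
    square by [circulation_annulus]; the bound $e\le\frac14$ keeps the small one inside. *)
Lemma plaquette_circulation (p : Z2) : all (fun v => v \in A) (pcorners p) ->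
  circulation U V p.1%:~R (p.1 + 1)%:~R p.2%:~R (p.2 + 1)%:~R = (p == (0, -1)) :> int.
Proof.
move=> /allP pA; rewrite !intrD.
have box v : p.1 <= v.1 <= p.1 + 1 -> p.2 <= v.2 <= p.2 + 1 -> v \in A.
  move=> h1 h2; apply: pA; case: v h1 h2 => v1 v2 /= h1 h2; rewrite !inE !xpair_eqE /=; lia.
have D (x y : R) : p.1%:~R <= x <= p.1%:~R + 1 -> p.2%:~R <= y <= p.2%:~R + 1 -> DA A (Complex x y).
  move=> /andP[h1 h2] /andP[h3 h4]; apply: (DA_box box); rewrite intrD; apply/andP; split; lra.
have [p0|p0] := eqVneq p (0, -1); last first.
  apply: circulation_eq0; [lra|lra|move=> x y hx hy].
  apply: conformal_regular (D x y hx hy) _ => //; apply/negP; rewrite xpair_eqE => /andP[/eqP ex /eqP ey].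
  case/andP: hx; case/andP: hy; rewrite ex ey => y1 y2 x1 x2.
  case/negP: p0; rewrite [p]surjective_pairing xpair_eqE (half_int x1 x2) eqxx /=.
  rewrite -subr_eq0 opprK (@half_int R (p.2 + 1)) ?eqxx // intrD; lra.
have [d d0 h] := conformal_circulation.
pose e := Num.min (d / 2) 4^-1; have e0 : 0 < e by rewrite lt_min divr_gt0 //=.
have ed : e < d by rewrite (@le_lt_trans _ _ (d / 2)) ?ge_min ?lexx //; lra.
have e1 : e <= 4^-1 by rewrite ge_min lexx orbT.
have [_ [r r0 circ]] := h e e0 ed.
have := circ 0 0; rewrite normr0 => /(_ r0 r0).
have -> : (fun x y => U x y - 0) = U by apply/funext => x; apply/funext => y; rewrite subr0.
have -> : (fun x y => V x y - 0) = V by apply/funext => x; apply/funext => y; rewrite subr0.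
move=> one; rewrite p0 /= mulrNz; apply: etrans one.
apply: (circulation_annulus (cx := 2^-1) (cy := - 2^-1)); do ?(clearbody e; clear circ h D p0; lra).
move=> x y hx hy xy; apply: (conformal_regular hf hw0 _ xy).
by apply: D; rewrite p0 //= mulrNz.
Qed.
End ConformalSigns.

Lemma odd_abszD (m n : int) : odd `|m + n| = odd `|m| (+) odd `|n|.
Proof.
have e k : odd `|k| = (k %% 2 != 0)%Z by lia.
by rewrite !e; lia.
Qed.

(** * Signs of lattice edges inside the domain *)

Section EdgeSigns.
Variables (R : realType) (A : {fset Z2}) (f : Cx R -> Cx R).
Hypothesis hf : is_conformal A f.
Hypothesis hw0 : DA A (w0 R).
Local Notation Re := (@complex.Re R).
Local Notation Im := (@complex.Im R).
Let U (x y : R) : R := Re (f (Complex x y)).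
Let V (x y : R) : R := Im (f (Complex x y)).

Definition turn_along (g : R -> Cx R) (a b : R) (k : int) : Prop :=
  turn (fun t => Re (f (g t))) (fun t => Im (f (g t))) a b k.

(** Every point of a lattice edge has an integer coordinate, and $w_0$ has none. *)
Lemma seg_neq_w0 (y z : Z2) (t : R) : adj y z -> seg y z t != w0 R.
Proof.
move=> yz; apply/negP; rewrite eq_complex /=; move: y z yz; apply: adj_cases => i j /=;
  rewrite -!mulrDl subrK !mul1r => /andP[/eqP e1 /eqP e2].
- move: e2 => /(congr1 (fun r => r + 1)) e2; have := @half_int R (j + 1).
  rewrite intrD e2; rewrite (_ : - 2^-1 + 1 = 2^-1 :> R); last lra.
  move=> /(_ (lexx _)) j0; have {}j0 : j + 1 = 0 by apply: j0; lra.
  have : (j + 1)%:~R = 0 :> R by rewrite j0.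
  rewrite intrD e2; lra.
- move: e2 => /(congr1 (fun r => r + 1)) e2; have := @half_int R (j + 1).
  rewrite intrD e2; rewrite (_ : - 2^-1 + 1 = 2^-1 :> R); last lra.
  move=> /(_ (lexx _)) j0; have {}j0 : j + 1 = 0 by apply: j0; lra.
  have : (j + 1)%:~R = 0 :> R by rewrite j0.
  rewrite intrD e2; lra.
- have := @half_int R i; rewrite e1 => /(_ (lexx _)) i0; have {}i0 : i = 0 by apply: i0; lra.
  move: e1; rewrite i0; lra.
- have := @half_int R i; rewrite e1 => /(_ (lexx _)) i0; have {}i0 : i = 0 by apply: i0; lra.
  move: e1; rewrite i0; lra.
Qed.

Lemma DA_seg (y z : Z2) (t : R) : y \in A -> z \in A -> adj y z -> 0 <= t <= 1 -> DA A (seg y z t).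
Proof.
move=> yA zA yz /andP[t0 t1]; move: y z yz yA zA; apply: adj_cases => i j yA zA.
- apply: (@DA_box R A i (i + 1) j j);
    [move=> [v1 v2] /= h1 h2|by rewrite /= ?intrD; apply/andP; split; nra|by rewrite /= ?intrD; apply/andP; split; nra].
  have -> : v2 = j by lia.
  by have [->|->] : v1 = i \/ v1 = i + 1 by lia.
- apply: (@DA_box R A i (i + 1) j j);
    [move=> [v1 v2] /= h1 h2|by rewrite /= ?intrD; apply/andP; split; nra|by rewrite /= ?intrD; apply/andP; split; nra].
  have -> : v2 = j by lia.
  by have [->|->] : v1 = i \/ v1 = i + 1 by lia.
- apply: (@DA_box R A i i j (j + 1));
    [move=> [v1 v2] /= h1 h2|by rewrite /= ?intrD; apply/andP; split; nra|by rewrite /= ?intrD; apply/andP; split; nra].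
  have -> : v1 = i by lia.
  by have [->|->] : v2 = j \/ v2 = j + 1 by lia.
- apply: (@DA_box R A i i j (j + 1));
    [move=> [v1 v2] /= h1 h2|by rewrite /= ?intrD; apply/andP; split; nra|by rewrite /= ?intrD; apply/andP; split; nra].
  have -> : v1 = i by lia.
  by have [->|->] : v2 = j \/ v2 = j + 1 by lia.
Qed.

Lemma DA_halfseg (y z : Z2) (t : R) : y \in A -> adj y z -> 0 <= t < 2^-1 -> DA A (seg y z t).
Proof.
move=> yA yz /andP[t0 t1].
have hA v : y.1 <= v.1 <= y.1 -> y.2 <= v.2 <= y.2 -> v \in A.
  by rewrite -!eq_le => /eqP e1 /eqP e2; rewrite (surjective_pairing v) -e1 -e2 -surjective_pairing.
apply: (DA_box hA); move: y z yz yA hA; apply: adj_cases => i j _ _ /=;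
  rewrite ?intrD; apply/andP; split; nra.
Qed.
Lemma edge_path (y z : Z2) (t : R) : y \in A -> z \in A -> adj y z -> 0 <= t <= 1 ->
  ({for t, continuous (fun t => Re (f (seg y z t)))} /\ {for t, continuous (fun t => Im (f (seg y z t)))}) /\
  0 < Re (f (seg y z t)) ^+ 2 + Im (f (seg y z t)) ^+ 2.
Proof.
move=> yA zA yz t01; have D := DA_seg yA zA yz t01.
have c : {for t, continuous (f \o seg y z)}.
  by apply: continuous_comp; [exact: seg_continuous|exact: (conformal_continuous hf D)].
split; last by apply/Complex_neq0/(conformal_neq0 hf hw0 D); exact: seg_neq_w0.
by split; [apply: (continuous_comp c); exact: continuous_Re|apply: (continuous_comp c); exact: continuous_Im].
Qed.

Definition edge_turn (y z : Z2) : int :=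
  winding (fun t => Re (f (seg y z t))) (fun t => Im (f (seg y z t))) 0 1.

Lemma edge_turnP (y z : Z2) : y \in A -> z \in A -> adj y z ->
  turn_along (seg y z) 0 1 (edge_turn y z).
Proof. by move=> yA zA yz; apply: windingP => // t /(edge_path yA zA yz)[]. Qed.

Lemma edge_turn_eq (y z : Z2) k : y \in A -> z \in A -> adj y z ->
  turn_along (seg y z) 0 1 k -> edge_turn y z = k.
Proof. by move=> yA zA yz; apply: turn_winding => // t /(edge_path yA zA yz)[]. Qed.

Lemma edge_turnC (y z : Z2) : y \in A -> z \in A -> adj y z -> edge_turn z y = - edge_turn y z.
Proof.
move=> yA zA yz; apply: edge_turn_eq => //; first by rewrite adj_sym.
have cr : continuous (fun t : R => 1 - t).
  by move=> t; apply: cvgB; [exact: cvg_cst|exact: cvg_id].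
have := turn_rev cr _ _ _ (edge_turnP yA zA yz) (a' := 0) (b' := 1).
rewrite subr0 subrr => /(_ _ erefl erefl) h; apply: (eq_turn _ (h _)) => t /andP[t0 t1].
  by rewrite /= -!segC.
by rewrite subr_ge0 t1 lerBlDr lerDl.
Qed.

(** [true] stands for the sign $-1$. Off the edges inside [A] the value is [false], so that sums
    along rows can start to the left of [A]. *)
Definition edge_sign (y z : Z2) : bool := [&& y \in A, z \in A, adj y z & odd `|edge_turn y z|%N].

Lemma edge_sign_sym y z : edge_sign y z = edge_sign z y.
Proof.
rewrite /edge_sign adj_sym andbCA; case: (boolP (z \in A)) => // zA; case: (boolP (y \in A)) => // yA.
by case: (boolP (adj z y)) => // zy; rewrite /= (edge_turnC zA yA zy) abszN.
Qed.

Lemma edge_signA y z : edge_sign y z -> y \in A. Proof. by case/and4P. Qed.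

Lemma edge_turn_affine (X Y : R -> R) (y z : Z2) (c : R) : y \in A -> z \in A -> adj y z ->
  (forall t, 0 <= t <= 1 -> X (c + t) = Re (f (seg y z t)) /\ Y (c + t) = Im (f (seg y z t))) ->
  winding X Y c (c + 1) = edge_turn y z.
Proof.
move=> yA zA yz e; have shift t : c <= t <= c + 1 -> 0 <= t - c <= 1.
  by rewrite subr_ge0 lerBlDl.
have ct t : c + (t - c) = t by rewrite addrC subrK.
apply: turn_winding; first by rewrite lerDl.
  move=> t /shift ht; have [_] := edge_path yA zA yz ht.
  by have [<- <-] := e _ ht; rewrite ct.
have cs : continuous (fun t : R => t - c).
  by move=> t; apply: cvgB; [exact: cvg_id|exact: cvg_cst].
have := turn_comp cs _ _ _ (edge_turnP yA zA yz) (a' := c) (b' := c + 1).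
rewrite subrr addrAC subrr add0r => /(_ shift erefl erefl); apply: eq_turn => t /shift/e /=.
by rewrite ct => -[-> ->].
Qed.

(** The circulation modulo 2: the orientations of the four sides no longer matter, and [plaq]
    remains. *)
Lemma edge_sign_plaq (p : Z2) : all (fun v => v \in A) (pcorners p) ->
  plaq edge_sign p = (p == (0, -1)).
Proof.
move=> pA; have := plaquette_circulation hf hw0 pA; case/and5P: pA => p1 p2 p3 p4 _.
have hor (i j : int) : adj (i, j) (i + 1, j) by rewrite adjE !inE !xpair_eqE /=; lia.
have ver (i j : int) : adj (i, j) (i, j + 1) by rewrite adjE !inE !xpair_eqE /=; lia.
rewrite /circulation !intrD.
rewrite (edge_turn_affine p1 p2 (hor _ _)) => [|t _]; last by rewrite /U /V /seg intrD;
  split; congr (_ (f (Complex _ _))); ring.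
rewrite (edge_turn_affine p2 p4 (ver _ _)) => [|t _]; last by rewrite /U /V /seg !intrD;
  split; congr (_ (f (Complex _ _))); ring.
rewrite (edge_turn_affine p3 p4 (hor _ _)) => [|t _]; last by rewrite /U /V /seg !intrD;
  split; congr (_ (f (Complex _ _))); ring.
rewrite (edge_turn_affine p1 p3 (ver _ _)) => [|t _]; last by rewrite /U /V /seg !intrD;
  split; congr (_ (f (Complex _ _))); ring.
rewrite /plaq /edge_sign p1 p2 p3 p4 !hor !ver /= => /(congr1 (fun k : int => odd `|k|)).
by rewrite !odd_abszD !abszN => ->; case: (p == _).
Qed.
End EdgeSigns.

Lemma within_continuous_comp (S T W : topologicalType) (D : set T) (f : T -> W) (g : S -> T) :
  {within D, continuous f} -> continuous g -> (forall t, D (g t)) -> continuous (f \o g).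
Proof.
move=> /subspace_continuousP cf cg gD t P hP.
have /= h := cf _ (gD t) P hP; have {}h := cg t _ h.
by move: h; apply: (@filterS _ (nbhs t)) => u /(_ (gD u)).
Qed.

Lemma exprz_sign (R : realType) (k : int) : (-1) ^ k = (-1) ^+ odd `|k| :> R.
Proof. by case: k => n; rewrite signr_odd // /exprz -exprVn invrN invr1. Qed.

(** * Half edges that end on the boundary *)

Section BoundaryEdge.
Variables (R : realType) (A : {fset Z2}) (f : Cx R -> Cx R).
Hypothesis hf : is_conformal A f.
Hypothesis hw0 : DA A (w0 R).
Local Notation Re := (@complex.Re R).
Local Notation Im := (@complex.Im R).
Variables (y z : Z2).
Hypothesis yA : y \in A.
Hypothesis yz : adj y z.
Let h (t : R) : Cx R := f (seg y z (clamp 0 2^-1 t)).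

Let h0 : 0 <= 2^-1 :> R. Proof. by []. Qed.

Lemma closure_halfseg (t : R) : 0 <= t <= 2^-1 -> closure (DA A) (seg y z t).
Proof.
case/andP=> t0; rewrite le_eqVlt => /orP[/eqP ->|t1]; last first.
  by apply: subset_closure; apply: DA_halfseg => //; rewrite t0.
move=> B /(@seg_continuous R y z 2^-1) hB.
near (2^-1 : R)^'- => u; exists (seg y z u); split; last by near: u; apply: cvg_within; exact: hB.
by apply: DA_halfseg => //; apply/andP; split; near: u; [apply: nbhs_left_ge|exact: nbhs_left_lt].
Unshelve. all: by end_near.
Qed.

Lemma half_edge_continuous : continuous h.
Proof.
have [_ _ _ _ cf] := hf; apply: (within_continuous_comp (g := seg y z \o clamp 0 2^-1) cf).
  by move=> t; apply: continuous_comp; [exact: clamp_continuous|exact: seg_continuous].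
by move=> t; apply: closure_halfseg; exact: clamp_itv.
Qed.

(* Near a zero of [f] on the boundary, [f] would take small values, which it
   already takes near [w0]. *)
Lemma midpoint_neq0 : f (seg y z 2^-1) != 0.
Proof.
apply/eqP => fz; have [d d0 onto] := conformal_onto hf hw0.
have hz : h 2^-1 = 0 by rewrite /h clamp_id // h0 lexx.
(* The distance to $w_0$ in the sup norm. A square of half-side [e] below it excludes the points
   near the midpoint, so a small value of [f] there would be taken at two distinct points, against
   injectivity. *)
pose far (t : R) : R := Num.max `|Re (seg y z t) - 2^-1| `|Im (seg y z t) + 2^-1|.
have far0 : 0 < far 2^-1.
  rewrite lt_max !normr_gt0 !subr_eq0 -negb_and; apply: contra (@seg_neq_w0 R y z 2^-1 yz).
  by rewrite addr_eq0 eq_complex.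
pose e := Num.min (d / 2) (far 2^-1 / 2).
have e0 : 0 < e by rewrite lt_min !divr_gt0.
have ed : e < d by rewrite (@le_lt_trans _ _ (d / 2)) ?ge_min ?lexx // gtr_pMr // invf_lt1 // ltr1n.
have ef : e < far 2^-1 by rewrite (@le_lt_trans _ _ (far 2^-1 / 2)) ?ge_min ?lexx ?orbT // gtr_pMr // invf_lt1 // ltr1n.
have [r r0 {}onto] := onto e e0 ed.
have cfar : {for 2^-1, continuous far}.
  apply: continuous_max; apply: continuous_comp; do ?exact: norm_continuous.
    apply: cvgB; last exact: cvg_cst.
    by apply: continuous_comp; [exact: seg_continuous|exact: continuous_Re].
  apply: cvgD; last exact: cvg_cst.
  by apply: continuous_comp; [exact: seg_continuous|exact: continuous_Im].
have cRe : \forall t \near (2^-1 : R), `|Re (h t)| < r.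
  suff c : Re \o h @ (2^-1 : R) --> (0 : R) by exact: cvgr0_norm_lt c _ r0.
  rewrite (_ : 0 = (Re \o h) 2^-1); last by rewrite /= hz.
  by apply: continuous_comp; [exact: half_edge_continuous|exact: continuous_Re].
have cIm : \forall t \near (2^-1 : R), `|Im (h t)| < r.
  suff c : Im \o h @ (2^-1 : R) --> (0 : R) by exact: cvgr0_norm_lt c _ r0.
  rewrite (_ : 0 = (Im \o h) 2^-1); last by rewrite /= hz.
  by apply: continuous_comp; [exact: half_edge_continuous|exact: continuous_Im].
near (2^-1 : R)^'- => t.
have t0 : 0 <= t by near: t; exact: nbhs_left_ge.
have t1 : t < 2^-1 by near: t; exact: nbhs_left_lt.
have D : DA A (seg y z t) by apply: DA_halfseg => //; rewrite t0.
have hht : h t = f (seg y z t) by rewrite /h clamp_id // t0 ltW.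
have : e < far t by near: t; apply: cvg_within; exact: cvgr_gt cfar _ ef.
have p1 : `|Re (f (seg y z t))| < r by rewrite -hht; near: t; apply: cvg_within; exact: cRe.
have p2 : `|Im (f (seg y z t))| < r by rewrite -hht; near: t; apply: cvg_within; exact: cIm.
have [u [v [hu hv D' e']]] := onto _ _ p1 p2.
have e'' : f (Complex (2^-1 + u) (- 2^-1 + v)) = f (seg y z t) by rewrite e'; case: (f _).
rewrite /far -(conformal_inj hf (mem_set D') (mem_set D) e'') /= lt_max.
by rewrite [2^-1 + u]addrC addrK addrAC addNr add0r !ltNge hu hv.
Unshelve. all: by end_near.
Qed.

Lemma half_edge_path (t : R) : 0 <= t <= 2^-1 -> 0 < Re (f (seg y z t)) ^+ 2 + Im (f (seg y z t)) ^+ 2.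
Proof.
case/andP=> t0; rewrite le_eqVlt => /orP[/eqP ->|t1]; apply: Complex_neq0; first exact: midpoint_neq0.
by apply: (conformal_neq0 hf hw0); [apply: DA_halfseg => //; rewrite t0|exact: seg_neq_w0].
Qed.

Definition half_turn : int :=
  winding (fun t => Re (f (seg y z t))) (fun t => Im (f (seg y z t))) 0 2^-1.

Lemma half_turnP : turn_along f (seg y z) 0 2^-1 half_turn.
Proof.
have [||k hk] := @turn_exists R (fun t => Re (h t)) (fun t => Im (h t)) 0 2^-1 h0.
- move=> t _; have c : {for t, continuous h} by exact: half_edge_continuous.
  by split; [apply: (continuous_comp c); exact: continuous_Re|apply: (continuous_comp c); exact: continuous_Im].
- by move=> t ht; rewrite /h clamp_id //; exact: half_edge_path.
have {}hk : turn_along f (seg y z) 0 2^-1 k by apply: eq_turn hk => t ht; rewrite /h clamp_id.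
by rewrite /half_turn (turn_winding h0 half_edge_path hk).
Qed.
End BoundaryEdge.

(** * Signs of interpolated walks as products of edge signs *)

Section WalkSigns.
Variables (R : realType) (A : {fset Z2}) (f : Cx R -> Cx R).
Hypothesis hf : is_conformal A f.
Hypothesis hw0 : DA A (w0 R).
Local Notation Re := (@complex.Re R).
Local Notation Im := (@complex.Im R).
Local Notation esign := (edge_sign A f).

(** The lift selected in [Q] is continuous on [[0, T]] only; [turn_branch] compares it with any lift
    on the whole line. *)
Lemma Q_turn (g : R -> Cx R) (T : R) (k : int) : 0 <= T ->
  (forall t : R, 0 <= t <= T -> 0 < Re (f (g t)) ^+ 2 + Im (f (g t)) ^+ 2) ->
  turn_along f g 0 T k -> Q f g T = (-1) ^+ odd `|k|.
Proof.
move=> T0 g0 tk; rewrite -exprz_sign /Q; congr (_ ^ _).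
have liftP Th t : f (g t) = `|f (g t)| * Complex (cos (Th t)) (sin (Th t)) <->
    polar (Re (f (g t))) (Im (f (g t))) (Th t).
  rewrite /polar normc_def; case: (f (g t)) => a b /=.
  have -> : (Num.sqrt (a ^+ 2 + b ^+ 2))%:C%C * Complex (cos (Th t)) (sin (Th t)) =
      Complex (Num.sqrt (a ^+ 2 + b ^+ 2) * cos (Th t)) (Num.sqrt (a ^+ 2 + b ^+ 2) * sin (Th t)).
    by apply/eqP; rewrite eq_complex /= !mul0r subr0 addr0 !eqxx.
  by split=> [e|[e e']]; [split; [exact: (congr1 Re e)|exact: (congr1 Im e)]|rewrite -e -e'].
have [cT pT] : is_arg_lift f g T (arg_lift f g T).
  rewrite /arg_lift; case: xgetP => [Th _ //|none]; case: tk => Th cTh [pTh _].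
  case: (none Th); split=> [|t /pTh/liftP//]; exact: continuous_subspaceT.
rewrite /J -/(branch (arg_lift f g T) 0 T); apply: (turn_branch T0 g0 tk cT) => t /pT.
by move/liftP.
Qed.

Lemma interp_turn (s : nat -> Z2) (n : nat) :
  (forall k, (k <= n)%N -> s k \in A) -> (forall k, (k < n)%N -> adj (s k) (s k.+1)) ->
  turn_along f (interp s) 0 n%:R (\sum_(k < n) edge_turn f (s k) (s k.+1)) /\
  forall t : R, 0 <= t <= n%:R -> 0 < Re (f (interp s t)) ^+ 2 + Im (f (interp s t)) ^+ 2.
Proof.
elim: n => [|n IHn] sA adjs.
  (* For a walk without steps the interpolation still mentions [s 1], which is unconstrained but has
     weight 0; an arbitrary neighbour of [y] takes its place. *)
  pose y := s 0%N; have e (t : R) : 0 <= t <= 0%:R -> interp s t = seg y (y.1 + 1, y.2) 0.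
    rewrite -eq_le => /eqP <-; rewrite (@seg_interp R s 0%N 0) ?subr0 ?lexx ?ler01 //.
    by rewrite /seg subr0 !mul0r.
  have yz : adj y (y.1 + 1, y.2) by rewrite adjE !inE !xpair_eqE /=; lia.
  have r0 (t : R) : 0 <= t <= 0%:R -> 0 < Re (f (interp s t)) ^+ 2 + Im (f (interp s t)) ^+ 2.
    by move=> /e ->; apply: (half_edge_path hf hw0) => //; [exact: sA|rewrite lexx /=].
  split=> //; rewrite big_ord0.
  have [//|||k [Th cT [pT ek]]] :=
    @turn_exists R (fun=> Re (f (seg y (y.1 + 1, y.2) 0))) (fun=> Im (f (seg y (y.1 + 1, y.2) 0))) 0 0.
  - by move=> t _; split; exact: cst_continuous.
  - by move=> t ht; have := r0 t ht; rewrite (e t ht).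
  by exists Th => //; split=> [t ht|]; [rewrite (e t ht); exact: pT|rewrite /branch subrr].
have [k h|k h|tn r0] := IHn; [by apply: sA; exact: leqW|by apply: adjs; exact: leqW|].
have nA : s n \in A by exact: sA.
have nA' : s n.+1 \in A by exact: sA.
have an := adjs n (ltnSn n).
have shift (t : R) : n%:R <= t <= n.+1%:R -> 0 <= t - n%:R <= 1.
  by rewrite subr_ge0 lerBlDl -natr1.
have nn : n%:R <= n.+1%:R :> R by rewrite ler_nat.
have rn (t : R) : n%:R <= t <= n.+1%:R -> 0 < Re (f (interp s t)) ^+ 2 + Im (f (interp s t)) ^+ 2.
  by move=> ht; rewrite (seg_interp _ ht); have [] := edge_path hf hw0 nA nA' an (shift _ ht).
split; last first.
  move=> t /andP[t0 t1]; have [h|h] := leP t n%:R; first by apply: r0; rewrite t0.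
  by apply: rn; rewrite (ltW h).
rewrite big_ord_recr /=; apply: (turn_cat (m := n%:R)) => //; first by apply: r0; rewrite ler0n lexx.
have cs : continuous (fun t : R => t - n%:R).
  by move=> t; apply: cvgB; [exact: cvg_id|exact: cvg_cst].
have := turn_comp cs _ _ _ (edge_turnP hf hw0 nA nA' an) (a' := n%:R) (b' := n.+1%:R).
rewrite subrr -natr1 addrAC subrr add0r natr1 => /(_ shift erefl erefl); apply: eq_turn => t ht.
by rewrite /= (seg_interp _ ht).
Qed.

Lemma half_interp_turn (s : nat -> Z2) (n : nat) :
  (forall k, (k <= n)%N -> s k \in A) -> (forall k, (k <= n)%N -> adj (s k) (s k.+1)) ->
  Q f (interp s) (n.+1%:R - 2^-1) =
  (-1) ^+ odd `|\sum_(k < n) edge_turn f (s k) (s k.+1)| * (-1) ^+ odd `|half_turn f (s n) (s n.+1)|.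
Proof.
move=> sA adjs; have [tn r0] := interp_turn sA (fun k h => adjs k (ltnW h)).
have nA : s n \in A by exact: sA.
have an := adjs n (leqnn n).
have hn : n%:R <= n.+1%:R - 2^-1 :> R by rewrite -natr1; lra.
have shift (t : R) : n%:R <= t <= n.+1%:R - 2^-1 -> 0 <= t - n%:R <= 2^-1.
  by rewrite -natr1 => /andP[? ?]; apply/andP; split; lra.
have wide (t : R) : n%:R <= t <= n.+1%:R - 2^-1 -> n%:R <= t <= n.+1%:R.
  by rewrite -natr1 => /andP[? ?]; apply/andP; split; lra.
have rn (t : R) : n%:R <= t <= n.+1%:R - 2^-1 -> 0 < Re (f (interp s t)) ^+ 2 + Im (f (interp s t)) ^+ 2.
  by move=> ht; rewrite (seg_interp _ (wide _ ht)); exact: (half_edge_path hf hw0 nA an (shift _ ht)).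
have n0 : 0 <= n%:R :> R by exact: ler0n.
rewrite -signr_addb -odd_abszD; apply: Q_turn.
- exact: le_trans hn.
- move=> t /andP[t0 t1]; have [h|h] := leP t n%:R; first by apply: r0; rewrite t0.
  by apply: rn; rewrite (ltW h).
apply: (turn_cat (m := n%:R)) => //; first by apply: r0; rewrite n0 lexx.
have cs : continuous (fun t : R => t - n%:R).
  by move=> t; apply: cvgB; [exact: cvg_id|exact: cvg_cst].
have := turn_comp cs _ _ _ (half_turnP hf hw0 nA an) (a' := n%:R) (b' := n.+1%:R - 2^-1).
rewrite subrr (_ : n.+1%:R - 2^-1 - n%:R = 2^-1); last by rewrite -natr1; lra.
move=> /(_ shift erefl erefl); apply: eq_turn => t /wide ht.
by rewrite /= (seg_interp _ ht).
Qed.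

Lemma odd_edge_turns (s : nat -> Z2) x t : (forall k, (k <= size t)%N -> s k = nth o0 (x :: t) k) ->
  path adj x t -> all (fun y => y \in A) (x :: t) ->
  odd `|\sum_(k < size t) edge_turn f (s k) (s k.+1)| = xpar esign x t.
Proof.
elim: t s x => [|y t IHt] s x es /=; first by rewrite big_ord0.
move=> /andP[xy pt] /and3P[xA yA tA]; rewrite big_ord_recl odd_abszD.
have yt : all (fun u => u \in A) (y :: t) by rewrite /= yA.
rewrite -(IHt (s \o S) y (fun k hk => es k.+1 hk) pt yt); congr (_ (+) _).
by rewrite (es 0%N) // (es 1%N) //= /edge_sign xA yA xy.
Qed.

Lemma Qw_xpar x t : path adj x t -> all (fun y => y \in A) (x :: t) ->
  Qw f (x :: t) = (-1) ^+ xpar esign x t.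
Proof.
move=> pt tA; have h := @interp_turn (nth o0 (x :: t)) (size t) _ _.
have [||tn r0] := h.
- by move=> k hk; apply: (allP tA); rewrite mem_nth.
- by move=> k hk; exact: (pathP o0 pt).
by rewrite /Qw (Q_turn _ r0 tn) ?ler0n // (odd_edge_turns (t := t) (x := x)).
Qed.
End WalkSigns.

(** * Signed Green functions *)

Section SignedWeights.
Variables (R : realType) (A : {fset Z2}) (f : Cx R -> Cx R).
Hypothesis hf : is_conformal A f.
Hypothesis hw0 : DA A (w0 R).

Definition wq (y z : Z2) : R := wp R y z * (-1) ^+ edge_sign A f y z.

Lemma wq_bound y z : `|wq y z| <= (adj y z)%:R / 4.
Proof. by rewrite normrM normr_sign mulr1; exact: wp_bound. Qed.

Lemma wprod_wq x t : path adj x t -> wprod wq x t = 4 ^- size t * (-1) ^+ xpar (edge_sign A f) x t.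
Proof.
move=> pt; rewrite -(wprod_wp R pt); elim: t x {pt} => [|y t IH] x /=; first by rewrite mulr1.
by rewrite IH signr_addb mulrACA.
Qed.

Lemma qw_wprod x t : path adj x t -> all (fun u => u \in A) (x :: t) -> qw f (x :: t) = wprod wq x t.
Proof. by move=> pt tA; rewrite /qw /pw (Qw_xpar hf hw0) // wprod_wq. Qed.

Lemma cvg_abs_kpow B x v :
  cvgn (series (fun k => \sum_(t <- wl k B x v) 4 ^- size t : R)).
Proof.
rewrite (_ : (fun k => _) = (fun k => kpow (@wp R) B k x v)).
  by apply/cvg_ex; exists (hsum (@wp R) B x v); exact: (@kpow_cvg R _ (@wp_bound R) B x v).
apply/funext => k; rewrite -sum_wl => [|u u' nu]; last by rewrite /wp (negbTE nu) mul0r.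
rewrite big_seq [RHS]big_seq; apply: eq_bigr => t.
by rewrite mem_wl => /and4P[_ pt _ _]; rewrite wprod_wp.
Qed.

Lemma Gq_hsum (B : {fset Z2}) z v : {subset B <= A} -> z \in B -> Gq f B z v = hsum wq B z v.
Proof.
move=> BA zB; pose l k := map (cons z) (wl k B z v).
have gl : graded (walks_in B z v) l.
  have [ul Dl tl] := wtails_graded B z v; split.
  - by move=> k; rewrite map_inj_uniq // => s t [].
  - move=> s; split=> [[t [-> pt tB lt]]|[k /mapP[t tl' ->]]].
      have /Dl[k tk] : wtails B z v t.
        by apply/and3P; split; rewrite ?lt //; apply/allP => u ut; apply: tB; rewrite inE ut orbT.
      by exists k; apply: map_f.
    have /Dl/and3P[pt /allP tB /eqP lt] : exists k, t \in wl k B z v by exists k.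
    by exists t; split=> // u; rewrite inE => /predU1P[->|/tB].
  - by move=> s j k /mapP[t tj ->] /mapP[t' tk [e]]; apply: (tl t) => //; rewrite e.
have BAt t : all (fun u => u \in B) t -> all (fun u => u \in A) t.
  by apply: sub_all => u; exact: BA.
rewrite /Gq (rsum_graded gl); last first.
  rewrite (_ : (fun k => _) = (fun k => \sum_(t <- wl k B z v) 4 ^- size t)); first exact: cvg_abs_kpow.
  apply/funext => k; rewrite big_map big_seq [RHS]big_seq; apply: eq_bigr => t.
  rewrite mem_wl => /and4P[_ pt /BAt tA _]; rewrite qw_wprod //= ?BA //.
  by rewrite wprod_wq // normrM normr_sign mulr1 ger0_norm // invr_ge0 exprn_ge0.
rewrite /hsum; congr (limn (series _)); apply/funext => k.
rewrite -sum_wl => [|u u' nu]; last by rewrite /wq /wp (negbTE nu) !mul0r.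
rewrite /l big_map big_seq [RHS]big_seq; apply: eq_bigr => t.
by rewrite mem_wl => /and4P[_ pt /BAt tA _]; rewrite qw_wprod //= ?BA.
Qed.

Lemma qbar_loopZ : o0 \in A -> o1 \in A ->
  qbar f A = 4^-1 * (loopZ wq A / loopZ wq ((A `\ o0) `\ o1)%fset).
Proof.
move=> A0 A1; have A1' : o1 \in (A `\ o0)%fset by rewrite !inE A1.
rewrite /qbar !Gq_hsum // => [|u]; last by rewrite !inE => /andP[].
rewrite (loopZ_rec wq_bound A0) (loopZ_rec wq_bound A1') -mulrA; congr (_ * _).
by rewrite [X in X / _]mulrA mulfK // gt_eqF // loopZ_gt0.
Qed.
End SignedWeights.

(** * The measure of the odd loops *)

Definition closed_parity (sb : Z2 -> Z2 -> bool) (l : seq Z2) : bool :=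
  if l is x :: t then xpar sb x (rcons t x) else false.

Lemma closed_parity_rot sb i l : closed_parity sb (rot i l) = closed_parity sb l.
Proof.
rewrite -{2}(cat_take_drop i l) /rot; case: (take i l) (drop i l) => [|x s] [|y u]; rewrite ?cats0 //=.
rewrite !rcons_cat /= -!cats1 !xpar_cat /= !xpar_cat /= !addbF.
by case: (xpar sb y u); case: (sb _ x); case: (xpar sb x s); case: (sb _ y).
Qed.

Lemma loop_class_rot i l : loop_class (rot i l) = loop_class l.
Proof.
have rr j k (s : seq Z2) : exists n, rot j (rot k s) = rot n s.
  have [ks|/ltnW ks] := leqP k (size s); last by rewrite (rot_oversize ks); exists j.
  have [js|/ltnW js] := leqP j (size s); last by rewrite rot_oversize ?size_rot //; exists k.
  by rewrite rot_add_mod //; eexists.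
apply/seteqP; split=> _ [j ->]; first by have [n ->] := rr j i l; exists n.
have [n en] := rr (size l - i)%N i l; have [k ek] := rr j (size l - i)%N (rot i l).
exists k; rewrite -ek; congr (rot j _); apply/esym.
by have := rotK i l; rewrite /rotr size_rot.
Qed.

Section LoopMeasure.
Variables (R : realType) (A : {fset Z2}) (f : Cx R -> Cx R).
Hypothesis hf : is_conformal A f.
Hypothesis hw0 : DA A (w0 R).
Local Notation esign := (edge_sign A f).
Local Notation wqA := (wq A f).

Definition odd_loops : set (seq Z2) :=
  [set l | rooted_loop l /\ all (fun u => u \in A) l && closed_parity esign l].

Lemma Qw_loop l : rooted_loop l -> all (fun u => u \in A) l ->
  Qw f (rcons l (head o0 l)) = (-1) ^+ closed_parity esign l.
Proof.
case: l => [[]//|x t] [_ ct] /= /andP[xA tA].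
by rewrite (Qw_xpar hf hw0) //= xA all_rcons xA.
Qed.

Lemma rooted_loop_rot i l : rooted_loop l -> rooted_loop (rot i l).
Proof. by case=> l0 cl; split; rewrite ?rot_cycle // -size_eq0 size_rot size_eq0. Qed.

Lemma JAP c : JA f A c <-> exists2 l, odd_loops l & c = loop_class l.
Proof.
have sign1 (b : bool) : (-1) ^+ b = -1 :> R <-> b.
  by case: b; split=> // /eqP; rewrite expr0 -subr_eq0 opprK (_ : 1 + 1 = 2%:R) // pnatr_eq0.
split=> [[[l rl <-] h]|[l [rl /andP[lA ol]] ->]].
  exists l => //; split=> //; have [|/allP lA] := h l; first by exists 0%N; rewrite rot0.
  by rewrite Qw_loop // => /sign1 ol; rewrite lA.
split; first by exists l.
move=> _ [i ->]; have rA : all (fun u => u \in A) (rot i l) by rewrite (eq_all_r (mem_rot i l)).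
split; first by apply/allP.
by rewrite Qw_loop //; [apply/sign1; rewrite closed_parity_rot|exact: rooted_loop_rot].
Qed.

Definition loop_weight (l : seq Z2) : R := (size l)%:R^-1 * 4 ^- size l.

Lemma loop_weight_ge0 l : 0 <= loop_weight l.
Proof. by rewrite mulr_ge0 // invr_ge0 ?exprn_ge0. Qed.

(** All rooted representatives have the same length, so the measure of the class is spread evenly:
    each receives [loop_weight]. *)
Lemma esum_loop_class l :
  (\esum_(l' in loop_class l) (loop_weight l')%:E = (loop_measure R (loop_class l))%:E)%E.
Proof.
have fin : finite_set (loop_class l).
  apply: (@sub_finite_set _ _ [set` [seq rot i l | i <- iota 0 (size l).+1]]) => [_ [i ->]|]; last exact: finite_seq.
  have [il|il] := leqP i (size l); first by apply/mapP; exists i; rewrite // mem_iota.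
  by apply/mapP; exists 0%N; rewrite ?mem_iota // rot0 rot_oversize // ltnW.
have len l' : loop_class l l' -> size l' = size l by case=> i ->; rewrite size_rot.
have ll : loop_length (loop_class l) = size l.
  by apply: len; apply: xgetPex; exists l; exists 0%N; rewrite rot0.
rewrite esum_fset // => [|l' _]; last by rewrite lee_fin loop_weight_ge0.
rewrite fsbig_finite //= /loop_measure ll.
transitivity (\sum_(l' <- fset_set (loop_class l)) (loop_weight l)%:E)%E.
  by apply: eq_big_seq => l'; rewrite in_fset_set // inE => /len e; rewrite /loop_weight e.
rewrite sumEFin; congr EFin; rewrite big_const_seq count_predT iter_addr_0 -[LHS]mulr_natl.
by rewrite /loop_weight mulrA.
Qed.

Lemma esum_JA : (\esum_(c in JA f A) (loop_measure R c)%:E = \esum_(l in odd_loops) (loop_weight l)%:E)%E.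
Proof.
transitivity (\esum_(c in JA f A) \esum_(l in c) (loop_weight l)%:E)%E.
  by apply: eq_esum => c /JAP[l _ ->]; rewrite esum_loop_class.
rewrite (esum_esum (J := fun c => c) (a := fun _ l => (loop_weight l)%:E)) => [|c l _ _]; last first.
  by rewrite lee_fin loop_weight_ge0.
apply: (@reindex_esum R _ _ odd_loops _ (fun l => (loop_class l, l)) (fun k => (loop_weight k.2)%:E)); split.
- move=> l ol; split=> /=; first by apply/JAP; exists l.
  by exists 0%N; rewrite rot0.
- by move=> l l' _ _ [].
- move=> [c l] /= [/JAP[l0 [rl /andP[lA ol]] ->] [i ->]].
  exists (rot i l0); last by rewrite loop_class_rot.
  split; first exact: rooted_loop_rot.
  by rewrite (eq_all_r (mem_rot i l0)) lA closed_parity_rot.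
Qed.

Let trace (w : Z2 -> Z2 -> R) k : R := (\sum_(x <- A) kpow w A k x x) / k%:R.

Lemma odd_loops_graded : graded odd_loops (fun k =>
  if k is 0%N then [::] else [seq belast x t | x <- A, t <- [seq t <- wl k A x x | xpar esign x t]]).
Proof.
have szl l k : l \in (if k is 0%N then [::] else
    [seq belast x t | x <- A, t <- [seq t <- wl k A x x | xpar esign x t]]) -> size l = k.
  case: k => // k /allpairsPdep[x [t [_ + ->]]].
  by rewrite mem_filter mem_wl size_belast => /and5P[_ /eqP].
split=> [[|k]//|l|l j k /szl <- /szl //].
  apply: allpairs_uniq_dep; first exact: fset_uniq.
    by move=> x _; rewrite filter_uniq ?wl_uniq.
  move=> [x s] [y u] /allpairsPdep[x' [s' [_ + [-> ->]]]] /allpairsPdep[y' [u' [_ + [-> ->]]]] /=.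
  rewrite !mem_filter !mem_wl => /and5P[_ ss _ _ /eqP ls] /and5P[_ su _ _ /eqP lu].
  case/lastP: s' ss ls => // s' z _; rewrite last_rcons => <-.
  case/lastP: u' su lu => // u' z' _; rewrite last_rcons => <-.
  by rewrite !belast_rcons => -[-> ->].
split=> [[[l0 cl] /andP[lA ol]]|[[|k]//]].
  case: l l0 cl lA ol => // x t _ ct /= /andP[xA tA] ol; exists (size t).+1.
  apply/allpairsPdep; exists x, (rcons t x); split=> //; last by rewrite belast_rcons.
  by rewrite mem_filter mem_wl size_rcons eqxx all_rcons xA tA last_rcons eqxx ol /= andbT; exact: ct.
case/allpairsPdep=> x [t [xA + ->]]; rewrite mem_filter mem_wl => /and5P[ol ss pt tA /eqP lt].
case/lastP: t ss ol pt tA lt => // t z _; rewrite last_rcons => ol pt + zx.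
by rewrite zx in ol pt *; rewrite all_rcons belast_rcons => tA; split; [split|rewrite /= tA].
Qed.

(** A closed walk of length [k] counts $4^{-k}$ in the first trace and $\pm4^{-k}$ in the second, so
    half of the difference selects the odd ones. This half is what the factor 2 in $\exp\{2m\}$
    compensates. For [k = 0] both traces are 0, being divided by 0. *)
Lemma sum_odd_loops k :
  \sum_(l <- if k is 0%N then [::] else [seq belast x t | x <- A, t <- [seq t <- wl k A x x | xpar esign x t]])
    loop_weight l = (trace (@wp R) k - trace wqA k) / 2.
Proof.
case: k => [|k]; first by rewrite big_nil /trace !invr0 !mulr0 subrr mul0r.
rewrite big_allpairs_dep -mulrBl -sumrB mulrAC [in RHS]mulr_suml [RHS]mulr_suml.
apply: eq_bigr => x _; rewrite big_filter.
have np u u' : ~~ adj u u' -> wp R u u' = 0 by move=> /negbTE nu; rewrite /wp nu mul0r.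
have nq u u' : ~~ adj u u' -> wqA u u' = 0 by move=> /np nu; rewrite /wq nu mul0r.
rewrite -(sum_wl k.+1 A x x np) -(sum_wl k.+1 A x x nq).
rewrite -sumrB !mulr_suml big_mkcond big_seq [RHS]big_seq; apply: eq_bigr => t.
rewrite mem_wl => /and4P[/eqP st pt _ _]; rewrite wprod_wp // wprod_wq // /loop_weight size_belast st.
case: (xpar _ _ _); last by rewrite expr0 mulr1 subrr !mul0r.
by rewrite expr1 mulrN1 opprK mulrDl -splitr mulrC.
Qed.

(** Dominated by the traces of simple random walk without the factor $1/k$, a finite sum of Green
    function series. *)
Lemma cvg_trace (w : Z2 -> Z2 -> R) : (forall x y, `|w x y| <= (adj x y)%:R / 4) ->
  cvgn (series (trace w)).
Proof.
move=> Hw; have p0 k x y : 0 <= kpow (@wp R) A k x y.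
  elim: k x => [|k IH] x /=; first exact: ler0n.
  by apply: sumr_ge0 => u _; rewrite mulr_ge0 ?divr_ge0.
have le_kpow k x y : `|kpow w A k x y| <= kpow (@wp R) A k x y.
  elim: k x => [|k IH] x /=; first by rewrite normr_nat.
  apply: le_trans (ler_norm_sum _ _ _) _; apply: ler_sum => u _.
  by rewrite normrM ler_pM.
apply: normed_cvg; apply: (@series_le_cvg _ _ (fun k => \sum_(x <- A) kpow (@wp R) A k x x)).
- by move=> k; exact: normr_ge0.
- by move=> k; apply: sumr_ge0.
- move=> k; rewrite /= /trace normrM [X in _ * X]ger0_norm ?invr_ge0 //.
  apply: (@le_trans _ _ `|\sum_(x <- A) kpow w A k x x|).
    case: k => [|k]; first by rewrite invr0 mulr0.
    by rewrite ler_piMr // invf_le1 ?ltr0n // ler1n.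
  by apply: le_trans (ler_norm_sum _ _ _) _; apply: ler_sum.
apply/cvg_ex; exists (\sum_(x <- A) hsum (@wp R) A x x).
rewrite (_ : series _ = fun n => \sum_(x <- A) series (fun k => kpow (@wp R) A k x x) n).
  by apply: cvg_bigsum => x _; exact: (@kpow_cvg R _ (@wp_bound R) A x x).
by apply/funext => n; rewrite /series /= exchange_big.
Qed.

Lemma exp_mJA : expR (2 * mJA f A) = loopZ (@wp R) A / loopZ wqA A.
Proof.
have [cp cq] := (cvg_trace (@wp_bound R), cvg_trace (@wq_bound R A f)).
have -> : mJA f A = (limn (series (trace (@wp R))) - limn (series (trace wqA))) / 2.
  have ge0 : forall c, 0 <= loop_measure R c.
    by move=> c; rewrite /loop_measure mulr_ge0 ?divr_ge0 // invr_ge0 exprn_ge0.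
  have pos : (loop_measure R)^\+ = loop_measure R by apply/funext => c; apply/max_idPl; exact: ge0.
  have neg : (loop_measure R)^\- = fun=> 0.
    by apply/funext => c; apply/max_idPr; rewrite oppr_le0.
  rewrite /mJA /rsum pos neg [X in _ - fine X]esum1 // subr0 esum_JA.
  have cpq : (fun n => (series (trace (@wp R)) n - series (trace wqA) n) / 2) @ \oo -->
      (limn (series (trace (@wp R))) - limn (series (trace wqA))) / 2.
    by apply: cvgMl; apply: cvgB.
  have e : series (fun k => \sum_(l <- if k is 0%N then [::] else
      [seq belast x t | x <- A, t <- [seq t <- wl k A x x | xpar esign x t]]) loop_weight l) =
      (fun n => (series (trace (@wp R)) n - series (trace wqA) n) / 2).
    by apply/funext => n; rewrite /series /= -sumrB mulr_suml; apply: eq_bigr => k _; exact: sum_odd_loops.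
  rewrite (fine_esum_graded odd_loops_graded) ?e //.
  - exact: cvg_lim cpq.
  - exact: loop_weight_ge0.
  - by apply/cvg_ex; eexists; exact: cpq.
by rewrite mulrC divfK // expRD expRN.
Qed.
End LoopMeasure.

(** * Trajectories of simple random walk *)

Fixpoint npaths n (x : Z2) : seq (seq Z2) :=
  if n is n'.+1 then [seq y :: t | y <- nbrs x, t <- npaths n' y] else [:: [::]].

Lemma mem_npaths n x t : (t \in npaths n x) = (size t == n) && path adj x t.
Proof.
elim: n x t => [|n IH] x [|y t]; rewrite // [npaths _ _]/(allpairs_dep _ (nbrs x) (npaths n)).
  by apply/negP => /allpairsPdep[y [t [_ _]]].
rewrite (_ : (size (y :: t) == n.+1) = (size t == n)) // (_ : path adj x (y :: t) = adj x y && path adj y t) //.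
apply/allpairsPdep/and3P => [[u [s [ux sn [-> ->]]]]|[sn xy pt]].
  by move: sn; rewrite IH adjE => /andP[].
by exists y, t; split; rewrite // -?adjE // IH sn.
Qed.

Lemma npaths_uniq n x : uniq (npaths n x).
Proof.
elim: n x => // n IH x; apply: allpairs_uniq_dep; [exact: nbrs_uniq|by []|].
by move=> [y s] [y' s'] _ _ /= [-> ->].
Qed.

Lemma size_npaths n x : size (npaths n x) = (4 ^ n)%N.
Proof.
by elim: n x => // n IH x; rewrite /= !size_cat !size_map !IH /= addn0 expnS; lia.
Qed.

Section Trajectories.
Variables (R : realType) (d : measure_display) (Om : measurableType d).
Variables (P : probability Om R) (S : nat -> Om -> Z2) (z : Z2).
Hypothesis hS : is_srw P S z.

Definition cyl (l : seq Z2) : set Om := [set o | forall k, (k < size l)%N -> S k o = nth o0 l k].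

Lemma measurable_cyl l : measurable (cyl l).
Proof.
have -> : cyl l = \bigcap_(k in `I_(size l)) [set o | S k o = nth o0 l k].
  by apply/seteqP; split => o h k; exact: h.
by apply: bigcap_measurableType => k _; exact: (hS.1).
Qed.

Definition cyls (l : seq (seq Z2)) : set Om := \bigcup_(s in [set` l]) cyl (z :: s).

Lemma measurable_cyls l : measurable (cyls l).
Proof. by apply: fin_bigcup_measurable => [|s _]; [exact: finite_seq|exact: measurable_cyl]. Qed.

Lemma P_cyls n (l : seq (seq Z2)) : uniq l -> (forall s, s \in l -> size s = n /\ path adj z s) ->
  P (cyls l) = ((size l)%:R * 4 ^- n)%:E.
Proof.
move=> ul hl; rewrite measure_fin_bigcup; first last.
- by move=> s _; exact: measurable_cyl.
- move=> s s' /= /hl[ss ps] /hl[ss' ps'] [ o [h h']].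
  apply: (@eq_from_nth _ o0); first by rewrite ss ss'.
  by move=> k ks; have := h k.+1 ks; rewrite h' //= ltnS ss' -ss.
- exact: finite_seq.
rewrite -fsbig_seq // big_seq (eq_bigr (fun=> (4 ^- n)%:E)) => [|s /hl[<- ps]]; last exact: (hS.2).
rewrite -big_seq sumEFin; congr EFin.
by rewrite big_const_seq count_predT iter_addr_0 -[LHS]mulr_natl.
Qed.

Definition nn_traj : set Om := \bigcap_n cyls (npaths n z).

(** [is_srw] prescribes the probabilities of nearest-neighbour cylinders only; at time [n] there are
    $4^n$ of them and their masses add up to 1, so nothing is left for other trajectories. *)
Lemma nn_traj_negligible : P.-negligible (~` nn_traj).
Proof.
rewrite setC_bigcap; apply: negligible_bigcup => n; apply/negligibleP.
  by apply: measurableC; exact: measurable_cyls.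
have m := measurable_cyls (npaths n z).
apply: etrans (probability_setC P m) _.
rewrite (@P_cyls n) ?npaths_uniq // => [|s]; last first.
  by rewrite mem_npaths => /andP[/eqP].
by rewrite size_npaths natrX mulfV ?expf_neq0 // subee.
Qed.

Lemma eq_on_nn_traj (U V : set Om) : measurable U -> measurable V ->
  (forall o, nn_traj o -> U o <-> V o) -> P U = P V.
Proof.
have le (U' V' : set Om) : measurable U' -> measurable V' ->
    (forall o, nn_traj o -> U' o -> V' o) -> (P U' <= P V')%E.
  move=> mU mV UV; have mD : measurable (U' `\` V') by exact: measurableD.
  have D0 : P (U' `\` V') = 0%E.
    apply: measure_negligible => //; apply: negligibleS nn_traj_negligible.
    by move=> o [uo nvo] go; apply: nvo; exact: UV.
  apply: (@le_trans _ _ (P (V' `|` (U' `\` V')))).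
    apply: le_measure; rewrite ?inE //; first exact: measurableU.
    by move=> o uo; have [vo|vo] := pselect (V' o); [left|right].
  by rewrite -[leRHS]adde0 -D0; exact: measureU2.
by move=> mU mV UV; apply/eqP; rewrite eq_le !le // => o /UV[].
Qed.

Lemma nn_trajP o : nn_traj o -> S 0%N o = z /\ forall k, adj (S k o) (S k.+1 o).
Proof.
move=> G; split=> [|k]; first by have [s _ h] := G 0%N I; rewrite (h 0%N).
have [s sn h] := G k.+1 I; have : s \in npaths k.+1 z by exact: sn.
rewrite mem_npaths => /andP[/eqP sk ps].
have hz j : (j <= k.+1)%N -> S j o = nth o0 (z :: s) j by move=> jk; apply: h; rewrite /= sk.
by rewrite !hz //; apply: (pathP o0 ps); rewrite sk.
Qed.

(** [tau] reads the index [k] off the trajectory, which makes the events for different [k]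
    disjoint. *)
Lemma P_graded_cyls (l : nat -> seq (seq Z2)) (tau : Om -> nat) :
  (forall k, uniq (l k)) -> (forall k s, s \in l k -> size s = k.+1 /\ path adj z s) ->
  (forall k s o, s \in l k -> cyl (z :: s) o -> tau o = k) ->
  cvgn (series (fun k => (size (l k))%:R * 4 ^- k.+1 : R)) ->
  P (\bigcup_k cyls (l k)) = (limn (series (fun k => (size (l k))%:R * 4 ^- k.+1 : R)))%:E.
Proof.
move=> ul hl htau cv; have m := bigcupT_measurable _ (fun k => measurable_cyls (l k)).
rewrite measure_semi_bigcup //; [|by move=> k; exact: measurable_cyls|].
  rewrite -EFin_lim //; congr (limn _); apply/funext => n; rewrite /series /= -sumEFin.
  by apply: eq_bigr => k _; rewrite (P_cyls (ul k) (hl k)).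
by move=> j k _ _ [ o [[s sj h] [s' sk h']]]; rewrite -(htau _ _ _ sj h) -(htau _ _ _ sk h').
Qed.
End Trajectories.

Lemma eq_Q (R : realType) (f : Cx R -> Cx R) (g g' : R -> Cx R) (T : R) :
  (forall t, 0 <= t <= T -> g t = g' t) -> Q f g T = Q f g' T.
Proof.
move=> e; rewrite /Q /J; suff -> : arg_lift f g T = arg_lift f g' T by [].
congr (xget _ _); apply/seteqP.
by split=> Th [cT pT]; split=> // t ht; have := pT t ht; rewrite e.
Qed.

(** * The signed exit expectation as a signed Green function *)

Section SignedExits.
Variables (R : realType) (A : {fset Z2}) (f : Cx R -> Cx R) (a : Z2 * Z2).
Hypothesis hf : is_conformal A f.
Hypothesis hw0 : DA A (w0 R).
Hypothesis A0 : o0 \in A.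
Hypothesis A1 : o1 \in A.
Hypothesis ha : is_bdedge A a.
Local Notation A' := ((A `\ o0) `\ o1)%fset.
Local Notation esign := (edge_sign A f).
Local Notation wqA := (wq A f).

Let eps : bool := odd `|half_turn f a.1 a.2|.

Lemma exit_timeE s n : s n \notin A -> (forall k, (k < n)%N -> s k \in A) -> exit_time A s = n.
Proof.
move=> sn sA; apply: xget_unique => // m [sm smA]; case: (ltngtP m n) => // mn.
  by move: sm; rewrite sA.
by move: sn; rewrite smA.
Qed.

Lemma exitsP s : exits A a s <-> exists n, [/\ exit_time A s = n.+1, forall k, (k <= n)%N -> s k \in A,
  s n = a.1, s n.+1 = a.2 & forall k, (0 < k <= n)%N -> s k \in A'].
Proof.
have [_ a2 _] := ha; split.
  have sA : (forall k, (k < exit_time A s)%N -> s k \in A).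
    by rewrite /exit_time; case: xgetP => [n _ []|].
  case e : (exit_time A s) sA => [|n] sA; rewrite /exits e => -[//= _ s1 s2 s3].
  exists n; split=> // k /andP[k0 kn].
  have := s3 k; rewrite k0 leqW // => /(_ isT).
  by rewrite !inE negb_or => /andP[-> ->]; exact: sA.
move=> [n [e sA s1 s2 s3]]; split; rewrite e //= => k /andP[k0]; rewrite leq_eqVlt ltnS => /predU1P[->|kn].
  by rewrite s2 !inE negb_or; apply/andP; split; apply: contra a2 => /eqP ->.
by have := s3 k; rewrite k0 kn => /(_ isT); rewrite !inE negb_or => /and3P[-> ->].
Qed.

(** The integrand takes only the values $1$, $-1$ and $0$; splitting it by sign reduces its
    expectation to two probabilities. *)
Definition exits_with (b : bool) (s : nat -> Z2) : Prop :=
  exits A a s /\ Q f (interp s) ((exit_time A s)%:R - 2^-1) = (-1) ^+ b.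

(** The interpolated path up to half a unit before the exit time uses no vertex after that time.
    Measurability of the event rests on this locality. *)
Lemma exits_with_local b s s' : exits_with b s ->
  (forall k, (k <= exit_time A s)%N -> s k = s' k) -> exits_with b s' /\ exit_time A s' = exit_time A s.
Proof.
case=> /exitsP[n [e sA s1 s2 s3]] q ss'; rewrite e in q ss' *.
have s'A k : (k <= n)%N -> s' k \in A by move=> kn; rewrite -ss' ?sA // leqW.
have e' : exit_time A s' = n.+1 by apply: exit_timeE => //; rewrite -ss' // s2; case: ha.
split=> //; split; last first.
  rewrite -q e'; apply: eq_Q => t /andP[t0 t1]; rewrite /interp.
  have tn : (Num.truncn t <= n)%N.
    by rewrite -ltnS truncn_lt_nat // (le_lt_trans t1) // gtrDl oppr_lt0 invr_gt0.
  by rewrite !ss' // leqW.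
apply/exitsP; exists n; split=> //; rewrite -?ss' //.
by move=> k /andP[k0 kn]; rewrite -ss' ?s3 ?k0 // leqW.
Qed.

Lemma signed_exitE s :
  signed_exit f A a s = (`[< exits_with false s >])%:R - (`[< exits_with true s >])%:R.
Proof.
rewrite /signed_exit /exits_with; case: asboolP => ex; last first.
  by rewrite mulr0 !asboolF ?subrr // => -[].
rewrite mulr1 /Q exprz_sign.
case: (odd _); rewrite expr0 expr1; [rewrite asboolF ?asboolT ?sub0r //|rewrite asboolT ?asboolF ?subr0 //].
  by case=> _ /esym/eqP; rewrite -subr_eq0 opprK (_ : 1 + 1 = 2%:R) // pnatr_eq0.
by case=> _ /eqP; rewrite -subr_eq0 opprK (_ : 1 + 1 = 2%:R) // pnatr_eq0.
Qed.

Section FromVertex.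
Variable z : Z2.
Hypothesis zA : z \in A.

(** Exit at time [k.+1]: [k] steps to [a.1] that avoid 0 and 1 after the start, then the boundary
    step, whose first half has the sign [eps] whatever precedes it. *)
Let tails (b : bool) k : seq (seq Z2) :=
  [seq rcons t a.2 | t <- wl k A' z a.1 & xpar esign z t (+) eps == b].

Lemma tails_exit b k t s : t \in tails b k ->
  (forall j, (j < size (z :: t))%N -> s j = nth o0 (z :: t) j) ->
  exits_with b s /\ exit_time A s = k.+1.
Proof.
have [_ a2 aa] := ha.
case/mapP=> t'; rewrite mem_filter mem_wl => /andP[/eqP eb /and4P[/eqP sk pt tA /eqP lt]] -> h.
have {}h j : (j <= k.+1)%N -> s j = nth o0 (rcons (z :: t') a.2) j.
  by move=> jk; apply: h; rewrite /= size_rcons sk.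
have hz j : (j <= k)%N -> s j = nth o0 (z :: t') j.
  by move=> jk; rewrite h ?leqW // nth_rcons /= sk ltnS jk.
have s2 : s k.+1 = a.2 by rewrite h // nth_rcons /= sk ltnn eqxx.
have s1 : s k = a.1 by rewrite hz // -sk -lt nth_last.
have tA0 : all (fun u => u \in A) (z :: t').
  by rewrite /= zA; apply: sub_all tA => u; rewrite !inE => /and3P[].
have sA j : (j <= k)%N -> s j \in A by move=> jk; rewrite hz //; apply: (allP tA0); rewrite mem_nth //= sk.
have e : exit_time A s = k.+1 by apply: exit_timeE => //; rewrite s2.
have adjs j : (j <= k)%N -> adj (s j) (s j.+1).
  rewrite leq_eqVlt => /predU1P[->|jk]; first by rewrite s1 s2.
  by rewrite !hz // 1?ltnW //; apply: (pathP o0 pt); rewrite sk.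
split=> //; split.
  apply/exitsP; exists k; split=> // -[//|j] /andP[_ jk].
  by rewrite hz //; apply: (allP tA); rewrite /= mem_nth // sk.
rewrite e (half_interp_turn hf hw0 sA adjs) s1 s2 -/eps -signr_addb -eb -[in LHS]sk.
by rewrite (@odd_edge_turns _ A f s z t') // => j; rewrite sk => /hz.
Qed.

Lemma exit_tails b s : s 0%N = z -> (forall k, adj (s k) (s k.+1)) -> exits_with b s ->
  exists k t, t \in tails b k /\ forall j, (j < size (z :: t))%N -> s j = nth o0 (z :: t) j.
Proof.
move=> s0 adjs [/exitsP[n [e sA s1 s2 s3]] q].
pose t := mkseq (fun j => s j.+1) n.
have ez j : (j <= n)%N -> s j = nth o0 (z :: t) j by case: j => [|j] jn; rewrite //= nth_mkseq.
have sz : size t = n by rewrite size_mkseq.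
have pt : path adj z t.
  by apply/(pathP o0) => j; rewrite sz => jn; rewrite -!ez // 1?ltnW //= nth_mkseq.
have lt : last z t = a.1 by rewrite -s1 ez // -sz nth_last.
have tA : all (fun u => u \in A') t.
  by apply/(all_nthP o0) => j; rewrite sz => jn; rewrite nth_mkseq // s3.
have tA0 : all (fun u => u \in A) (z :: t).
  by rewrite /= zA; apply: sub_all tA => u; rewrite !inE => /and3P[].
exists n, (rcons t a.2); split.
  apply: map_f; rewrite mem_filter mem_wl sz pt tA lt !eqxx /= andbT.
  have ot : odd `|\sum_(k < n) edge_turn f (s k) (s k.+1)| = xpar esign z t.
    by have := @odd_edge_turns _ A f s z t; rewrite sz; apply.
  move: q; rewrite e (half_interp_turn hf hw0) // s1 s2 -/eps -signr_addb ot.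
  case: (_ (+) _); case: (b) => //; rewrite expr0 expr1 => /eqP.
    by rewrite eq_sym -subr_eq0 opprK (_ : 1 + 1 = 2%:R) // pnatr_eq0.
  by rewrite -subr_eq0 opprK (_ : 1 + 1 = 2%:R) // pnatr_eq0.
move=> j; rewrite /= size_rcons sz -rcons_cons nth_rcons /= sz !ltnS leq_eqVlt => /predU1P[->|jn].
  by rewrite ltnn eqxx s2.
by move: jn; rewrite ltnS => jn; rewrite jn -ez.
Qed.
Section Probability.
Variables (d : measure_display) (Om : measurableType d).
Variables (P : probability Om R) (S : nat -> Om -> Z2).
Hypothesis hS : is_srw P S z.

Let U (b : bool) : set Om := [set o | exits_with b (S^~ o)].

Let measurable_U b : measurable (U b).
Proof.
(* There are countably many finite sequences [l]. A cylinder is kept when [l] is the prefix, up to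
   the exit time, of some trajectory in the event; by locality the event then contains the whole
   cylinder. *)
pose F l := if `[< exists2 s, exits_with b s & size l = (exit_time A s).+1 /\
  forall k, (k < size l)%N -> s k = nth o0 l k >] then cyl S l else set0.
have -> : U b = \bigcup_l F l.
  apply/seteqP; split=> o.
    move=> uo; pose l := mkseq (S^~ o) (exit_time A (S^~ o)).+1.
    have hl k : (k < size l)%N -> S k o = nth o0 l k by rewrite size_mkseq => kl; rewrite nth_mkseq.
    exists l => //; rewrite /F asboolT //.
    by exists (S^~ o) => //; split=> //; rewrite size_mkseq.
  move=> [l _]; rewrite /F; case: asboolP => // -[s us [ls sl]] ol.
  have [] // := exits_with_local us (s' := S^~ o) => k kl.
  by rewrite sl ?ls // ol // ls.
apply: countable_bigcupT_measurable => [|l]; first exact: countableP.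
by rewrite /F; case: asboolP => _; [exact: (measurable_cyl hS)|exact: measurable0].
Qed.

Let tails_series b : cvgn (series (fun k => (size (tails b k))%:R * 4 ^- k.+1 : R)).
Proof.
have := @cvg_abs_kpow R A' z a.1; apply: series_le_cvg => k.
- by rewrite mulr_ge0 // invr_ge0 exprn_ge0.
- by apply: sumr_ge0 => t _; rewrite invr_ge0 exprn_ge0.
rewrite size_map size_filter big_seq (eq_bigr (fun=> 4 ^- k)) => [|t]; last first.
  by rewrite mem_wl => /andP[/eqP ->].
rewrite -big_seq big_const_seq count_predT iter_addr_0 -[leRHS]mulr_natl.
rewrite ler_pM ?ler_nat ?count_size ?invr_ge0 ?exprn_ge0 // lef_pV2 ?posrE ?exprn_gt0 //.
by rewrite exprS ler_peMl ?exprn_ge0 // ler1n.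
Qed.

Let P_U b : P (U b) = (limn (series (fun k => (size (tails b k))%:R * 4 ^- k.+1 : R)))%:E.
Proof.
have [_ a2 aa] := ha.
have tu k : uniq (tails b k).
  by rewrite map_inj_uniq ?filter_uniq ?wl_uniq // => s t /rcons_inj[].
have tp k s : s \in tails b k -> size s = k.+1 /\ path adj z s.
  case/mapP=> t; rewrite mem_filter mem_wl => /and5P[_ /eqP sk pt _ /eqP lt] ->.
  by rewrite size_rcons sk rcons_path pt lt.
have tt k s o : s \in tails b k -> cyl S (z :: s) o -> (exit_time A (S^~ o)).-1 = k.
  by move=> sk so; have [_ ->] := tails_exit sk so.
rewrite -(@P_graded_cyls R d Om P S z hS (tails b) (fun o => (exit_time A (S^~ o)).-1) tu tp tt (@tails_series b)).
apply: (eq_on_nn_traj hS (measurable_U b)).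
  by apply: bigcupT_measurable => k; exact: (measurable_cyls hS).
move=> o /nn_trajP[S0 Sadj]; split.
  by move=> /(exit_tails S0 Sadj)[k [t [tk ot]]]; exists k => //; exists t.
by move=> [k _ [t tk ot]]; have [] := tails_exit tk ot.
Qed.

(** The factor [4^-1] is the weight of the boundary step and [(-1) ^+ eps] the sign of its half
    edge; the rest sums over the walks up to [a.1]. *)
Lemma mean_signed_exit :
  fine 'E_P[fun o => signed_exit f A a (S^~ o)]%E = 4^-1 * (-1) ^+ eps * hsum wqA A' z a.1.
Proof.
have -> : (fun o => signed_exit f A a (S^~ o)) = fun o => \1_(U false) o - \1_(U true) o :> R.
  by apply/funext => o; rewrite signed_exitE !indicE /U; congr ((_ : bool)%:R - (_ : bool)%:R);
    apply/asboolP/idP => h; rewrite ?inE // in h *.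
rewrite unlock (eq_integral (fun o => (\1_(U false) o)%:E - (\1_(U true) o)%:E)%E) //.
rewrite integralB_EFin //; try exact: integrable_indic.
have intU b : (\int[P]_o (\1_(U b) o)%:E)%E = (limn (series (fun k => (size (tails b k))%:R * 4 ^- k.+1 : R)))%:E.
  by rewrite integral_indic // setIT; exact: P_U.
rewrite !intU /= -limB; [|exact: tails_series|exact: tails_series].
have cq := @kpow_cvg R _ (wq_bound A f) A' z a.1.
have cc : (fun n => series (fun k => kpow wqA A' k z a.1) n * (4^-1 * (-1) ^+ eps)) @ \oo -->
    hsum wqA A' z a.1 * (4^-1 * (-1) ^+ eps) by apply: cvgMl; exact: cq.
rewrite [RHS]mulrC -(cvg_lim _ cc) //; congr (limn _); apply/funext => n.
rewrite /series /= -[LHS]sumrB mulr_suml; apply: eq_bigr => k _.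
have nq u u' : ~~ adj u u' -> wqA u u' = 0 by move=> /negbTE nu; rewrite /wq /wp nu !mul0r.
have sz b : (size (tails b k))%:R = \sum_(t <- wl k A' z a.1) (xpar esign z t (+) eps == b)%:R :> R.
  rewrite size_map size_filter -sum1_count natr_sum big_mkcond; apply: eq_bigr => t _.
  by case: (_ == b).
rewrite -(sum_wl k A' z a.1 nq) mulr_suml -mulrBl !sz -sumrB mulr_suml.
rewrite big_seq [RHS]big_seq; apply: eq_bigr => t; rewrite mem_wl => /and4P[/eqP sk pt _ _].
rewrite wprod_wq // sk exprS invfM.
by case: (xpar _ _ _); case: eps => /=; rewrite ?expr0 ?expr1; ring.
Qed.
End Probability.
End FromVertex.
End SignedExits.

(** * Matching both sides path by path *)

Lemma infix2_cons (x y u : Z2) s : u != x -> infix [:: x; y] (u :: s) = infix [:: x; y] s.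
Proof. by move=> ux; rewrite /= eq_sym (negbTE ux). Qed.

Lemma infix2_rcons (x y u : Z2) s : u != y -> infix [:: x; y] (rcons s u) = infix [:: x; y] s.
Proof. by move=> uy; rewrite -infix_rev rev_rcons (infix2_cons _ _ uy) -[RHS]infix_rev. Qed.

Lemma rev_cons_last (x : Z2) u : rev (x :: u) = last x u :: rev (belast x u).
Proof. by rewrite lastI rev_rcons. Qed.

Lemma splice_weight (R : realType) (p q u v c z : R) : c * c = 1 ->
  p * u * (q * v) * z = 4 * c * (u * v * c * (4^-1 * (p * q) * z)).
Proof.
by move=> cc; transitivity (c * c * (p * u * (q * v) * z)); [rewrite cc mul1r|field].
Qed.

Lemma det_factor (R : realType) (ea eb p q r s : R) :
  4^-1 * ea * p * (4^-1 * eb * q) - 4^-1 * eb * r * (4^-1 * ea * s) =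
  4 ^- 2 * (ea * eb) * (p * q - r * s).
Proof. by field. Qed.

Lemma cancel_partition (R : realType) (h z n zq z' : R) : zq != 0 -> z' != 0 ->
  h * (4 ^- 2 * z * n) = 4^-1 * (zq / z') * (z / zq) * (4 ^- 2 * (4 * n * z') * h).
Proof. by move=> q0 z0; field; rewrite q0 z0. Qed.

Section Numerator.
Variables (R : realType) (A : {fset Z2}) (f : Cx R -> Cx R) (a b : Z2 * Z2).
Hypothesis hf : is_conformal A f.
Hypothesis hw0 : DA A (w0 R).
Hypothesis cA : lconnected (fun x => x \notin A).
Hypothesis ha : is_bdedge A a.
Hypothesis hb : is_bdedge A b.
Local Notation A' := ((A `\ o0) `\ o1)%fset.
Local Notation sb := (edge_sign A f).
Local Notation wqA := (wq A f).
Local Notation wpA := (@wp R).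

Let A4 : [/\ o0 \in A, o1 \in A & (0, -1) \in A].
Proof. by have := DA_w0_corners hw0; rewrite /= !addNr !add0r => /and5P[]. Qed.

Let A0 : o0 \in A. Proof. by case: A4. Qed.
Let A1 : o1 \in A. Proof. by case: A4. Qed.
Let wA : (0, -1) \in A. Proof. by case: A4. Qed.
Let outA u v : u \notin A -> v \in A -> u != v. Proof. by move=> uA; apply: contraTneq => <-. Qed.
Let n := #|` A|.
Let etas : seq (seq Z2) := saws n (A `\ a.1)%fset a.1 b.1.

Let mem_etas g : (g \in etas) =
  [&& path adj a.1 g, uniq (a.1 :: g), all (fun u => u \in A) (a.1 :: g) & last a.1 g == b.1].
Proof.
have [a1 _ _] := ha; rewrite mem_saws; last by rewrite /n (cardfsD1 a.1 A) leq_addl.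
by rewrite all_fsetD1 /= a1 /= -!andbA; case: (path _ _ _) => //=; case: (uniq g) => //=; rewrite andbF.
Qed.

Let traverses01_bd g : traverses01 (a.2 :: rcons (a.1 :: g) b.2) = traverses01 (a.1 :: g).
Proof.
have [_ a2 _] := ha; have [_ b2 _] := hb.
rewrite /traverses01 (@infix2_cons o0 o1 a.2) ?(@infix2_cons o1 o0 a.2) ?outA //.
by rewrite (@infix2_rcons o0 o1 b.2) ?(@infix2_rcons o1 o0 b.2) ?outA.
Qed.

Let bd_walksP w : bd_walks A a b w /\ traverses01 (L w) <->
  exists2 t, lerw_tails A a.1 b.1 (fun g => traverses01 (a.1 :: g)) t & w = a.2 :: rcons (a.1 :: t) b.2.
Proof.
have [a1 a2 aa] := ha; have [b1 b2 bb] := hb.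
have LE t : L (a.2 :: rcons (a.1 :: t) b.2) = a.2 :: rcons (a.1 :: shorten a.1 t) b.2.
  by rewrite /L /= belast_rcons /= last_rcons.
have ns t : nsteps (a.2 :: rcons (a.1 :: t) b.2) = (size t).+2 by rewrite /nsteps /= size_rcons.
have ni t i : (i <= size t)%N -> nth o0 (a.2 :: rcons (a.1 :: t) b.2) i.+1 = nth o0 (a.1 :: t) i.
  by move=> it; transitivity (nth o0 (rcons (a.1 :: t) b.2) i) => //; rewrite nth_rcons ifT.
have nl t : nth o0 (a.2 :: rcons (a.1 :: t) b.2) (size t).+2 = b.2.
  by transitivity (nth o0 (rcons (a.1 :: t) b.2) (size (a.1 :: t))) => //; rewrite nth_rcons ltnn eqxx.
split=> [[[[tau0 w0a w1a] [wb1 wb2] sw wi] tr]|[t [/and3P[pt tA /eqP lt] tr] ->]]; last first.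
  rewrite LE traverses01_bd; split=> //; split; rewrite ?ns // ?nl ?ni // -?(last_nth o0 a.1 t) //.
    by rewrite /= adj_sym aa rcons_path pt lt.
  case=> // i /andP[_]; rewrite !ltnS => it; rewrite ni //.
  by case: i it => //= i it; apply: (allP tA); rewrite mem_nth.
have [t ew] : exists t, w = a.2 :: rcons (a.1 :: t) b.2.
  case: w tau0 w0a w1a wb1 wb2 {sw wi tr} => // u [//|v s] _ /= -> ->.
  (* A walk of a single step would have [a.2 = b.1], but [a.2] lies outside [A] and [b.1] inside. *)
  case/lastP: s => [/= e|s y]; first by move: a2; rewrite e b1.
  by rewrite /nsteps /= size_rcons /= nth_rcons ltnn eqxx => _ ->; exists s.
rewrite ew LE traverses01_bd in tr; exists t => //; split=> //.
have lt : last a.1 t = b.1 by rewrite (last_nth o0) -ni // -wb1 ew ns.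
have pt : path adj a.1 t by move: sw; rewrite ew /= rcons_path => /and3P[].
move: wi; rewrite ew ns => wi; apply/and3P; split=> //; last by rewrite lt.
apply/(all_nthP o0) => i it; have := wi i.+2; rewrite !ltnS it => /(_ isT).
by rewrite ni.
Qed.

Let F g : R := 4 ^- size g / loopZ wpA (fdel A (a.1 :: g)).

(** The factor [4 ^- 2] is the weight of the two boundary edges, which loop erasure keeps; between
    them stands the law of the loop-erased walk from [a.1] to [b.1]. *)
Lemma numeratorE : rsum [set w | bd_walks A a b w /\ traverses01 (L w)] (@pw R) =
  4 ^- 2 * loopZ wpA A * \sum_(g <- etas | traverses01 (a.1 :: g)) F g.
Proof.
have [a1 _ _] := ha.
have pw0 w : 0 <= pw R w by rewrite invr_ge0 exprn_ge0.
have pos : (@pw R)^\+ = @pw R by apply/funext => w; apply/max_idPl.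
have neg : (@pw R)^\- = fun=> 0 by apply/funext => w; apply/max_idPr; rewrite oppr_le0.
rewrite /rsum pos neg [X in _ - fine X]esum1 // subr0.
pose e t : seq Z2 := a.2 :: rcons (a.1 :: t) b.2.
rewrite (@reindex_esum R _ _ (lerw_tails A a.1 b.1 (fun g => traverses01 (a.1 :: g))) _ e); last first.
  split=> [t ht|t t' _ _ [/rcons_inj[]]//|w /bd_walksP[t ht ->]]; last by exists t.
  by apply/bd_walksP; exists t.
transitivity (fine (\esum_(t in lerw_tails A a.1 b.1 (fun g => traverses01 (a.1 :: g)))
    ((4 ^- 2 : R)%R%:E * (4 ^- size t : R)%R%:E))%E).
  by congr fine; apply: eq_esum => t _; rewrite /pw /nsteps /= size_rcons -EFinM -invfM -exprD.
rewrite esumZl ?invr_ge0 ?exprn_ge0 //.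
rewrite (@esum_lerw R n) ?leqnSn // /= -mulrA; congr (_ * _).
rewrite [in RHS]big_mkcond mulr_sumr big_seq [RHS]big_seq; apply: eq_bigr => g.
rewrite -/etas mem_etas => /and4P[pg _ _ _]; rewrite fdel_cons /F wprod_wp //.
by case: (traverses01 _); rewrite ?mul0r ?mulr0 // mul1r mulrCA.
Qed.

Let crossP o g : g \in etas -> infix (middle_edge o) (a.1 :: g) -> crosscut A a.1 b.1 o g.
Proof. by rewrite mem_etas => /and4P[pg ug gA /eqP lg] ig; split. Qed.

Let signs o o' g g' : crosscut A a.1 b.1 o g -> crosscut A a.1 b.1 o' g' ->
  xpar sb a.1 g (+) xpar sb a.1 g' = (o != o').
Proof.
exact: (crosscut_signs ha hb (edge_sign_sym hf hw0) (@edge_signA R A f) (edge_sign_plaq hf hw0) wA cA).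
Qed.

(** The part of [g] after 0, prolonged by [b.2], is the path from 0 to the complement of [A] that
    every remaining loop avoids; so the two loop sums agree walk by walk. *)
Lemma loopZ_off_crosscut g : g \in etas -> o0 \in a.1 :: g ->
  loopZ wqA (fdel A (a.1 :: g)) = loopZ wpA (fdel A (a.1 :: g)).
Proof.
move=> ge og; set B := fdel A _; have [b1 b2 bb] := hb.
have np u u' : ~~ adj u u' -> wpA u u' = 0 by move=> /negbTE nu; rewrite /wp nu mul0r.
have nq u u' : ~~ adj u u' -> wqA u u' = 0 by move=> /np nu; rewrite /wq nu mul0r.
congr (expR (limn (series _))); apply/funext => k; congr (_ / _).
rewrite big_seq [RHS]big_seq; apply: eq_bigr => x xB.
rewrite -(sum_wl k B x x np) -(sum_wl k B x x nq) big_seq [RHS]big_seq; apply: eq_bigr => t.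
rewrite mem_wl => /and4P[_ pt tB /eqP ct]; rewrite wprod_wq // wprod_wp //.
suff -> : xpar sb x t = false by rewrite expr0 mulr1.
have BA u : u \in B -> u \in A /\ u \notin a.1 :: g by rewrite in_fdel => /andP[].
have xtB u : u \in x :: t -> u \in B by rewrite inE => /predU1P[->//|/(allP tB)].
move: ge; rewrite mem_etas => /and4P[pg _ gA /eqP lg].
have [p [s eg]] : exists p s, a.1 :: g = p ++ o0 :: s by case/splitPr: og => p s; exists p, s.
have [ps ls] : path adj o0 s /\ last o0 s = b.1.
  have sg : sorted adj (a.1 :: g) by [].
  split; first by move: sg; rewrite eg => /cat_sorted2[].
  by have := congr1 (last o0) eg; rewrite last_cat /= lg.
apply: (loop_sign_avoiding (edge_sign_sym hf hw0) (@edge_signA R A f) (edge_sign_plaq hf hw0) wA cA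
  (s := rcons s b.2)) => //.
- by apply/allP => u /xtB/BA[].
- by rewrite rcons_path ps ls.
- by rewrite last_rcons.
apply/allP => u; rewrite -rcons_cons mem_rcons inE => /predU1P[->|us].
  by apply: contra b2 => /xtB/BA[].
apply/negP => /xtB/BA[_]; rewrite eg mem_cat us orbT //.
Qed.
Let disjoint_paths (x : Z2) u (y : Z2) v : Prop :=
  [/\ [/\ path adj x u, uniq (x :: u) & all (fun z => z \in A) (x :: u)],
      [/\ path adj y v, uniq (y :: v) & all (fun z => z \in A) (y :: v)]
    & ~~ has (mem (x :: u)) (y :: v)].

Let spliceE (x : Z2) u (y : Z2) v : last x u = a.1 ->
  a.1 :: (rev (belast x u) ++ y :: v) = rev (x :: u) ++ y :: v.
Proof. by rewrite rev_cons_last => ->. Qed.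

Let last_rev_belast (x : Z2) u : last (last x u) (rev (belast x u)) = x.
Proof. by have := congr1 (last o0) (rev_cons_last x u); rewrite rev_cons last_rcons. Qed.

Let path_rev (x : Z2) u : path adj (last x u) (rev (belast x u)) = path adj x u.
Proof. by rewrite rev_path; apply: eq_path => y z; rewrite adj_sym. Qed.

(** Cut [g] at its step from [x] to [y]: read backwards from [x] it leads to [a.1], forwards from
    [y] to [b.1], and the two paths are disjoint because [g] is simple. *)
Let splice_etas (x y : Z2) g : adj x y -> g \in etas /\ infix [:: x; y] (a.1 :: g) <->
  exists u v, [/\ disjoint_paths x u y v, last x u = a.1, last y v = b.1 & g = rev (belast x u) ++ y :: v].
Proof.
move=> xy; rewrite mem_etas; split=> [[/and4P[pg ug gA /eqP lg] /infixP[p [v e]]]|].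
  have {}e : a.1 :: g = rev (x :: rev p) ++ y :: v by rewrite rev_cons revK cat_rcons e.
  have [e1 e2] : a.1 = last x (rev p) /\ g = rev (belast x (rev p)) ++ y :: v.
    by move: e; rewrite rev_cons_last => -[].
  exists (rev p), v; split=> //; last by move: lg; rewrite e2 last_cat.
  move: pg; rewrite {1}e2 {1}e1 cat_path path_rev last_rev_belast /= => /and3P[p1 _ p2].
  move: ug gA; rewrite e cat_uniq all_cat rev_uniq all_rev => /and3P[u1 h u2] /andP[a1 a2].
  by split=> //; rewrite (eq_has (a2 := mem (rev (x :: rev p)))) // => z; rewrite /= mem_rev.
move=> [u [v [[[p1 u1 a1] [p2 u2 a2] h] l1 l2 ->]]]; rewrite spliceE //; split.
  apply/and4P; split.
  - by rewrite -{1}l1 cat_path path_rev l1 -{1}l1 last_rev_belast p1 /= xy.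
  - rewrite cat_uniq rev_uniq u1 u2 andbT.
    by rewrite (eq_has (a2 := mem (x :: u))) // => z; rewrite /= mem_rev.
  - by rewrite all_cat all_rev a1.
  - by rewrite last_cat /= l2.
by apply/infixP; exists (rev u), v; rewrite rev_cons cat_rcons.
Qed.

Let splice_inj (x y : Z2) u v u' v' : disjoint_paths x u y v -> disjoint_paths x u' y v' ->
  last x u = a.1 -> last x u' = a.1 ->
  rev (belast x u) ++ y :: v = rev (belast x u') ++ y :: v' -> u = u' /\ v = v'.
Proof.
have ix s t : ~~ has (mem (x :: s)) (y :: t) -> index y (rev (x :: s) ++ y :: t) = size (rev (x :: s)).
  by rewrite /= negb_or => /andP[ys _]; rewrite index_cat mem_rev (negbTE ys) /= eqxx addn0.
move=> [_ _ h] [_ _ h'] l l' /(congr1 (cons a.1)); rewrite !spliceE // => e.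
have es : size (rev (x :: u)) = size (rev (x :: u')) by rewrite -(ix u v) // -(ix u' v') // e.
move/eqP: e; rewrite eqseq_cat // => /andP[/eqP/(congr1 rev)]; rewrite !revK => -[->] /eqP[->].
by [].
Qed.

(** A path crossing from 0 to 1 has 0 on the side of [a.1]; one crossing from 1 to 0 has it on the
    side of [b.1]. The two directions correspond to the two products in the determinant. *)
Let va (o : bool) := if o then b.1 else a.1.
Let vb (o : bool) := if o then a.1 else b.1.

Let pairP o s t : (s \in saws n A' o0 (va o)) && (t \in saws n (fdel A' s) o1 (vb o)) <->
  [/\ disjoint_paths o0 s o1 t, last o0 s = va o & last o1 t = vb o].
Proof.
have cA' : (#|` A'| <= n)%N.
  by apply: fsubset_leq_card; apply/fsubsetP => u; rewrite !inE => /and3P[].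
rewrite !mem_saws ?(leq_trans (card_fdel _ _)) //.
have o01 : o1 != o0 by [].
split=> [/andP[/and4P[ps us sA /eqP ls] /and4P[pt ut tA /eqP lt]]|[[[ps /andP[os us] sA] [pt /andP[ot ut] tA] h] ls lt]].
  move: sA; rewrite !all_fsetD1 => /and3P[s1 s0 sA].
  have tA' u : u \in t -> [/\ u != o0, u != o1, u \in A & u \notin s].
    by move/(allP tA); rewrite in_fdel !inE => /andP[/and3P[-> -> ->] ->].
  split=> //; split; [by rewrite /= s0 us A0|split=> //=|].
  - by rewrite ut andbT; apply/negP => /tA'[_]; rewrite eqxx.
  - by rewrite A1; apply/allP => u /tA'[].
  apply/hasPn => u; rewrite inE => /predU1P[->|/tA'[u0 _ _ us']]; rewrite /= inE negb_or ?o01 //.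
  by rewrite u0.
move/hasPn: h => h; have /andP[sA0 sA1] := sA; have /andP[tA0 tA1] := tA.
have [{}us {}ut] : uniq s /\ uniq t by [].
have [{}sA1 {}tA1] : all (fun z => z \in A) s /\ all (fun z => z \in A) t by [].
rewrite ps us pt ut ls lt !eqxx !andbT /=; apply/andP; split.
  rewrite !all_fsetD1 os sA1 !andbT.
  by have := h o1 (mem_head _ _); rewrite /= inE negb_or => /andP[].
apply/allP => u ut'; rewrite in_fdel !inE (allP tA1 u ut') andbT.
have := h u; rewrite /= inE ut' orbT => /(_ isT); rewrite inE negb_or => /andP[-> ->].
by rewrite !andbT; apply: contraNneq ot => <-.
Qed.

Let splice o s t : seq Z2 :=
  if o then rev (belast o1 t) ++ o0 :: s else rev (belast o0 s) ++ o1 :: t.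

Let disjoint_pathsC x u y v : disjoint_paths x u y v -> disjoint_paths y v x u.
Proof. by case=> h1 h2 h; split=> //; rewrite has_sym. Qed.

Let adj01 : adj o0 o1. Proof. by []. Qed.

Let splice_spec o s t : disjoint_paths o0 s o1 t -> last o0 s = va o -> last o1 t = vb o ->
  [/\ a.1 :: splice o s t =i [:: o0, o1 & s ++ t], size (splice o s t) = (size s + size t).+1
    & xpar sb a.1 (splice o s t) = xpar sb o0 s (+) xpar sb o1 t (+) sb o0 o1].
Proof.
have sbC := edge_sign_sym hf hw0.
case: o => dp ls lt; rewrite /splice /=; split.
- by move=> u; rewrite spliceE // mem_cat mem_rev !inE mem_cat; do ?case: (_ == _); do ?case: (_ \in _).
- by rewrite size_cat size_rev size_belast /= addnS addnC.
- have -> : a.1 = last o1 t by rewrite lt.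
  rewrite xpar_cat (xpar_rev _ _ sbC) last_rev_belast /= (sbC o1 o0).
  by case: (xpar sb o1 t); case: (sb o0 o1); case: (xpar sb o0 s).
- by move=> u; rewrite spliceE // mem_cat mem_rev !inE mem_cat; do ?case: (_ == _); do ?case: (_ \in _).
- by rewrite size_cat size_rev size_belast /= addnS.
- have -> : a.1 = last o0 s by rewrite ls.
  rewrite xpar_cat (xpar_rev _ _ sbC) last_rev_belast /=.
  by case: (xpar sb o1 t); case: (sb o0 o1); case: (xpar sb o0 s).
Qed.

Let term s t : R := wprod wqA o0 s * wprod wqA o1 t / loopZ wqA (fdel A' (s ++ t)).

(** The factors 4 and [(-1) ^+ sb o0 o1] restore the weight and the sign of the middle edge, which
    belongs to the spliced path but to neither member of the pair. The signed partition function in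
    the denominator becomes the unsigned one by [loopZ_off_crosscut]. *)
Let sum_pairs o :
  \sum_(s <- saws n A' o0 (va o)) \sum_(t <- saws n (fdel A' s) o1 (vb o)) term s t =
  \sum_(g <- etas | infix (middle_edge o) (a.1 :: g)) 4 * (-1) ^+ sb o0 o1 * ((-1) ^+ xpar sb a.1 g * F g).
Proof.
set l := [seq splice o s t | s <- saws n A' o0 (va o), t <- saws n (fdel A' s) o1 (vb o)].
have splitP g : g \in etas /\ infix (middle_edge o) (a.1 :: g) <->
    exists s t, [/\ disjoint_paths o0 s o1 t, last o0 s = va o, last o1 t = vb o & g = splice o s t].
  rewrite /middle_edge /splice /va /vb; case: o {l}; rewrite splice_etas // 1?adj_sym //.
    by split=> -[u [v [dp l1 l2 ->]]]; exists v, u; split=> //; exact: disjoint_pathsC.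
have perm : perm_eq l [seq g <- etas | infix (middle_edge o) (a.1 :: g)].
  apply: uniq_perm; first last.
  - move=> g; rewrite mem_filter andbC; apply/allpairsPdep/andP => [[s [t [sl tl ->]]]|/splitP[s [t [dp ls lt ->]]]].
      have /pairP[dp ls lt] : (s \in saws n A' o0 (va o)) && (t \in saws n (fdel A' s) o1 (vb o)) by rewrite sl.
      by apply/splitP; exists s, t.
    have /andP[sl tl] : (s \in saws n A' o0 (va o)) && (t \in saws n (fdel A' s) o1 (vb o)) by apply/pairP.
    by exists s, t.
  - by rewrite filter_uniq // saws_uniq.
  apply: allpairs_uniq_dep => [|s _|]; [exact: saws_uniq|exact: saws_uniq|].
  move=> [s t] [s' t'] /allpairsPdep[s1 [t1 [sl tl [-> ->]]]] /allpairsPdep[s2 [t2 [sl' tl' [-> ->]]]] /=.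
  have /pairP[dp ls lt] : (s1 \in saws n A' o0 (va o)) && (t1 \in saws n (fdel A' s1) o1 (vb o)) by rewrite sl.
  have /pairP[dp' ls' lt'] : (s2 \in saws n A' o0 (va o)) && (t2 \in saws n (fdel A' s2) o1 (vb o)) by rewrite sl'.
  move: ls lt ls' lt'; rewrite /splice /va /vb; case: o {l splitP sl tl sl' tl'} => ls lt ls' lt' e.
    by have [-> ->] := splice_inj (disjoint_pathsC dp) (disjoint_pathsC dp') lt lt' e.
  by have [-> ->] := splice_inj dp dp' ls ls' e.
rewrite -[RHS]big_filter -[RHS](perm_big _ perm) [RHS]big_allpairs_dep /=.
rewrite big_seq [RHS]big_seq; apply: eq_bigr => s sl; rewrite big_seq [RHS]big_seq; apply: eq_bigr => t tl.
have /pairP[dp ls lt] : (s \in saws n A' o0 (va o)) && (t \in saws n (fdel A' s) o1 (vb o)) by rewrite sl.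
have [em es ex] := splice_spec dp ls lt.
have [ge ig] : splice o s t \in etas /\ infix (middle_edge o) (a.1 :: splice o s t).
  by apply/splitP; exists s, t.
rewrite /term /F es ex -loopZ_off_crosscut ?em ?mem_head // (eq_fdel _ em) -!fdel_cons.
case: dp => [[ps _ _] [pt _ _] _]; rewrite !wprod_wq // !signr_addb exprS exprD !invfM.
by apply: splice_weight; rewrite -signr_addb addbb.
Qed.

(* All crossings of a given direction carry the same sign, and the two
   directions carry opposite signs, so the signed sum has no cancellation. *)
Lemma det_numerator :
  `|(hsum wqA A' o0 a.1 * hsum wqA A' o1 b.1 - hsum wqA A' o0 b.1 * hsum wqA A' o1 a.1) / loopZ wqA A'| =
  4 * \sum_(g <- etas | traverses01 (a.1 :: g)) F g.
Proof.
have cA' : (#|` A'| <= n)%N.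
  by apply: fsubset_leq_card; apply/fsubsetP => u; rewrite !inE => /and3P[].
rewrite (fomin_identity (wq_bound A f) _ _ _ cA') ?inE ?eqxx // (sum_pairs false) (sum_pairs true).
(* The reference sign is read off any path through the edge 01; without such a path both sums are
   empty and any value serves. *)
have [c hc] : exists c : bool, forall o g, g \in etas -> infix (middle_edge o) (a.1 :: g) ->
    xpar sb a.1 g = c (+) o.
  have [[ o [g [ge ig]]]|no] := pselect (exists o g, g \in etas /\ infix (middle_edge o) (a.1 :: g)).
    exists (xpar sb a.1 g (+) o) => o' g' ge' ig'.
    have := signs (crossP ge ig) (crossP ge' ig').
    by case: (xpar _ _ g); case: (xpar _ _ g'); case: o {ig}; case: o' {ig'}.
  by exists false => o g ge ig; case: no; exists o, g.
have F0 g : 0 <= F g by rewrite divr_ge0 ?invr_ge0 ?exprn_ge0 // ltW // loopZ_gt0.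
have S0 : 0 <= \sum_(g <- etas | traverses01 (a.1 :: g)) F g by rewrite sumr_ge0.
pose i1 g := infix (middle_edge false) (a.1 :: g); pose i2 g := infix (middle_edge true) (a.1 :: g).
have tr g : traverses01 (a.1 :: g) = i1 g || i2 g by [].
have e : \sum_(g <- etas | i1 g) (-1) ^+ xpar sb a.1 g * F g - \sum_(g <- etas | i2 g) (-1) ^+ xpar sb a.1 g * F g =
    (-1) ^+ c * \sum_(g <- etas | traverses01 (a.1 :: g)) F g.
  rewrite mulr_sumr [RHS](bigID i1) /=; congr (_ + _).
    rewrite big_seq_cond [RHS]big_seq_cond; apply: eq_big => g.
      by rewrite tr; case: (i1 g); rewrite ?andbF.
    by case/andP=> ge ig; rewrite (hc false g ge ig) addbF.
  rewrite -sumrN big_seq_cond [RHS]big_seq_cond; apply: eq_big => g.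
    rewrite tr; case: (boolP (g \in etas)) => //= ge; case: (boolP (i1 g)) => [g1|_]; last by rewrite andbT.
    (* A path using the edge in both directions would carry both signs at once. *)
    by apply/negP => g2; have := hc false g ge g1; rewrite (hc true g ge g2); case: (c).
  by case/andP=> ge ig; rewrite (hc true g ge ig) addbT signrN mulNr opprK.
rewrite -!mulr_sumr -mulrBr.
rewrite (_ : \sum_(g <- etas | _) _ - _ = (-1) ^+ c * \sum_(g <- etas | traverses01 (a.1 :: g)) F g); last exact: e.
by rewrite !normrM !normr_sign mulr1 mul1r normr_nat ger0_norm.
Qed.
End Numerator.

Theorem theorem1p3 (R : realType) (d : measure_display) (Om : measurableType d)
  (Pr : Z2 -> probability Om R) (S : nat -> Om -> Z2)
  (hS : forall z : Z2, is_srw (Pr z) S z)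
  (A : {fset Z2}) (f : Cx R -> Cx R) (a b : Z2 * Z2)
  (hA : is_domain A)
  (hw0 : DA A (w0 R))
  (hf : is_conformal A f)
  (hcut : @edge01 R `&` branch_cut A f = set0)
  (ha : is_bdedge A a) (hb : is_bdedge A b) (hab : a <> b) :
  P_LERW R A a b = qbar f A * expR (2 * mJA f A) * Phi f Pr S A a b.
Proof.
have [A0 _ cA] := hA.
have A1 : o1 \in A by have := DA_w0_corners hw0; rewrite /= !addNr !add0r => /and5P[].
have RAE z c : z \in A -> is_bdedge A c -> RA f Pr S A z c =
    4^-1 * (-1) ^+ odd `|half_turn f c.1 c.2| * hsum (wq A f) ((A `\ o0) `\ o1)%fset z c.1.
  by move=> zA hc; rewrite /RA (mean_signed_exit hf hw0 A0 A1 hc zA (hS z)).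
have Zq0 : 0 < loopZ (wq A f) ((A `\ o0) `\ o1)%fset by exact: loopZ_gt0.
have ZA0 : 0 < loopZ (wq A f) A by exact: loopZ_gt0.
rewrite /P_LERW /Phi (numeratorE hw0 ha hb) (qbar_loopZ hf hw0 A0 A1) (exp_mJA hf hw0) /= !RAE //.
have := det_numerator hf hw0 cA ha hb.
set N := \sum_(g <- _ | _) _; set h0a := hsum _ _ o0 a.1; set h1b := hsum _ _ o1 b.1.
set h0b := hsum _ _ o0 b.1; set h1a := hsum _ _ o1 a.1.
rewrite normrM normfV (gtr0_norm Zq0) => det.
set ea := (-1) ^+ odd `|half_turn f a.1 a.2|; set eb := (-1) ^+ odd `|half_turn f b.1 b.2|.
(* The half-edge signs of [a] and of [b] form a common factor of both products, and its absolute
   value is 1. *)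
rewrite det_factor 3!normrM /ea /eb !normr_sign mulr1 mulr1 ger0_norm ?invr_ge0 ?exprn_ge0 //.
have -> : `|h0a * h1b - h0b * h1a| = 4 * N * loopZ (wq A f) ((A `\ o0) `\ o1)%fset.
  by rewrite -det divfK // gt_eqF.
by apply: cancel_partition; rewrite gt_eqF.
Qed.
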